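(* Let $0<Z<Z_c$ and let $b$ be the Brown--Ravenhall operator in $L^2(\mathbb{R}^3)\otimes\mathbb{C}^2$, with form domain $\mathcal{D}(\beta)=L^2(\mathbb{R}^3;\sqrt{1+p^2}\,d\mathbf{p})\otimes\mathbb{C}^2$. If $\lambda$ is an eigenvalue of $b$ with eigenvector $\phi$, then $$\lambda\|\phi\|^2=\int_{\mathbb{R}^3}\frac{e(0)^2}{e(p)}|\phi(\mathbf{p})|^2\,d\mathbf{p}$$ $$-\frac{\gamma}{2}e(0)\iint_{\mathbb{R}^3\times\mathbb{R}^3}\phi(\mathbf{p}')^*K^1(\mathbf{p}',\mathbf{p})\phi(\mathbf{p})\left[\frac{1}{e(p)}-\frac{e(0)}{e(p)^2}+\frac{1}{e(p')}-\frac{e(0)}{e(p')^2}\right]d\mathbf{p}'\,d\mathbf{p}$$ $$+\frac{\gamma}{2}e(0)\iint_{\mathbb{R}^3\times\mathbb{R}^3}\phi(\mathbf{p}')^*K^2(\mathbf{p}',\mathbf{p})\phi(\mathbf{p})\left[\frac{1}{e(p)}+\frac{e(0)}{e(p)^2}+\frac{1}{e(p')}+\frac{e(0)}{e(p')^2}\right]d\mathbf{p}'\,d\mathbf{p},$$ where $$K^1(\mathbf{p}',\mathbf{p})=\frac{[e(p')+e(0)][e(p)+e(0)]\,1_2}{n(p')\,|\mathbf{p}-\mathbf{p}'|^2\,n(p)},\qquad K^2(\mathbf{p}',\mathbf{p})=\frac{c^2(\mathbf{p}'\cdot\boldsymbol\sigma)(\mathbf{p}\cdot\boldsymbol\sig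ma)}{n(p')\,|\mathbf{p}-\mathbf{p}'|^2\,n(p)}.$$
   Context: Constants: $m>0$ (mass), $c>0$ (speed of light), $\alpha>0$ (fine structure constant), $Z>0$ (nuclear charge, real). Put $\gamma=\frac{\alpha c Z}{2\pi^2}$ and $Z_c=\frac{2}{(\frac{\pi}{2}+\frac{2}{\pi})\alpha}$. For $\mathbf{p}\in\mathbb{R}^3$ write $p=|\mathbf{p}|$, $e(p)=\sqrt{c^2p^2+m^2c^4}$ (so $e(0)=mc^2$), and $n(p)=[2e(p)(e(p)+e(0))]^{1/2}$. $\boldsymbol\sigma=(\sigma_1,\sigma_2,\sigma_3)$ are the Pauli matrices $\sigma_1=\begin{pmatrix}0&1\\1&0\end{pmatrix}$, $\sigma_2=\begin{pmatrix}0&-i\\i&0\end{pmatrix}$, $\sigma_3=\begin{pmatrix}1&0\\0&-1\end{pmatrix}$, $\mathbf{p}\cdot\boldsymbol\sigma=\sum_j p_j\sigma_j$, and $1_2$ is the $2\times2$ identity matrix. $^*$ denotes the Hermitian conjugate; inner products are linear in the second argument. Define the $2\times 2$ matrix kernel $$K(\mathbf{p}',\mathbf{p})=\frac{[e(p')+e(0)][e(p)+e(0)]1_2+c^2(\mathbf{p}'\cdot\boldsymbol\sigma)(\mathbf{p}\cdot\boldsymbol\sigma)}{n(p')\,|\mathbf{p}-\mathbf{p}'|^2\,n(p)}$$ and, on $\mathcal{D}(\beta)=L^2(\mathbb{R}^3;\sqrt{1+p^2}\,d\mathbf{p})\otimes\mathbb{C}^2$ (the $L^2$ space with weight $\sqrt{1+p^2}$),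 the sesquilinear form $$\beta[v,u]=\int_{\mathbb{R}^3}e(p)\,v(\mathbf{p})^*u(\mathbf{p})\,d\mathbf{p}-\gamma\iint_{\mathbb{R}^3\times\mathbb{R}^3}v(\mathbf{p}')^*K(\mathbf{p}',\mathbf{p})u(\mathbf{p})\,d\mathbf{p}'\,d\mathbf{p}.$$ For $Z<Z_c$ it is known that $\beta$ is a closed positive form in $L^2(\mathbb{R}^3)\otimes\mathbb{C}^2$ (momentum space). The Brown--Ravenhall operator $b$ is the associated positive self-adjoint operator in $L^2(\mathbb{R}^3)\otimes\mathbb{C}^2$, determined by $(v,bu)=\beta[v,u]$ for $u\in\mathcal{D}(b)$, $v\in\mathcal{D}(\beta)$. *)

(* Defs.v *)
From HB Require Import structures.
From mathcomp Require Import all_boot all_order all_algebra.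
From mathcomp Require Import spectral.
From mathcomp.real_closed Require Import complex.
From mathcomp Require Import all_classical all_reals all_analysis.

Set Implicit Arguments.
Unset Strict Implicit.
Unset Printing Implicit Defensive.

Import Order.TTheory GRing.Theory Num.Theory.
Import numFieldNormedType.Exports.

Local Open Scope classical_set_scope.
Local Open Scope ring_scope.
Local Open Scope complex_scope.
Local Open Scope sesquilinear_scope.

Section ComplexIntegral.
Context {d : measure_display} {T : measurableType d} {R : realType}.
Variable mu : {measure set T -> \bar R}.

Definition cintegrable (f : T -> R[i]) : Prop :=
  mu.-integrable setT (fun x => (complex.Re (f x))%:E) /\
  mu.-integrable setT (fun x => (complex.Im (f x))%:E).

(* As with [Rintegral], the value is meaningful only when [cintegrable f]. *)
Definition cintegral (f : T -> R[i]) : R[i] :=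
  Rintegral mu setT (fun x => complex.Re (f x)) +i*
  Rintegral mu setT (fun x => complex.Im (f x)).

End ComplexIntegral.

(* The sigma-finite structure that the library declares on [m1 \x m2] is not
   found by unification, so it is re-established for the measures used here. *)
Lemma sigma_finite_prod d1 d2 (T1 : measurableType d1) (T2 : measurableType d2)
    (R : realType) (m1 : {sigma_finite_measure set T1 -> \bar R})
    (m2 : {sigma_finite_measure set T2 -> \bar R}) :
  sigma_finite setT (m1 \x m2)%E.
Proof.
have /sigma_finiteP[F [TF ndF Foo]] := sigma_finiteT m1.
have /sigma_finiteP[G [TG ndG Goo]] := sigma_finiteT m2.
exists (fun n => F n `*` G n).
  rewrite -setXTT TF TG predeqE => -[x y]; split.
    move=> [/= [n _ Fnx] [k _ Gky]]; exists (maxn n k) => //; split.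
    - by move: x Fnx; exact/subsetPset/ndF/leq_maxl.
    - by move: y Gky; exact/subsetPset/ndG/leq_maxr.
  by move=> [n _ []/= ? ?]; split; exists n.
move=> k; have [? ?] := Foo k; have [? ?] := Goo k.
split; first exact: measurableX.
by rewrite product_measure1E// lte_mul_pinfty// ge0_fin_numE.
Qed.

Notation momentum R :=
  (measurableTypeR R * measurableTypeR R * measurableTypeR R)%type.

Notation spinor R := (momentum R -> 'cV[R[i]]_2).

Section MomentumSpace.
Variable R : realType.

Definition lebesgue2 : set (measurableTypeR R * measurableTypeR R) -> \bar R :=
  (@lebesgue_measure R \x @lebesgue_measure R)%E.

HB.instance Definition _ := Measure.on lebesgue2.
HB.instance Definition _ := Measure_isSigmaFinite.Build _ _ _ lebesgue2
  (sigma_finite_prod (@lebesgue_measure R) (@lebesgue_measure R)).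

Definition lebesgue3 : set (momentum R) -> \bar R :=
  (lebesgue2 \x @lebesgue_measure R)%E.

HB.instance Definition _ := Measure.on lebesgue3.
HB.instance Definition _ := Measure_isSigmaFinite.Build _ _ _ lebesgue3
  (sigma_finite_prod lebesgue2 (@lebesgue_measure R)).

Definition lebesgue33 : set (momentum R * momentum R) -> \bar R :=
  (lebesgue3 \x lebesgue3)%E.

HB.instance Definition _ := Measure.on lebesgue33.
HB.instance Definition _ := Measure_isSigmaFinite.Build _ _ _ lebesgue33
  (sigma_finite_prod lebesgue3 lebesgue3).

Definition coord (p : momentum R) (j : 'I_3) : R :=
  [:: (p.1.1 : R); (p.1.2 : R); (p.2 : R)]`_j.

Definition pnorm (p : momentum R) : R := Num.sqrt (\sum_j coord p j ^+ 2).

Definition pdist (p p' : momentum R) : R :=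
  Num.sqrt (\sum_j (coord p j - coord p' j) ^+ 2).

Definition mx2 (a b c d : R[i]) : 'M[R[i]]_2 :=
  \matrix_(i, j) (nth [::] [:: [:: a; b]; [:: c; d]] i)`_j.

Definition pauli (j : 'I_3) : 'M[R[i]]_2 :=
  [:: mx2 0 1 1 0; mx2 0 (- 'i) 'i 0; mx2 1 0 0 (- 1)]`_j.

Definition dot_pauli (p : momentum R) : 'M[R[i]]_2 :=
  \sum_j (coord p j)%:C *: pauli j.

(* The scalar v^* K u, the unique entry of a 1 x 1 matrix. *)
Definition sandwich (v : 'cV[R[i]]_2) (K : 'M[R[i]]_2) (u : 'cV[R[i]]_2) :
  R[i] := (v ^t* *m K *m u) 0 0.

Definition inner (v u : 'cV[R[i]]_2) : R[i] := (v ^t* *m u) 0 0.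

Definition sqnorm (u : 'cV[R[i]]_2) : R := \sum_i Normc.normc (u i 0) ^+ 2.

Definition spinor_measurable (u : spinor R) : Prop :=
  forall i : 'I_2,
    measurable_fun setT (fun p => complex.Re (u p i 0)) /\
    measurable_fun setT (fun p => complex.Im (u p i 0)).

(* L^2(R^3; w dp) (x) C^2, by representatives: elements of the space are
   classes of such functions modulo equality almost everywhere. *)
Definition weighted_L2 (w : momentum R -> R) : set (spinor R) :=
  [set u | spinor_measurable u /\
    (\int[lebesgue3]_p (w p * sqnorm (u p))%:E < +oo)%E].

Definition L2 : set (spinor R) := weighted_L2 (cst 1).

Definition L2_inner (v u : spinor R) : R[i] :=
  cintegral lebesgue3 (fun p => inner (v p) (u p)).

Definition L2_norm (u : spinor R) : R :=
  Num.sqrt (Rintegral lebesgue3 setT (fun p => sqnorm (u p))).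

(* The graph [A u w] (meaning A u = w) of the operator in L^2 associated with a
   sesquilinear form q of domain D: u belongs to the domain of the operator iff
   u is in D and v |-> q[v, u] is represented on D by some w in L^2. *)
Definition form_operator (D : set (spinor R)) (q : spinor R -> spinor R -> R[i])
    (u w : spinor R) : Prop :=
  [/\ D u, L2 w & forall v, D v -> L2_inner v w = q v u].

Definition eigenvector (A : spinor R -> spinor R -> Prop) (lambda : R[i])
    (phi : spinor R) : Prop :=
  A phi (fun p => lambda *: phi p) /\
  ~ {ae lebesgue3, forall p, phi p = 0}.

End MomentumSpace.

Section BrownRavenhall.
Variables (R : realType) (m c : R).

Definition energy (p : R) : R := Num.sqrt (c ^+ 2 * p ^+ 2 + m ^+ 2 * c ^+ 4).

Definition nfactor (p : R) : R :=
  Num.sqrt (2 * energy p * (energy p + energy 0)).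

Definition kernel_denom (p' p : momentum R) : R :=
  nfactor (pnorm p') * pdist p p' ^+ 2 * nfactor (pnorm p).

Definition kernel_num1 (p' p : momentum R) : 'M[R[i]]_2 :=
  ((energy (pnorm p') + energy 0) * (energy (pnorm p) + energy 0))%:C%:M.

Definition kernel_num2 (p' p : momentum R) : 'M[R[i]]_2 :=
  (c ^+ 2)%:C *: (dot_pauli p' *m dot_pauli p).

Definition kernel (p' p : momentum R) : 'M[R[i]]_2 :=
  (kernel_denom p' p)^-1%:C *: (kernel_num1 p' p + kernel_num2 p' p).

Definition kernel1 (p' p : momentum R) : 'M[R[i]]_2 :=
  (kernel_denom p' p)^-1%:C *: kernel_num1 p' p.

Definition kernel2 (p' p : momentum R) : 'M[R[i]]_2 :=
  (kernel_denom p' p)^-1%:C *: kernel_num2 p' p.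

Definition br_gamma (alpha Z : R) : R := alpha * c * Z / (2 * pi ^+ 2).

Definition critical_charge (alpha : R) : R :=
  2 / ((pi / 2 + 2 / pi) * alpha).

Definition br_domain : set (spinor R) :=
  weighted_L2 (fun p => Num.sqrt (1 + pnorm p ^+ 2)).

(* Both integrals converge absolutely for v, u in [br_domain] (for the second
   one, by the Hardy-Kato inequality for the kernel |p - p'|^-2).  The pair
   [q] is (p', p). *)
Definition br_form (alpha Z : R) (v u : spinor R) : R[i] :=
  cintegral (@lebesgue3 R)
    (fun p => (energy (pnorm p))%:C * inner (v p) (u p))
  - (br_gamma alpha Z)%:C *
    cintegral (@lebesgue33 R)
      (fun q => sandwich (v q.1) (kernel q.1 q.2) (u q.2)).

Definition brown_ravenhall (alpha Z : R) : spinor R -> spinor R -> Prop :=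
  form_operator br_domain (br_form alpha Z).

End BrownRavenhall.

(* Main.v *)
Require Import Defs.
From mathcomp Require Import all_boot all_order all_algebra.
From mathcomp Require Import ring lra.
From mathcomp.real_closed Require Import complex.
From mathcomp Require Import all_classical all_reals all_analysis measurable_realfun.
Import Order.TTheory GRing.Theory Num.Theory.
Import numFieldNormedType.Exports.

Set Implicit Arguments.
Unset Strict Implicit.
Unset Printing Implicit Defensive.

Local Open Scope classical_set_scope.
Local Open Scope ring_scope.
Local Open Scope complex_scope.
Import Normc.

(** The formula is a virial theorem: it expresses that the form is stationary
at an eigenvector under dilations of momentum space.

Let phi_a(p) = phi(a p).  Testing the eigenvalue equation with phi_a gives
lambda (phi_a, phi) = b[phi_a, phi].  Testing it with phi_{1/a}, substituting
p -> a p and conjugating moves the dilation from the test function to the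
form: conj(lambda) (phi_a, phi) = b_a[phi_a, phi], where b_a has the energy
e(a p) and the kernel a^3 K(a p', a p).  For a = 1 the two equations show that
lambda is real.  Their difference divided by a - 1 ([quotient_identity]) then
involves difference quotients of the energy and of the kernel only, so that
phi is never differentiated, and a -> 1 yields [virial_theorem]:
the integral of (c^2 p^2 / e) |phi|^2 equals gamma times the form of phi with
the kernel d/da (a^3 K(a p', a p)) at a = 1.

Both K and its dilations have the shape
|p - p'|^-2 (al + be (p'.sigma) (p.sigma)) with al and be products of functions
of p and p'.  The factor |p - p'|^-2 is homogeneous, hence only al and be are
differentiated; with n^2 = 2 e (e + e(0)) the derivative is K, minus e(0)/2
times the first bracket of the statement times K^1, plus e(0)/2 times the second
one times K^2.  Adding the eigenvalue equation for phi itself and using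
e - c^2 p^2 / e = e(0)^2 / e gives the claim.

Two analytic facts justify the limit.

The kernel |p - p'|^-2 defines a bounded form on the form domain
([schur_fst], [schur_snd]).  By the inequality of arithmetic and geometric
means it is at most the product of |p_j - p'_j|^(-2/3), so a Schur test with
the weights (1 + |p_j|)^(-2/3) reduces to one dimension, where the majorant of
[line_kernel_omega_le] has an elementary primitive.  The same bound holds, with
one constant, for the difference quotients of K, because those of al and of
|p'| |p| be are bounded uniformly in 1 < a <= 2, as rationalising the square
roots shows.

The dilations are strongly continuous on the form domain
([dilation_continuous_spinor]).  This is reduced to the continuity of
dilations in L^1 ([dilation_continuous_L1]), which follows from the case of the
line by averaging over the dilations themselves: on almost every ray the
function s |-> f(s x) is integrable over [1, 4], and there continuous functions
approximate it. *)

(** * Measures that scale under a transformation *)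

Section affine.
Context {R : realType}.
Notation mu := (@lebesgue_measure R).

Lemma measurable_affine (a b : R) :
  measurable_fun [set: measurableTypeR R]
    ((fun x => a * x + b) : measurableTypeR R -> measurableTypeR R).
Proof.
apply: measurable_funD; last exact: measurable_cst.
exact: mulrl_measurable.
Qed.

(** Lebesgue measure and the multiple [a] of its image under the affine map
agree on half-open intervals, hence everywhere. *)
Lemma ge0_integral_affine (a b : R) (f : R -> \bar R) : 0 < a ->
  measurable_fun setT f -> (forall x, 0 <= f x)%E ->
  (\int[mu]_x f (a * x + b)%R = (a^-1)%:E * \int[mu]_x f x)%E.
Proof.
move=> a0 mf f0.
pose T := measurableTypeR R.
have mphi := @measurable_affine a b.
pose phi : T -> T := fun x => a * x + b.
pose k : {nonneg R} := NngNum (ltW a0).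
have E A : measurable A -> mu A = mscale k (pushforward mu phi) A.
  apply: lebesgue_measure_unique => _ [[x y] _ <-] /=.
  rewrite /mscale/= /pushforward.
  rewrite (_ : _ @^-1` _ = `](x - b) / a, (y - b) / a]%classic); last first.
    apply/seteqP; split=> z /=; rewrite !in_itv/= ltr_pdivrMr// ler_pdivlMr//;
      rewrite ltrBlDr lerBrDr mulrC //.
  rewrite !lebesgue_measure_itv/= !lte_fin ltr_pM2r ?invr_gt0// ltrD2r.
  case: ifP => _; last by rewrite mule0.
  by rewrite -!EFinD -EFinM; congr EFin; field; rewrite gt_eqF.
have E2 := @eq_measure_integral _ _ _ setT
  (mscale k (pushforward mu phi)) mu f (fun A mA _ => E mphi A mA).
rewrite E2 ge0_integral_mscale//= ge0_integral_pushforward//=.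
rewrite muleA -EFinM mulVf ?gt_eqF// mul1e.
by [].
Qed.

End affine.

(** The change of variables rule for nonnegative functions is taken as the
definition, because in this form products inherit it through Tonelli's
theorem. *)
Definition scales_measure d (T : measurableType d) (R : realType)
    (mu : set T -> \bar R) (delta : T -> T) (k : R) :=
  measurable_fun setT delta /\
  forall f : T -> \bar R, measurable_fun setT f -> (forall x, 0 <= f x)%E ->
  (\int[mu]_x f (delta x) = k%:E * \int[mu]_x f x)%E.

Lemma scales_prod d1 d2 (T1 : measurableType d1) (T2 : measurableType d2)
    (R : realType) (m1 : {sigma_finite_measure set T1 -> \bar R})
    (m2 : {sigma_finite_measure set T2 -> \bar R}) delta1 delta2 k1 k2 :
  0 <= k1 -> 0 <= k2 ->
  scales_measure m1 delta1 k1 -> scales_measure m2 delta2 k2 ->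
  scales_measure (m1 \x m2)%E (fun x => (delta1 x.1, delta2 x.2)) (k1 * k2).
Proof.
move=> k10 k20 [md1 s1] [md2 s2]; split.
  by apply/measurable_fun_pair; exact: measurableT_comp.
move=> f mf f0.
rewrite fubini_tonelli1//=; last first.
  apply: measurableT_comp => //.
  by apply/measurable_fun_pair; exact: measurableT_comp.
rewrite /fubini_F/=.
under eq_integral => x _.
  rewrite (s2 (fun y => f (delta1 x, y)))//; last first.
    exact: measurableT_comp (pair1_measurable _).
  over.
rewrite (s1 (fun x => k2%:E * \int[m2]_y f (x, y))%E); last first.
- by move=> x; rewrite mule_ge0 ?lee_fin// integral_ge0.
- by apply: measurable_funeM; exact: measurable_fun_fubini_tonelli_F.
rewrite ge0_integralZl//; last 2 first.
- exact: measurable_fun_fubini_tonelli_F.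
- by move=> x _; exact: integral_ge0.
by rewrite fubini_tonelli1// muleA EFinM.
Qed.

Lemma integral_scales d (T : measurableType d) (R : realType)
    (mu : {measure set T -> \bar R}) (delta : T -> T) (k : R) (f : T -> \bar R) :
  0 <= k -> scales_measure mu delta k -> measurable_fun setT f ->
  mu.-integrable setT f ->
  (\int[mu]_x f (delta x) = k%:E * \int[mu]_x f x)%E.
Proof.
move=> k0 [md s] mf fi.
rewrite integralE [X in (_ * X)%E]integralE.
rewrite (_ : (fun x => f (delta x))^\+ = fun x => f^\+ (delta x))%E; last first.
  by apply/funext => x; rewrite !funeposE.
rewrite (_ : (fun x => f (delta x))^\- = fun x => f^\- (delta x))%E; last first.
  by apply/funext => x; rewrite !funenegE.
rewrite (s f^\+%E)//; last exact: measurable_funepos.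
rewrite (s f^\-%E)//; last exact: measurable_funeneg.
by rewrite [in RHS]muleBr//; exact: integrable_add_def.
Qed.

Lemma ge0_integral_swap d (T : measurableType d) (R : realType)
  (m1 : {sigma_finite_measure set T -> \bar R}) (f : T * T -> \bar R) :
  measurable_fun setT f -> (forall x, 0 <= f x)%E ->
  (\int[m1 \x m1]_z f (z.2, z.1) = \int[m1 \x m1]_z f z)%E.
Proof.
move=> mf f0.
rewrite fubini_tonelli1//=; last first.
  apply: measurableT_comp => //.
  exact: measurable_swap.
by rewrite fubini_tonelli2.
Qed.

(** * Continuity of dilations in L^1 *)

Section ereal_sequences.
Context {R : realType}.

Lemma ge0_cvge0 (u : nat -> \bar R) : (forall n, 0 <= u n)%E ->
  (forall e : R, 0 < e -> \forall n \near \oo, (u n <= e%:E)%E) ->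
  u n @[n --> \oo] --> 0%E.
Proof.
move=> u0 ue.
apply/fine_cvgP; split.
  near=> n; rewrite ge0_fin_numE//; apply: (@le_lt_trans _ _ 1%E); last exact: ltry.
  by near: n; exact: ue.
apply/cvgrPdist_le => e e0; near=> n; rewrite /= sub0r normrN ger0_norm ?fine_ge0//.
rewrite -lee_fin fineK; first by near: n; exact: ue.
rewrite ge0_fin_numE//; apply: (@le_lt_trans _ _ 1%E); last exact: ltry.
by near: n; exact: ue.
Unshelve. all: by end_near. Qed.

Lemma cvge0_le (u : nat -> \bar R) (e : R) : 0 < e ->
  u n @[n --> \oo] --> 0%E -> \forall n \near \oo, (u n <= e%:E)%E.
Proof.
move=> e0 /fine_cvgP[uf /cvgrPdist_le /(_ e e0) ue].
near=> n; rewrite -[u n]fineK; last by near: n.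
rewrite lee_fin (le_trans (ler_norm _))// -normrN -[- _]sub0r.
by near: n.
Unshelve. all: by end_near. Qed.

End ereal_sequences.

Lemma tonelli_in d1 d2 (T1 : measurableType d1) (T2 : measurableType d2)
    (R : realType) (m1 : {sigma_finite_measure set T1 -> \bar R})
    (m2 : {sigma_finite_measure set T2 -> \bar R}) (D : set T1)
    (f : T1 * T2 -> \bar R) :
  measurable D -> measurable_fun setT f -> (forall x, 0 <= f x)%E ->
  (\int[m1]_(x in D) \int[m2]_y f (x, y) =
   \int[m2]_y \int[m1]_(x in D) f (x, y))%E.
Proof.
move=> mD mf f0.
pose g := f \_ (D `*` setT).
have mg : measurable_fun setT g.
  by apply/(measurable_restrictT f (measurableX mD measurableT)); exact: measurable_funTS.
have g0 x : (0 <= g x)%E by rewrite /g patchE; case: ifP.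
rewrite integral_mkcond.
transitivity (\int[m1]_x \int[m2]_y g (x, y))%E.
  apply: eq_integral => x _; rewrite patchE; case: ifPn => xD.
    by apply: eq_integral => y _; rewrite /g patchE in_setX xD in_setT.
  rewrite integral0_eq// => y _; rewrite /g patchE in_setX.
  by rewrite (negbTE xD).
rewrite fubini_tonelli//; apply: eq_integral => y _.
rewrite [RHS]integral_mkcond; apply: eq_integral => x _.
by rewrite /g !patchE in_setX in_setT andbT.
Qed.

Section dilation_line.
Context {R : realType}.
Notation mu := (@lebesgue_measure R).

(** Dilating by [b] keeps [1, 2] inside [1, 4], and the Jacobian is at most 1. *)
Lemma integral_dilate_le (F : R -> \bar R) (b : R) :
  measurable_fun setT F -> (forall x, 0 <= F x)%E -> 1 <= b <= 2 ->
  (\int[mu]_(s in `[1%R, 2%R]) F (b * s)%R <= \int[mu]_(s in `[1%R, 4%R]) F s)%E.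
Proof.
move=> mF F0 /andP[b1 b2].
have b0 : 0 < b by lra.
have mG : measurable_fun setT (F \_ `[1%R, 4%R]).
  by apply/(measurable_restrictT F (measurable_itv _)); exact: measurable_funTS.
have G0 x : (0 <= (F \_ `[1%R, 4%R]) x)%E by rewrite patchE; case: ifP.
have mb : measurable_fun setT (fun s : R => b * s) by exact: mulrl_measurable.
rewrite [leRHS]integral_mkcond.
have H : (\int[mu]_x (F \_ `[1%R, 4%R]) (b * x)%R =
    (b^-1)%:E * \int[mu]_x (F \_ `[1%R, 4%R]) x)%E.
  rewrite -[RHS](@ge0_integral_affine R b 0 _ b0 mG G0).
  by apply: eq_integral => x _; rewrite addr0.
apply: (@le_trans _ _ (\int[mu]_x (F \_ `[1%R, 4%R]) (b * x)%R)%E).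
  rewrite integral_mkcond; apply: ge0_le_integral => //.
  - by move=> x _; rewrite patchE; case: ifP.
  - by apply/(measurable_restrictT (fun s => F (b * s)) (measurable_itv _)); apply: measurable_funTS; exact: measurableT_comp.
  - exact: measurableT_comp.
  - move=> x _; rewrite [X in (X <= _)%E]patchE; case: ifPn => // xI.
    rewrite patchE mem_set//=; move: xI; rewrite inE/= !in_itv/= => /andP[x1 x2].
    by apply/andP; split; nra.
rewrite H -[leRHS]mul1e; apply: lee_pmul => //.
- by rewrite lee_fin invr_ge0 ltW.
- exact: integral_ge0.
- by rewrite lee_fin invf_le1.
Qed.

(** For a continuous function this is bounded convergence.  The general case
follows by approximation in L^1 of [1, 4], an interval that contains both [s]
and [b n * s], so that the error is not enlarged by the dilation. *)
Lemma dilation_continuous_line (g : R -> R) (b : nat -> R) :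
  measurable_fun setT g ->
  mu.-integrable `[1, 4] (EFin \o g) ->
  (forall n, 1 <= b n <= 2) -> b n @[n --> \oo] --> (1 : R) ->
  (\int[mu]_(s in `[1%R, 2%R]) `|g (b n * s) - g s|%:E)%E @[n --> \oo] --> 0%E.
Proof.
move=> mg ig b12 b1.
have mI : measurable (`[1%R, 2%R] : set R) by [].
have mE : measurable (`[1%R, 4%R] : set R) by [].
have ELEB : (mu `[1%R, 4%R]%classic < +oo)%E.
  by rewrite lebesgue_measure_itv/= lte_fin ltr1n -EFinB ltry.
have mb (c : R) : measurable_fun setT (fun s : R => c * s) by exact: mulrl_measurable.
have [h_ [ch ih hg]] := approximation_continuous_integrable mE ELEB ig.
apply: ge0_cvge0 => [n|e e0]; first by apply: integral_ge0 => x _; rewrite lee_fin.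
have e3 : 0 < e / 3 by lra.
have [N _ /(_ N (leqnn N)) hN] := cvge0_le e3 hg.
pose h := h_ N; have chN := ch N; rewrite -/h in hN chN.
have mh : measurable_fun setT h by exact: continuous_measurable_fun.
have mgh : measurable_fun setT (fun z => `|g z - h z|%:E).
  by apply/measurable_EFinP; apply: measurableT_comp => //; exact: measurable_funB.
have mid : (\int[mu]_(s in `[1%R, 2%R]) `|h (b n * s) - h s|%:E)%E @[n --> \oo] --> 0%E.
  have [M [_ hM]] : bounded_set (h @` `[1, 4]).
    apply: compact_bounded; apply: continuous_compact; last exact: segment_compact.
    exact: continuous_subspaceT.
  have {}hM x : 1 <= x <= 4 -> `|h x| <= `|M| + 1.
    move=> x14; apply: (hM (`|M| + 1)); first by rewrite (le_lt_trans (ler_norm _))// ltrDl.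
    by exists x => //=; rewrite in_itv.
  have := @dominated_convergence _ _ _ mu `[1, 2] mI
    (fun n s => `|h (b n * s) - h s|%:E) (cst 0%E) (cst (2 * (`|M| + 1))%:E).
  move=> []//.
  - move=> n; apply: measurable_funTS; apply/measurable_EFinP.
    apply: measurableT_comp => //; apply: measurable_funB => //.
    exact: (measurableT_comp mh (mb _)).
  - apply: aeW => s _; apply: cvg_EFin.
      by apply: nearW => n.
    rewrite -[X in _ --> X](normr0 R); apply: cvg_norm.
    rewrite -[X in _ --> X](subrr (h s)); apply: cvgB; last exact: cvg_cst.
    have bs : b n * s @[n --> \oo] --> (s : R).
      by rewrite -[X in _ --> X]mul1r; apply: cvgM => //; exact: cvg_cst.
    by apply: continuous_cvg => //; exact: chN.
  - apply/integrableP; split => //.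
    rewrite (eq_integral (cst (2 * (`|M| + 1))%:E)); last first.
      by move=> x _; rewrite /= ger0_norm// mulr_ge0// addr_ge0.
    rewrite integral_cst//= lebesgue_measure_itv/= lte_fin ltr1n -EFinB -EFinM.
    exact: ltry.
  - apply: aeW => s n; rewrite /= in_itv/= => /andP[s1 s2].
    have /andP[B1 B2] := b12 n.
    rewrite lee_fin normr_id (le_trans (ler_normB _ _))// mulr2n mulrDl mul1r.
    apply: lerD; apply: hM; apply/andP; split; nra.
  - by rewrite integral0_eq.
have := cvge0_le e3 mid; apply: filterS => n midn.
have mgb : measurable_fun setT (fun x => g (b n * x)) by exact: (measurableT_comp mg (mb _)).
have mhb : measurable_fun setT (fun x => h (b n * x)) by exact: (measurableT_comp mh (mb _)).
have m1 : measurable_fun setT (fun s => `|g (b n * s) - h (b n * s)|%:E).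
  by apply/measurable_EFinP; apply: measurableT_comp => //; exact: measurable_funB.
have m2 : measurable_fun setT (fun s => `|h (b n * s) - h s|%:E).
  by apply/measurable_EFinP; apply: measurableT_comp => //; exact: measurable_funB.
apply: (@le_trans _ _ (\int[mu]_(s in `[1%R, 2%R])
   (`|g (b n * s) - h (b n * s)|%:E + `|h (b n * s) - h s|%:E + `|g s - h s|%:E))%E).
  apply: ge0_le_integral => //.
  - apply: measurable_funTS; apply/measurable_EFinP; apply: measurableT_comp => //.
    exact: measurable_funB.
  - by apply: measurable_funTS; apply: emeasurable_funD => //; apply: emeasurable_funD.
  - move=> s _; rewrite -!EFinD lee_fin.
    have -> : g (b n * s) - g s = (g (b n * s) - h (b n * s)) + (h (b n * s) - h s) - (g s - h s) by ring.
    by rewrite (le_trans (ler_normB _ _))// lerD2r ler_normD.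
rewrite ge0_integralD//; last 3 first.
- by move=> x _; rewrite -EFinD lee_fin addr_ge0.
- by apply: measurable_funTS; apply: emeasurable_funD.
- exact: measurable_funTS.
rewrite ge0_integralD//; last 2 first.
- exact: measurable_funTS.
- exact: measurable_funTS.
have -> : e%:E = ((e / 3)%:E + (e / 3)%:E + (e / 3)%:E)%E by rewrite -!EFinD; congr EFin; field.
apply: leeD; first apply: leeD => //.
- apply: le_trans hN; exact: (@integral_dilate_le (fun z => `|g z - h z|%:E)).
- apply: le_trans hN; apply: ge0_subset_integral => //.
  + exact: measurable_funTS.
  + by apply: subset_itvl; rewrite bnd_simp ler_nat.
Qed.

End dilation_line.

Section dilation_space.
Context d (T : measurableType d) {R : realType}.
Variables (nu : {sigma_finite_measure set T -> \bar R}) (delta : R -> T -> T).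
Notation mu := (@lebesgue_measure R).
Hypothesis mdelta : measurable_fun [set: measurableTypeR R * T] (fun z => delta z.1 z.2).
Hypothesis deltaM : forall (s t : R) x, 0 < s -> 0 < t -> delta s (delta t x) = delta (s * t) x.
Variable D : nat.
Hypothesis delta_scales : forall s : R, 0 < s -> scales_measure nu (delta s) (s ^- D).

(** The integral of |f(b s x) - f(s x)| over [x] is [s ^- D] times the one for
[s = 1], so averaging over [s] in [1, 2] loses only the factor [2 ^ D].  After
exchanging the integrals, the inner one runs along the ray through [x], where
the result on the line applies, with twice the integral over [1, 4] as a
majorant.  In this way only the line needs a topology. *)
Lemma dilation_continuous_L1 (f : T -> R) (b : nat -> R) :
  measurable_fun setT f -> (forall x, 0 <= f x) ->
  (\int[nu]_x (f x)%:E < +oo)%E ->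
  (forall n, 1 <= b n <= 2) -> b n @[n --> \oo] --> (1 : R) ->
  (\int[nu]_x `|f (delta (b n) x) - f x|%:E)%E @[n --> \oo] --> 0%E.
Proof.
move=> mf f0 fi b12 b1.
have b0 n : 0 < b n by have /andP[+ _] := b12 n; apply: lt_le_trans.
have mI : measurable (`[1%R, 2%R] : set R) by [].
have mE : measurable (`[1%R, 4%R] : set R) by [].
have mfd : measurable_fun [set: measurableTypeR R * T] (fun z => f (delta z.1 z.2)).
  exact: measurableT_comp.
have mray x : measurable_fun [set: measurableTypeR R] (fun s => f (delta s x)).
  exact: (measurableT_comp mfd (pair2_measurable x)).
have mdil s : measurable_fun setT (fun x => f (delta s x)).
  exact: (measurableT_comp mfd (pair1_measurable (s : measurableTypeR R))).
pose G x := (\int[mu]_(s in `[1%R, 4%R]) (f (delta s x))%:E)%E.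
pose J n x := (\int[mu]_(s in `[1%R, 2%R]) `|f (delta (b n * s) x) - f (delta s x)|%:E)%E.
have G0 x : (0 <= G x)%E by apply: integral_ge0 => s _; rewrite lee_fin.
have mG : measurable_fun setT G.
  rewrite (_ : G = fun x => (\int[mu]_s
      ((fun z => (f (delta z.1 z.2))%:E) \_ (`[1%R, 4%R] `*` setT)) (s, x))%E).
    apply: (@measurable_fun_fubini_tonelli_G _ _ (measurableTypeR R) T R mu) => //.
      apply/(measurable_restrictT _ (measurableX mE measurableT)).
      by apply: measurable_funTS; apply/measurable_EFinP.
    by move=> z; rewrite patchE; case: ifP => // _; rewrite lee_fin.
  apply/funext => x; rewrite /G integral_mkcond; apply: eq_integral => s _.
  by rewrite !patchE in_setX in_setT andbT.
have mJ n : measurable_fun setT (J n).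
  rewrite (_ : J n = fun x => (\int[mu]_s
      ((fun z => `|f (delta (b n * z.1) z.2) - f (delta z.1 z.2)|%:E)
         \_ (`[1%R, 2%R] `*` setT)) (s, x))%E).
    apply: (@measurable_fun_fubini_tonelli_G _ _ (measurableTypeR R) T R mu) => //.
      apply/(measurable_restrictT _ (measurableX mI measurableT)).
      apply: measurable_funTS; apply/measurable_EFinP.
      apply: measurableT_comp => //; apply: measurable_funB => //.
      have mm : measurable_fun [set: measurableTypeR R * T]
          (fun z => (b n * z.1 : measurableTypeR R, z.2)).
        apply/measurable_fun_pair => //.
        exact: (measurableT_comp (mulrl_measurable (b n)) measurable_fst).
      exact: (measurableT_comp mfd mm).
    by move=> z; rewrite patchE; case: ifP => // _; rewrite lee_fin.
  apply/funext => x; rewrite /J integral_mkcond; apply: eq_integral => s _.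
  by rewrite !patchE in_setX in_setT andbT.
have iG : nu.-integrable setT G.
  apply/integrableP; split => //.
  under eq_integral => x _ do rewrite gee0_abs//.
  rewrite /G -(@tonelli_in _ _ (measurableTypeR R) T R mu nu _ (fun z => (f (delta z.1 z.2))%:E))//; last 2 first.
  - exact/measurable_EFinP.
  - by move=> z; rewrite lee_fin.
  have fi0 : (0 <= \int[nu]_x (f x)%:E)%E.
    by apply: integral_ge0 => x _; rewrite lee_fin.
  apply: (@le_lt_trans _ _ (\int[mu]_(s in `[1%R, 4%R]) (cst (\int[nu]_x (f x)%:E) s))%E).
    apply: ge0_le_integral => //.
    - by move=> s _; apply: integral_ge0 => x _; rewrite lee_fin.
    - apply: measurable_funTS.
      apply: (@measurable_fun_fubini_tonelli_F _ _ (measurableTypeR R) T R nu (fun z => (f (delta z.1 z.2))%:E)) => //.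
        exact/measurable_EFinP.
      by move=> z; rewrite lee_fin.
    - move=> s /=; rewrite in_itv/= => /andP[s1 s4].
      have s0 : 0 < s by rewrite (lt_le_trans _ s1).
      have [_ /(_ (fun x => (f x)%:E)) ->//] := delta_scales s0; last by apply/measurable_EFinP.
      rewrite -[leRHS]mul1e; apply: lee_pmul => //.
        by rewrite lee_fin invr_ge0 exprn_ge0// ltW.
      by rewrite lee_fin invf_le1 ?exprn_gt0// exprn_ege1.
  rewrite integral_cst//= lebesgue_measure_itv/= lte_fin ltr1n -EFinB.
  by rewrite lte_mul_pinfty// ?ltry// ge0_fin_numE.
have JG n x : (J n x <= 2%:E * G x)%E.
  apply: (@le_trans _ _ (\int[mu]_(s in `[1%R, 2%R])
      ((f (delta (b n * s) x))%:E + (f (delta s x))%:E))%E).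
    have mbx : measurable_fun [set: measurableTypeR R] (fun s => f (delta (b n * s) x)).
      exact: (measurableT_comp (mray x) (mulrl_measurable (b n))).
    apply: ge0_le_integral => //.
    - apply: measurable_funTS; apply/measurable_EFinP; apply: measurableT_comp => //.
      exact: measurable_funB.
    - by apply: measurable_funTS; apply: emeasurable_funD; apply/measurable_EFinP.
    - move=> s _; rewrite -EFinD lee_fin (le_trans (ler_normB _ _))//.
      by rewrite !ger0_norm.
  have mbx : measurable_fun [set: measurableTypeR R] (fun s => f (delta (b n * s) x)).
    exact: (measurableT_comp (mray x) (mulrl_measurable (b n))).
  rewrite ge0_integralD//; last 4 first.
  - by move=> s _; rewrite lee_fin.
  - by apply: measurable_funTS; apply/measurable_EFinP.
  - by move=> s _; rewrite lee_fin.
  - by apply: measurable_funTS; apply/measurable_EFinP.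
  rewrite (_ : 2%:E * G x = G x + G x)%E; last first.
    by rewrite -mule2n muleC mule_natr.
  apply: leeD.
    apply: (@integral_dilate_le R (fun s => (f (delta s x))%:E)) => //.
    - by apply/measurable_EFinP; exact: mray.
    - by move=> y; rewrite lee_fin.
  apply: ge0_subset_integral => //.
  - by apply: measurable_funTS; apply/measurable_EFinP.
  - by move=> s _; rewrite lee_fin.
  - by apply: subset_itvl; rewrite bnd_simp ler_nat.
have J0 n x : (0 <= J n x)%E by apply: integral_ge0 => s _; rewrite lee_fin.
have Jlim : (\int[nu]_x J n x)%E @[n --> \oo] --> 0%E.
  have := @dominated_convergence _ _ _ nu setT measurableT J (cst 0%E)
    (fun x => 2%:E * G x)%E.
  move=> []//.
  - have := integrable_ae measurableT iG; apply: filterS => x /(_ I) Gx _.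
    apply: dilation_continuous_line => //; first exact: mray.
    apply/integrableP; split.
      by apply: measurable_funTS; apply/measurable_EFinP; exact: mray.
    rewrite /= (_ : (\int[_]_(_ in _) _)%E = G x).
      by rewrite -ge0_fin_numE.
    by apply: eq_integral => s _; rewrite /= ger0_norm.
  - exact: integrableZl.
  - by apply: aeW => x n _; rewrite gee0_abs.
  - by rewrite integral0.
pose H n := (\int[nu]_x `|f (delta (b n) x) - f x|%:E)%E.
have H0 n : (0 <= H n)%E by apply: integral_ge0 => x _; rewrite lee_fin.
have HJ n : ((2 ^- D)%:E * H n <= \int[nu]_x J n x)%E.
  rewrite /J -(@tonelli_in _ _ (measurableTypeR R) T R mu nu _
    (fun z => `|f (delta (b n * z.1) z.2) - f (delta z.1 z.2)|%:E))//; last first.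
    apply/measurable_EFinP.
    apply: measurableT_comp => //; apply: measurable_funB => //.
    have mm : measurable_fun [set: measurableTypeR R * T]
        (fun z => (b n * z.1 : measurableTypeR R, z.2)).
      apply/measurable_fun_pair => //.
      exact: (measurableT_comp (mulrl_measurable (b n)) measurable_fst).
    exact: (measurableT_comp mfd mm).
  rewrite [leLHS](_ : _ = \int[mu]_(s in `[1%R, 2%R]) (cst ((2 ^- D)%:E * H n) s))%E; last first.
    rewrite integral_cst//= lebesgue_measure_itv/= lte_fin ltr1n -EFinB.
    by rewrite (_ : 2 - 1 = 1 :> R) ?mule1//; ring.
  apply: ge0_le_integral => //.
  - by move=> s _; rewrite mule_ge0.
  - apply: measurable_funTS.
    apply: (@measurable_fun_fubini_tonelli_F _ _ (measurableTypeR R) T R nu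
      (fun z => `|f (delta (b n * z.1) z.2) - f (delta z.1 z.2)|%:E)) => //.
    apply/measurable_EFinP.
    apply: measurableT_comp => //; apply: measurable_funB => //.
    have mm : measurable_fun [set: measurableTypeR R * T]
        (fun z => (b n * z.1 : measurableTypeR R, z.2)).
      apply/measurable_fun_pair => //.
      exact: (measurableT_comp (mulrl_measurable (b n)) measurable_fst).
    exact: (measurableT_comp mfd mm).
  - move=> s /=; rewrite in_itv/= => /andP[s1 s2].
    have s0 : 0 < s by rewrite (lt_le_trans _ s1).
    rewrite (eq_integral (fun x => `|f (delta (b n) (delta s x)) - f (delta s x)|%:E)); last first.
      by move=> x _; rewrite deltaM.
    have [_ /(_ (fun x => `|f (delta (b n) x) - f x|%:E)) ->//] := delta_scales s0.
      rewrite lee_wpmul2r// lee_fin lef_pV2 ?posrE ?exprn_gt0// lerXn2r// nnegrE ltW//.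
    by apply/measurable_EFinP; apply: measurableT_comp => //; exact: measurable_funB.
apply: ge0_cvge0 => // e e0.
have e1 : 0 < 2 ^- D * e :> R by rewrite mulr_gt0// invr_gt0 exprn_gt0.
have := cvge0_le e1 Jlim; apply: filterS => n Jn.
have := le_trans (HJ n) Jn.
by rewrite EFinM lee_pmul2l// lte_fin invr_gt0 exprn_gt0.
Qed.

End dilation_space.

(** * Inverse, square root and cube root *)

Section measurable_real_operations.
Context {R : realType}.

Lemma measurable_inv : measurable_fun [set: R] (fun x : R => x^-1).
Proof.
rewrite (_ : (fun x : R => x^-1) = fun x => x * (x ^+ 2) `^ (-1)).
  apply: measurable_funM => //.
  exact: (measurableT_comp (measurable_powR (-1)) (@exprn_measurable R setT 2)).
apply/funext => x; rewrite powR_inv1 ?sqr_ge0//.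
by have [->|x0] := eqVneq x 0; [rewrite invr0 mul0r|field].
Qed.

Lemma measurable_sqrt : measurable_fun [set: R] (Num.sqrt : R -> R).
Proof.
rewrite (_ : (Num.sqrt : R -> R) = fun x => (Num.max x 0) `^ 2^-1).
  apply: (measurableT_comp (measurable_powR _)).
  exact: measurable_maxr.
apply/funext => x; rewrite powR12_sqrt ?le_max ?lexx ?orbT//.
by case: (leP x 0) => // x0; rewrite sqrtr0 ler0_sqrtr.
Qed.

Context d (T : measurableType d).
Implicit Types f : T -> R.

Lemma measurable_funV f : measurable_fun setT f ->
  measurable_fun setT (fun x => (f x)^-1).
Proof. exact: (measurableT_comp measurable_inv). Qed.

Lemma measurable_fun_sqrt f : measurable_fun setT f ->
  measurable_fun setT (fun x => Num.sqrt (f x)).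
Proof. exact: (measurableT_comp measurable_sqrt). Qed.

End measurable_real_operations.

Section cube_root.
Context {R : realType}.
Implicit Types t s : R.

Definition cbrt t : R := t `^ 3^-1.

Lemma cbrt_gt0 t : 0 < t -> 0 < cbrt t.
Proof. exact: powR_gt0. Qed.

Lemma cbrtK t : 0 <= t -> cbrt t ^+ 3 = t.
Proof.
by move=> t0; rewrite -powR_mulrn ?powR_ge0// -powRrM mulVf ?powRr1// pnatr_eq0.
Qed.

Lemma measurable_cbrt : measurable_fun setT cbrt.
Proof. exact: measurable_powR. Qed.

Lemma is_derive_cbrt t : 0 < t -> is_derive t 1 cbrt (3 * cbrt t ^+ 2)^-1.
Proof.
move=> t0; have := is_derive1_powR (3^-1) t0; congr (is_derive _ _ _ _).
have c0 := cbrt_gt0 t0.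
rewrite powRB ?(gt_eqF t0) ?implybT// (powRr1 (ltW t0)) -/(cbrt t).
rewrite -[X in _ / X](cbrtK (ltW t0)).
by field; rewrite gt_eqF.
Qed.

Lemma cbrt_continuous t : 0 < t -> {for t, continuous cbrt}.
Proof.
move=> t0; have [+ _] := is_derive_cbrt t0.
by move/derivable1_diffP/differentiable_continuous.
Qed.

End cube_root.

(** * The Schur test for |x - y|^(-2/3) on the line *)

Section half_line.
Context {R : realType}.
Notation mu := (@lebesgue_measure R).

(** Evaluated at |x - y| and at |y|, for [s = (1 + |x|)^(1/3)], this majorises the
Schur integrand near its singularities at [y = x] and [y = 0]; the shape is
dictated by the elementary primitive [3 y^(1/3) / (s (y^(1/3) + s))]. *)
Definition schur_profile (s y : R) : R := (cbrt y ^+ 2 * (cbrt y + s) ^+ 2)^-1.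

Lemma integral_schur_profile_le (s : R) : 0 < s ->
  (\int[mu]_(y in `]0%R, +oo[) (schur_profile s y)%:E <= (3 / s)%:E)%E.
Proof.
move=> s0.
pose F y := 3 * (cbrt y / (s * (cbrt y + s))).
have dF (y : R) : 0 < y -> is_derive y 1 F (schur_profile s y).
  move=> y0; have c0 := cbrt_gt0 y0.
  have dc := is_derive_cbrt y0.
  have cs : cbrt y + s != 0 by rewrite gt_eqF ?addr_gt0.
  rewrite /F.
  have d1 : is_derive y 1 (fun y => s * (cbrt y + s)) (s * (3 * cbrt y ^+ 2)^-1).
    by apply: is_derive_eq; rewrite /GRing.scale/= addr0.
  have sne : s * (cbrt y + s) != 0 by rewrite mulf_neq0// gt_eqF.
  have d2 := @is_deriveV R (fun y => s * (cbrt y + s)) y _ 1 sne d1.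
  have d3 := is_deriveM dc d2.
  apply: (is_derive_eq (is_deriveZ 3 d3)).
  rewrite /GRing.scale/= /schur_profile; field.
  by rewrite cs !gt_eqF.
have FTC (a b : R) : 0 < a -> a < b ->
    (\int[mu]_(y in `[a, b]) (schur_profile s y)%:E <= (3 / s)%:E)%E.
  move=> a0 ab.
  rewrite (@continuous_FTC2 _ (schur_profile s) F)//.
  - rewrite -EFinB lee_fin /F.
    have ca := cbrt_gt0 a0; have cb := cbrt_gt0 (lt_trans a0 ab).
    have : 0 < cbrt a / (s * (cbrt a + s)) by rewrite divr_gt0 ?mulr_gt0 ?addr_gt0.
    have : cbrt b / (s * (cbrt b + s)) <= s^-1.
      rewrite ler_pdivrMr ?mulr_gt0 ?addr_gt0// mulKf ?gt_eqF//; lra.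
    lra.
  - apply: continuous_in_subspaceT => y; rewrite inE/= in_itv/= => /andP[ay _].
    have y0 : 0 < y by exact: lt_le_trans ay.
    have c0 := cbrt_gt0 y0; have cc := cbrt_continuous y0.
    rewrite /schur_profile; apply: cvgV.
      by rewrite gt_eqF// mulr_gt0 ?exprn_gt0 ?addr_gt0.
    have cs : cbrt z + s @[z --> y] --> cbrt y + s by apply: cvgD => //; exact: cvg_cst.
    exact: (cvgM (cvgM cc cc) (cvgM cs cs)).
  - split.
    + move=> y; rewrite in_itv/= => /andP[ay _].
      by have [] := dF y (lt_trans a0 ay).
    + apply: cvg_at_right_filter.
      by have [/derivable1_diffP/differentiable_continuous] := dF a a0.
    + apply: cvg_at_left_filter.
      by have [/derivable1_diffP/differentiable_continuous] := dF b (lt_trans a0 ab).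
  - move=> y; rewrite in_itv/= => /andP[ay _].
    by have [_] := dF y (lt_trans a0 ay); rewrite derive1E.
have g0 y : 0 <= schur_profile s y by rewrite invr_ge0 mulr_ge0// sqr_ge0.
have mg : measurable_fun setT (schur_profile s).
  rewrite /schur_profile; apply: measurable_funTS.
  apply: measurable_funV.
  apply: measurable_funM; apply: measurable_funX; first exact: measurable_cbrt.
  by apply: measurable_funD => //; exact: measurable_cbrt.
pose S (n : nat) := `[(n.+1%:R^-1 : R), n.+2%:R]%classic.
have SU : \bigcup_n S n = `]0, +oo[%classic.
  apply/seteqP; split=> [y [n _]|y]; rewrite /S/= !in_itv/= ?andbT.
    by move=> /andP[+ _]; apply: lt_le_trans; rewrite invr_gt0.
  move=> y0; exists (maxn (Num.trunc y) (Num.trunc y^-1)) => //=.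
  rewrite in_itv/=; apply/andP; split.
    rewrite invf_ple ?posrE//.
    apply: (le_trans (ltW (truncnS_gt _))); rewrite ler_nat ltnS leq_maxr//.
  apply: (le_trans (ltW (truncnS_gt _))); rewrite ler_nat ltnS leqW// leq_maxl//.
rewrite -SU.
apply: (@cvge_le _ \oo _ R (fun i => \int[mu]_(x in S i) (schur_profile s x)%:E)%E); last first.
  apply: ge0_nondecreasing_set_cvg_integral => //.
  - move=> m n mn; apply/subsetPset; apply: subset_itvScc.
      by rewrite bnd_simp lef_pV2 ?posrE// ler_nat.
    by rewrite bnd_simp ler_nat.
  - by move=> i; exact: measurable_itv.
  - by move=> i; apply: measurable_funTS; apply/measurable_EFinP.
  - by move=> i x _; rewrite /= lee_fin.
apply: nearW => n; apply: FTC; first by rewrite invr_gt0.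
by rewrite (@le_lt_trans _ _ 1)// ?ltr1n// invf_le1// ler1n.
Qed.

End half_line.

Section schur_line.
Context {R : realType}.
Notation mu := (@lebesgue_measure R).

Definition schur_majorant (s y : R) : \bar R :=
  if y == 0 then +oo%E else (schur_profile s `|y|)%:E.

(** The function |x|^(-2/3).  The value at 0 has to be infinite for
[inv_pdist_le] to hold where a single coordinate of [p - p'] vanishes. *)
Definition line_kernel (x : R) : \bar R :=
  if x == 0 then +oo%E else ((cbrt `|x| ^+ 2)^-1)%:E.

(** The Schur weight on the line is [omega ^- 2], that is (1 + |x|)^(-2/3). *)
Definition omega (x : R) : R := cbrt (1 + `|x|).

Lemma schur_profile_ge0 (s y : R) : 0 <= schur_profile s y.
Proof. by rewrite invr_ge0 mulr_ge0// sqr_ge0. Qed.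

Lemma measurable_schur_profile (s : R) : measurable_fun setT (schur_profile s).
Proof.
apply: measurable_funV.
apply: measurable_funM; apply: measurable_funX; first exact: measurable_cbrt.
by apply: measurable_funD => //; exact: measurable_cbrt.
Qed.

Lemma schur_majorant0 s : schur_majorant s 0 = +oo%E.
Proof. by rewrite /schur_majorant eqxx. Qed.

Lemma schur_majorant_ge0 s y : (0 <= schur_majorant s y)%E.
Proof. by rewrite /schur_majorant; case: ifP => //; rewrite lee_fin schur_profile_ge0. Qed.

Lemma measurable_schur_majorant s : measurable_fun setT (schur_majorant s).
Proof.
apply: measurable_fun_ifT => //; first exact: measurable_fun_eqr.
apply/measurable_EFinP; apply: (measurableT_comp (measurable_schur_profile s)).
exact: normr_measurable.
Qed.

Lemma line_kernel_ge0 x : (0 <= line_kernel x)%E.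
Proof. by rewrite /line_kernel; case: ifP => //; rewrite lee_fin invr_ge0 sqr_ge0. Qed.

Lemma measurable_line_kernel : measurable_fun setT line_kernel.
Proof.
apply: measurable_fun_ifT => //; first exact: measurable_fun_eqr.
apply/measurable_EFinP; apply: measurable_funV; apply: measurable_funX.
exact: (measurableT_comp measurable_cbrt (@normr_measurable R setT)).
Qed.

Lemma omega_gt0 x : 0 < omega x.
Proof. by apply: cbrt_gt0; rewrite ltr_pwDl. Qed.

Lemma omegaK x : omega x ^+ 3 = 1 + `|x|.
Proof. by apply: cbrtK; rewrite addr_ge0. Qed.

Lemma measurable_omega : measurable_fun setT omega.
Proof.
apply: (measurableT_comp measurable_cbrt).
by apply: measurable_funD => //; exact: normr_measurable.
Qed.

Lemma integral_schur_majorant_le s : 0 < s -> (\int[mu]_y schur_majorant s y <= (6 / s)%:E)%E.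
Proof.
move=> s0.
have mg := measurable_schur_majorant s.
rewrite (_ : setT = `]-oo, 0%R] `|` `]0%R, +oo[); last first.
  apply/seteqP; split=> // x _; rewrite /= !in_itv/= andbT.
  by have [x0|x0] := leP x 0; [left|right].
rewrite ge0_integral_setU//; last 3 first.
- exact: measurable_funTS.
- by move=> x _; exact: schur_majorant_ge0.
- apply/disj_setPS => x []; rewrite /= !in_itv/= andbT => x0 /(le_lt_trans x0).
  by rewrite ltxx.
have H : (\int[mu]_(y in `]0%R, +oo[) schur_majorant s y <= (3 / s)%:E)%E.
  apply: le_trans (integral_schur_profile_le s0); apply: ge0_le_integral => //.
  - by move=> x _; exact: schur_majorant_ge0.
  - exact: measurable_funTS.
  - by apply: measurable_funTS; apply/measurable_EFinP; exact: measurable_schur_profile.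
  - move=> x; rewrite /= in_itv/= andbT => x0.
    by rewrite /schur_majorant gt_eqF// gtr0_norm.
have -> : (6 / s)%:E = ((3 / s)%:E + (3 / s)%:E)%E.
  by rewrite -EFinD; congr EFin; field; rewrite gt_eqF.
apply: leeD => //; apply: le_trans H.
rewrite integral_itv_obnd_cbnd; last exact: measurable_funTS.
rewrite ge0_integration_by_substitution0//; last by move=> r; exact: schur_majorant_ge0.
by under [leRHS]eq_integral => x _ do rewrite /schur_majorant oppr_eq0 normrN.
Qed.

(** As 1 + |x| <= (1 + |y|) + |x - y|, the larger one of [omega y] and
|x - y|^(1/3) is at least [omega x / 2] and can replace the nonsingular factor
of the profile; the smaller one keeps its singularity. *)
Lemma line_kernel_omega_le x y :
  (line_kernel (x - y)%R * ((omega y ^+ 2)^-1)%:E <=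
   9%:E * (schur_majorant (omega x) (x - y)%R + schur_majorant (omega x) y))%E.
Proof.
have w0 := omega_gt0.
have [xy0|xy0] := eqVneq (x - y) 0.
  rewrite xy0 schur_majorant0 addye ?gt0_muley ?leey// ?lte_fin//.
  by rewrite gt_eqF// (lt_le_trans _ (schur_majorant_ge0 _ _))// ltNye.
have [y0|y0] := eqVneq y 0.
  rewrite y0 schur_majorant0 addey ?gt0_muley ?leey// ?lte_fin//.
  by rewrite gt_eqF// (lt_le_trans _ (schur_majorant_ge0 _ _))// ltNye.
rewrite /line_kernel /schur_majorant (negbTE xy0) (negbTE y0) -EFinD -!EFinM lee_fin /schur_profile.
have a0 : 0 < cbrt `|x - y| by apply: cbrt_gt0; rewrite normr_gt0.
have c0 : 0 < cbrt `|y| by apply: cbrt_gt0; rewrite normr_gt0.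
have aK : cbrt `|x - y| ^+ 3 = `|x - y| by apply: cbrtK.
have cK : cbrt `|y| ^+ 3 = `|y| by apply: cbrtK.
have := omegaK x; have := omegaK y; have := w0 x; have := w0 y.
move: a0 c0 aK cK.
set a := cbrt _; set c := cbrt _; set b := omega y; set s := omega x.
move=> a0 c0 aK cK b0 s0 bK sK.
have sab : s ^+ 3 <= b ^+ 3 + a ^+ 3.
  rewrite sK bK aK -addrA lerD2l -[X in `|X| <= _](subrK y) addrC.
  exact: (le_trans (ler_normD _ _)).
have powle n (u v : R) : (0 < n)%N -> 0 < u -> 0 < v -> (u ^+ n <= v ^+ n) = (u <= v).
  by move=> n0 u0 v0; rewrite ler_pXn2r// nnegrE ltW.
have cb : c <= b by rewrite -(powle 3)// cK bK lerDr.
(* [u] is the smaller and [v] the larger of the two cube roots: s^3 <= 2 v^3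
   gives s <= 2 v, hence u + s <= 3 v and the constant 9. *)
have key u v : 0 < u -> 0 < v -> s ^+ 3 <= v ^+ 3 + v ^+ 3 -> u <= v ->
    (v ^+ 2)^-1 <= 9 * ((u + s) ^+ 2)^-1.
  move=> u0 v0 sv uv.
  have s2v : s <= 2 * v.
    have v3 : 0 <= v ^+ 3 by rewrite exprn_ge0// ltW.
    by rewrite -(powle 3) ?mulr_gt0// exprMn (le_trans sv)//; lra.
  have us0 : 0 < u + s by exact: addr_gt0.
  rewrite ler_pdivlMr ?exprn_gt0// mulrC ler_pdivrMr ?exprn_gt0//.
  have -> : 9 * v ^+ 2 = (3 * v) ^+ 2 by ring.
  by rewrite powle ?mulr_gt0//; lra.
have A1 : 0 <= (a ^+ 2 * (a + s) ^+ 2)^-1 by rewrite invr_ge0 mulr_ge0// sqr_ge0.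
have A2 : 0 <= (c ^+ 2 * (c + s) ^+ 2)^-1 by rewrite invr_ge0 mulr_ge0// sqr_ge0.
have [ab|ba] := leP a b.
  have k : (b ^+ 2)^-1 <= 9 * ((a + s) ^+ 2)^-1.
    by apply: key => //; rewrite (le_trans sab)// lerD2l powle.
  suff : (a ^+ 2)^-1 * (b ^+ 2)^-1 <= 9 * (a ^+ 2 * (a + s) ^+ 2)^-1 by lra.
  rewrite [X in 9 * X]invfM [X in _ <= X]mulrCA.
  by apply: ler_wpM2l => //; rewrite invr_ge0 sqr_ge0.
have k : (a ^+ 2)^-1 <= 9 * ((c + s) ^+ 2)^-1.
  apply: key => //; last exact: le_trans cb (ltW ba).
  by rewrite (le_trans sab)// lerD2r powle// ltW.
suff : (a ^+ 2)^-1 * (b ^+ 2)^-1 <= 9 * (c ^+ 2 * (c + s) ^+ 2)^-1 by lra.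
rewrite [X in 9 * X]invfM [X in _ <= X]mulrCA mulrC.
apply: ler_pM; rewrite ?invr_ge0 ?sqr_ge0//.
by rewrite lef_pV2 ?posrE ?exprn_gt0// powle.
Qed.

(** Both halves of the majorant have the same integral, by the invariance of
Lebesgue measure under [y |-> x - y]. *)
Lemma schur_line x :
  (\int[mu]_y (line_kernel (x - y)%R * ((omega y ^+ 2)^-1)%:E) <= (108 / omega x)%:E)%E.
Proof.
have w0 := omega_gt0.
have mg := measurable_schur_majorant (omega x).
have mx : measurable_fun [set: measurableTypeR R] ((fun y => x - y) : measurableTypeR R -> R).
  by apply: measurable_funB => //; exact: measurable_cst.
have mgx : measurable_fun [set: measurableTypeR R] (fun y => schur_majorant (omega x) (x - y)%R).
  exact: (measurableT_comp mg mx).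
apply: (@le_trans _ _ (\int[mu]_y (9%:E * (schur_majorant (omega x) (x - y)%R + schur_majorant (omega x) y)))%E).
  apply: ge0_le_integral => //.
  - by move=> y _; rewrite mule_ge0 ?line_kernel_ge0// lee_fin invr_ge0 sqr_ge0.
  - apply: emeasurable_funM; first exact: (measurableT_comp measurable_line_kernel mx).
    apply/measurable_EFinP; apply: measurable_funV; apply: measurable_funX.
    exact: measurable_omega.
  - by apply: measurable_funeM; exact: emeasurable_funD.
  - by move=> y _; exact: line_kernel_omega_le.
rewrite ge0_integralZl//; last 2 first.
- exact: emeasurable_funD.
- by move=> y _; rewrite adde_ge0// schur_majorant_ge0.
rewrite ge0_integralD//; [|by move=> y _; exact: schur_majorant_ge0|by move=> y _; exact: schur_majorant_ge0].
have E : (\int[mu]_y schur_majorant (omega x) (x - y)%R = \int[mu]_y schur_majorant (omega x) y)%E.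
  transitivity (\int[mu]_y schur_majorant (omega x) (1 * y + - x)%R)%E.
    apply: eq_integral => y _; rewrite /schur_majorant mul1r -[y - x]opprB oppr_eq0 normrN.
    by [].
  rewrite ge0_integral_affine//; last by move=> y; exact: schur_majorant_ge0.
  by rewrite invr1 mul1e.
rewrite E.
apply: (@le_trans _ _ (9%:E * ((6 / omega x)%:E + (6 / omega x)%:E))%E).
  by apply: lee_wpmul2l => //; apply: leeD; exact: integral_schur_majorant_le.
rewrite -EFinD -EFinM lee_fin le_eqVlt; apply/orP; left; apply/eqP; field.
by rewrite gt_eqF.
Qed.

End schur_line.

(** * Momentum space and the Schur test for |p - p'|^-2 *)

Lemma ge0_integral_prod d1 d2 (T1 : measurableType d1) (T2 : measurableType d2)
    (R : realType) (m1 : {sigma_finite_measure set T1 -> \bar R})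
    (m2 : {sigma_finite_measure set T2 -> \bar R})
    (f : T1 -> \bar R) (g : T2 -> \bar R) :
  measurable_fun setT f -> measurable_fun setT g ->
  (forall x, 0 <= f x)%E -> (forall y, 0 <= g y)%E ->
  (\int[m1 \x m2]_z (f z.1 * g z.2) = (\int[m1]_x f x) * (\int[m2]_y g y))%E.
Proof.
move=> mf mg f0 g0; rewrite fubini_tonelli1//=; last 2 first.
- by apply: emeasurable_funM; exact: measurableT_comp.
- by move=> z; rewrite mule_ge0.
rewrite /fubini_F/=.
under eq_integral => x _ do rewrite ge0_integralZl//.
by rewrite ge0_integralZr//; exact: integral_ge0.
Qed.

Section momentum_space.
Context {R : realType}.
Notation mu := (@lebesgue_measure R).
Implicit Types p : momentum R.

Lemma pnorm_sqr p : pnorm p ^+ 2 = p.1.1 ^+ 2 + p.1.2 ^+ 2 + p.2 ^+ 2.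
Proof.
rewrite sqr_sqrtr; last by apply: sumr_ge0 => i _; exact: sqr_ge0.
by rewrite !big_ord_recl big_ord0 /Defs.coord /= addr0 addrA.
Qed.

Lemma pdist_sqr p p' : pdist p p' ^+ 2 =
  (p.1.1 - p'.1.1) ^+ 2 + (p.1.2 - p'.1.2) ^+ 2 + (p.2 - p'.2) ^+ 2.
Proof.
rewrite sqr_sqrtr; last by apply: sumr_ge0 => i _; exact: sqr_ge0.
by rewrite !big_ord_recl big_ord0 /Defs.coord /= addr0 addrA.
Qed.

Lemma pnorm_ge0 p : 0 <= pnorm p. Proof. exact: sqrtr_ge0. Qed.

Definition dilate (a : R) p : momentum R := (a * p.1.1, a * p.1.2, a * p.2).

Lemma pnorm_dilate a p : 0 <= a -> pnorm (dilate a p) = a * pnorm p.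
Proof.
move=> a0; rewrite /pnorm -[X in X * _](ger0_norm a0) -sqrtr_sqr -sqrtrM ?sqr_ge0//.
by congr Num.sqrt; rewrite !big_ord_recl !big_ord0 /Defs.coord /=; ring.
Qed.

Lemma pdist_dilate a p p' : 0 <= a -> pdist (dilate a p) (dilate a p') = a * pdist p p'.
Proof.
move=> a0; rewrite /pdist -[X in X * _](ger0_norm a0) -sqrtr_sqr -sqrtrM ?sqr_ge0//.
by congr Num.sqrt; rewrite !big_ord_recl !big_ord0 /Defs.coord /=; ring.
Qed.

Lemma dilate_dilate a b p : dilate a (dilate b p) = dilate (a * b) p.
Proof. by rewrite /dilate/= !mulrA. Qed.

Lemma dilate1 p : dilate 1 p = p.
Proof. by case: p => -[x y] z; rewrite /dilate/= !mul1r. Qed.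

Lemma measurable_coord (j : 'I_3) : measurable_fun setT (fun p : momentum R => Defs.coord p j).
Proof.
rewrite /Defs.coord; case: j => -[|[|[|//]]] j /=.
- exact: (measurableT_comp measurable_fst measurable_fst).
- exact: (measurableT_comp measurable_snd measurable_fst).
- exact: measurable_snd.
Qed.

Lemma measurable_pnorm : measurable_fun setT (@pnorm R).
Proof.
apply: measurable_fun_sqrt; apply: measurable_sum => j.
by apply: measurable_funX; exact: measurable_coord.
Qed.

Lemma measurable_pdist :
  measurable_fun setT (fun q : momentum R * momentum R => pdist q.1 q.2).
Proof.
apply: measurable_fun_sqrt; apply: measurable_sum => j.
apply: measurable_funX; apply: measurable_funB.
- exact: (measurableT_comp (measurable_coord j) measurable_fst).
- exact: (measurableT_comp (measurable_coord j) measurable_snd).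
Qed.

Lemma measurable_dilate :
  measurable_fun [set: measurableTypeR R * momentum R] (fun z => dilate z.1 z.2).
Proof.
have m1 : measurable_fun [set: measurableTypeR R * momentum R] (fun z => z.1 : R) by exact: measurable_fst.
have m2 := @measurable_snd _ _ (measurableTypeR R) (momentum R).
apply/measurable_fun_pair; first apply/measurable_fun_pair.
- apply: measurable_funM => //.
  exact: (measurableT_comp (measurableT_comp measurable_fst measurable_fst) m2).
- apply: measurable_funM => //.
  exact: (measurableT_comp (measurableT_comp measurable_snd measurable_fst) m2).
- apply: measurable_funM => //.
  exact: (measurableT_comp measurable_snd m2).
Qed.

Lemma scales_line a : 0 < a ->
  scales_measure mu (fun x : measurableTypeR R => a * x : measurableTypeR R) a^-1.
Proof.
move=> a0; split; first exact: mulrl_measurable.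
move=> f mf f0; rewrite -(@ge0_integral_affine R a 0)//.
by apply: eq_integral => x _; rewrite addr0.
Qed.

Lemma scales_lebesgue3 a : 0 < a -> scales_measure (@lebesgue3 R) (dilate a) (a ^- 3).
Proof.
move=> a0; have i0 : 0 <= a^-1 by rewrite invr_ge0 ltW.
have -> : a ^- 3 = (a^-1 * a^-1) * a^-1 by rewrite -exprVn; ring.
pose da := fun x : measurableTypeR R => a * x : measurableTypeR R.
have s1 : scales_measure mu da a^-1 := scales_line a0.
have s2 := @scales_prod _ _ _ _ R mu mu da da _ _ i0 i0 s1 s1.
refine (@scales_prod _ _ _ _ R (@lebesgue2 R) mu _ da _ _ (mulr_ge0 i0 i0) i0 s2 s1).
Qed.

Lemma scales_lebesgue33 a : 0 < a -> scales_measure (@lebesgue33 R)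
  (fun q => (dilate a q.1, dilate a q.2)) (a ^- 6).
Proof.
move=> a0; have i0 : 0 <= a ^- 3 by rewrite invr_ge0 exprn_ge0// ltW.
have -> : a ^- 6 = a ^- 3 * a ^- 3 by rewrite -invfM -exprD.
have s3 := scales_lebesgue3 a0.
exact: (@scales_prod _ _ _ _ R (@lebesgue3 R) (@lebesgue3 R) _ _ _ _ i0 i0 s3 s3).
Qed.

Definition Omega p : R := omega p.1.1 * omega p.1.2 * omega p.2.

Lemma Omega_gt0 p : 0 < Omega p.
Proof. by rewrite !mulr_gt0// omega_gt0. Qed.

Lemma measurable_Omega : measurable_fun setT Omega.
Proof.
have m j := measurableT_comp (@measurable_omega R) (measurable_coord j).
apply: measurable_funM; first apply: measurable_funM.
- exact: m ord0.
- exact: m (@Ordinal 3 1 isT).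
- exact: m (@Ordinal 3 2 isT).
Qed.

(** Each factor is at most the cube root of [2 * sqrt (1 + pnorm p ^+ 2)]. *)
Lemma Omega_le p : Omega p <= 2 * Num.sqrt (1 + pnorm p ^+ 2).
Proof.
have w0 := @omega_gt0 R.
have s1 : 0 <= 1 + pnorm p ^+ 2 by rewrite addr_ge0// sqr_ge0.
set S := Num.sqrt _.
have S2 : S ^+ 2 = 1 + pnorm p ^+ 2 by rewrite sqr_sqrtr.
have S0 : 0 <= S by exact: sqrtr_ge0.
have bnd (x : R) : x ^+ 2 <= pnorm p ^+ 2 -> omega x ^+ 3 <= 2 * S.
  move=> xp; rewrite omegaK.
  have xS : `|x| <= S.
    rewrite -(@ler_pXn2r _ 2) ?nnegrE// S2 real_normK ?num_real//.
    by rewrite (le_trans xp)// lerDr.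
  have S1 : 1 <= S by rewrite -(@ler_pXn2r _ 2) ?nnegrE// S2 expr1n lerDl sqr_ge0.
  lra.
have := pnorm_sqr p.
have := sqr_ge0 (p.1.1 : R); have := sqr_ge0 (p.1.2 : R); have := sqr_ge0 (p.2 : R).
move=> h1 h2 h3 E.
have b1 : omega p.1.1 ^+ 3 <= 2 * S by apply: bnd; rewrite E; lra.
have b2 : omega p.1.2 ^+ 3 <= 2 * S by apply: bnd; rewrite E; lra.
have b3 : omega p.2 ^+ 3 <= 2 * S by apply: bnd; rewrite E; lra.
have S20 : 0 <= 2 * S by rewrite mulr_ge0.
rewrite -(@ler_pXn2r _ 3) ?nnegrE//; last by rewrite ltW// Omega_gt0.
have -> : Omega p ^+ 3 = omega p.1.1 ^+ 3 * omega p.1.2 ^+ 3 * omega p.2 ^+ 3.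
  by rewrite /Omega !exprMn.
rewrite [X in _ <= X]exprSr [X in _ <= X * _]expr2.
have e0 (x : R) : 0 <= omega x ^+ 3 by rewrite exprn_ge0// ltW.
by apply: ler_pM => //; [exact: mulr_ge0|exact: ler_pM].
Qed.

(** Arithmetic against geometric mean: u^2 + v^2 + w^2 is at least the cube root
of u^2 v^2 w^2.  This reduces the Schur test in space to the line. *)
Lemma inv_pdist_le p p' :
  (((pdist p p' ^+ 2)^-1)%:E <=
   line_kernel (p.1.1 - p'.1.1)%R * line_kernel (p.1.2 - p'.1.2)%R * line_kernel (p.2 - p'.2)%R)%E.
Proof.
rewrite pdist_sqr.
move: (p.1.1 - p'.1.1) (p.1.2 - p'.1.2) (p.2 - p'.2) => u v w.
have k0 (x : R) : (0 < line_kernel x)%E.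
  rewrite /line_kernel; case: ifPn => // x0; rewrite lte_fin invr_gt0 exprn_gt0//.
  by rewrite cbrt_gt0// normr_gt0.
have ky : line_kernel 0 = +oo%E :> \bar R by rewrite /line_kernel eqxx.
have [->|u0] := eqVneq u 0; first by rewrite ky !gt0_mulye ?leey.
have [->|v0] := eqVneq v 0; first by rewrite ky gt0_muley// gt0_mulye ?leey.
have [->|w0] := eqVneq w 0; first by rewrite ky gt0_muley ?leey// mule_gt0.
rewrite /line_kernel (negbTE u0) (negbTE v0) (negbTE w0) -!EFinM lee_fin -!invfM.
have pos (x : R) : x != 0 -> 0 < cbrt `|x| by move=> x0; rewrite cbrt_gt0// normr_gt0.
rewrite lef_pV2 ?posrE; last 2 first.
- by rewrite ltr_pwDr ?sqr_ge0 ?addr_ge0 ?sqr_ge0// lt_neqAle sqr_ge0 eq_sym sqrf_eq0 w0.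
- by apply: mulr_gt0; first apply: mulr_gt0; rewrite exprn_gt0// pos.
have u2 := sqr_ge0 u; have v2 := sqr_ge0 v; have w2 := sqr_ge0 w.
have sqrc (x : R) : (cbrt `|x| ^+ 2) ^+ 3 = x ^+ 2 :> R.
  by rewrite exprAC cbrtK// real_normK// num_real.
have c2 (x : R) : 0 <= cbrt `|x| ^+ 2 by exact: sqr_ge0.
rewrite -(@ler_pXn2r _ 3)//; last 2 first.
- by rewrite nnegrE; apply: mulr_ge0 => //; exact: mulr_ge0.
- by rewrite nnegrE; lra.
have gen (A B C a b c : R) : A ^+ 3 = a -> B ^+ 3 = b -> C ^+ 3 = c ->
    0 <= a -> 0 <= b -> 0 <= c -> (A * B * C) ^+ 3 <= (a + b + c) ^+ 3.
  move=> <- <- <-; rewrite 2!exprMn; set a' := A ^+ 3; set b' := B ^+ 3; set c' := C ^+ 3.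
  move=> a0 b0 c0; rewrite [X in _ <= X]exprSr expr2.
  apply: ler_pM => //; [exact: mulr_ge0| |lra].
  by apply: ler_pM => //; lra.
exact: gen.
Qed.

Lemma schur_space p :
  (\int[@lebesgue3 R]_p' (((pdist p p' ^+ 2)^-1)%:E * ((Omega p' ^+ 2)^-1)%:E)
   <= (108 ^+ 3 / Omega p)%:E)%E.
Proof.
pose f x y := (line_kernel (x - y)%R * ((omega y ^+ 2)^-1)%:E)%E : \bar R.
have mO : measurable_fun [set: measurableTypeR R] (fun y => ((omega y ^+ 2)^-1)%:E : \bar R).
  apply/measurable_EFinP; apply: measurable_funV; apply: measurable_funX.
  exact: measurable_omega.
have mf x : measurable_fun [set: measurableTypeR R] (f x).
  apply: emeasurable_funM => //.
  apply: (measurableT_comp (@measurable_line_kernel R)).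
  by apply: measurable_funB => //; exact: measurable_cst.
have f0 x y : (0 <= f x y)%E.
  by rewrite mule_ge0 ?line_kernel_ge0// lee_fin invr_ge0 sqr_ge0.
have mp : measurable_fun setT (fun p' : momentum R => pdist p p').
  exact: (measurableT_comp measurable_pdist (pair1_measurable p)).
apply: (@le_trans _ _ (\int[@lebesgue3 R]_p' (f p.1.1 p'.1.1 * f p.1.2 p'.1.2 * f p.2 p'.2))%E).
  apply: ge0_le_integral => //.
  - by move=> p' _; rewrite mule_ge0// lee_fin invr_ge0 sqr_ge0.
  - apply: emeasurable_funM; apply/measurable_EFinP; apply: measurable_funV; apply: measurable_funX => //.
    exact: measurable_Omega.
  - apply: emeasurable_funM; first apply: emeasurable_funM.
    + exact: (measurableT_comp (mf _) (measurable_coord ord0)).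
    + exact: (measurableT_comp (mf _) (measurable_coord (@Ordinal 3 1 isT))).
    + exact: (measurableT_comp (mf _) (measurable_coord (@Ordinal 3 2 isT))).
  - move=> p' _; rewrite /f.
    have -> : ((Omega p' ^+ 2)^-1)%:E = (((omega p'.1.1 ^+ 2)^-1)%:E *
        ((omega p'.1.2 ^+ 2)^-1)%:E * ((omega p'.2 ^+ 2)^-1)%:E)%E.
      by rewrite -!EFinM -!invfM -!exprMn.
    rewrite [leRHS](_ : _ = line_kernel (p.1.1 - p'.1.1)%R * line_kernel (p.1.2 - p'.1.2)%R * line_kernel (p.2 - p'.2)%R *
       (((omega p'.1.1 ^+ 2)^-1)%:E *
        ((omega p'.1.2 ^+ 2)^-1)%:E * ((omega p'.2 ^+ 2)^-1)%:E))%E; last first.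
      by rewrite [RHS]muleACA; congr (_ * _)%E; rewrite muleACA.
    by apply: lee_wpmul2r; [rewrite !mule_ge0// lee_fin invr_ge0 sqr_ge0|exact: inv_pdist_le].
have := @ge0_integral_prod _ _ _ _ R (@lebesgue2 R) mu
  (fun z => f p.1.1 z.1 * f p.1.2 z.2)%E (f p.2).
rewrite /= => ->//; last 2 first.
- apply: emeasurable_funM.
  + exact: (measurableT_comp (mf _) measurable_fst).
  + exact: (measurableT_comp (mf _) measurable_snd).
- by move=> z; exact: mule_ge0.
have -> := @ge0_integral_prod _ _ _ _ R mu mu (f p.1.1) (f p.1.2) (mf _) (mf _) (f0 _) (f0 _).
have I0 x : (0 <= \int[mu]_y f x y)%E by apply: integral_ge0 => y _; exact: f0.
apply: (@le_trans _ _ ((108 / omega p.1.1)%:E * (108 / omega p.1.2)%:E * (108 / omega p.2)%:E)%E).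
  apply: lee_pmul => //; [exact: mule_ge0| |exact: schur_line].
  by apply: lee_pmul => //; exact: schur_line.
rewrite -!EFinM lee_fin le_eqVlt; apply/orP; left; apply/eqP; rewrite /Omega; field.
by rewrite !gt_eqF ?omega_gt0.
Qed.

End momentum_space.

(** * Integrals of complex functions *)

Section complex_numbers.
Context {R : realType}.
Implicit Types z w : R[i].

Lemma ReD z w : complex.Re (z + w) = complex.Re z + complex.Re w.
Proof. by case: z w => [a b] [c d]. Qed.

Lemma ImD z w : complex.Im (z + w) = complex.Im z + complex.Im w.
Proof. by case: z w => [a b] [c d]. Qed.

Lemma ReB z w : complex.Re (z - w) = complex.Re z - complex.Re w.
Proof. by case: z w => [a b] [c d]. Qed.

Lemma ImB z w : complex.Im (z - w) = complex.Im z - complex.Im w.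
Proof. by case: z w => [a b] [c d]. Qed.

Lemma ReM z w : complex.Re (z * w) =
  complex.Re z * complex.Re w - complex.Im z * complex.Im w.
Proof. by case: z w => [a b] [c d]. Qed.

Lemma ImM z w : complex.Im (z * w) =
  complex.Re z * complex.Im w + complex.Im z * complex.Re w.
Proof. by case: z w => [a b] [c d]. Qed.

Lemma Re_conj z : complex.Re z^*%C = complex.Re z.
Proof. by case: z. Qed.

Lemma Im_conj z : complex.Im z^*%C = - complex.Im z.
Proof. by case: z. Qed.

Lemma normcE z : normc z = Num.sqrt (complex.Re z ^+ 2 + complex.Im z ^+ 2).
Proof. by case: z. Qed.

Lemma conjCE z : Num.conj z = z^*%C. Proof. by []. Qed.

Lemma normc_ge0 z : 0 <= normc z. Proof. by case: z => a b; exact: sqrtr_ge0. Qed.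

Lemma normc_sqr z : normc z ^+ 2 = complex.Re z ^+ 2 + complex.Im z ^+ 2.
Proof. by case: z => a b; rewrite sqr_sqrtr// addr_ge0// sqr_ge0. Qed.

Lemma ler_Re_normc z : `|complex.Re z| <= normc z.
Proof.
rewrite -(@ler_pXn2r _ 2) ?nnegrE ?normc_ge0// normc_sqr real_normK ?num_real//.
by rewrite lerDl sqr_ge0.
Qed.

Lemma ler_Im_normc z : `|complex.Im z| <= normc z.
Proof.
rewrite -(@ler_pXn2r _ 2) ?nnegrE ?normc_ge0// normc_sqr real_normK ?num_real//.
by rewrite lerDr sqr_ge0.
Qed.

Lemma normc_le z : normc z <= `|complex.Re z| + `|complex.Im z|.
Proof.
rewrite -(@ler_pXn2r _ 2) ?nnegrE ?normc_ge0 ?addr_ge0// normc_sqr sqrrD.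
by rewrite !real_normK ?num_real// lerD2r lerDl mulrn_wge0// mulr_ge0.
Qed.

Lemma normc_conj z : normc z^*%C = normc z.
Proof. by case: z => a b /=; rewrite sqrrN. Qed.

Lemma normc_real (x : R) : normc x%:C = `|x|.
Proof. by rewrite /= expr0n addr0 sqrtr_sqr. Qed.

End complex_numbers.

Section complex_measurable.
Context d (T : measurableType d) {R : realType}.
Implicit Types (f g : T -> R[i]) (h : T -> R).

Definition cmeasurable f :=
  measurable_fun setT (fun x => complex.Re (f x)) /\
  measurable_fun setT (fun x => complex.Im (f x)).

Lemma cmeasurable_cst (z : R[i]) : cmeasurable (cst z).
Proof. by split; exact: measurable_cst. Qed.

Lemma cmeasurable_real h : measurable_fun setT h -> cmeasurable (fun x => (h x)%:C).
Proof. by move=> mh; split => //=; exact: measurable_cst. Qed.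

Lemma cmeasurableD f g : cmeasurable f -> cmeasurable g ->
  cmeasurable (fun x => f x + g x).
Proof.
move=> [f1 f2] [g1 g2]; split.
  by under eq_fun do rewrite ReD; exact: measurable_funD.
by under eq_fun do rewrite ImD; exact: measurable_funD.
Qed.

Lemma cmeasurableM f g : cmeasurable f -> cmeasurable g ->
  cmeasurable (fun x => f x * g x).
Proof.
move=> [f1 f2] [g1 g2]; split.
  under eq_fun do rewrite ReM.
  by apply: measurable_funB; exact: measurable_funM.
under eq_fun do rewrite ImM.
by apply: measurable_funD; exact: measurable_funM.
Qed.

Lemma cmeasurable_conj f : cmeasurable f -> cmeasurable (fun x => (f x)^*%C).
Proof.
move=> [f1 f2]; split.
  by under eq_fun do rewrite Re_conj.
under eq_fun do rewrite Im_conj.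
exact: measurable_funN.
Qed.

Lemma cmeasurable_sum n (F : 'I_n -> T -> R[i]) : (forall i, cmeasurable (F i)) ->
  cmeasurable (fun x => \sum_i F i x).
Proof.
elim: n F => [|n IH] F mF.
  by under eq_fun do rewrite big_ord0; exact: cmeasurable_cst.
under eq_fun do rewrite big_ord_recl.
by apply: cmeasurableD => //; exact: IH.
Qed.

Lemma measurable_normc f : cmeasurable f -> measurable_fun setT (fun x => normc (f x)).
Proof.
move=> [f1 f2].
under eq_fun do rewrite normcE.
by apply: measurable_fun_sqrt; apply: measurable_funD; exact: measurable_funX.
Qed.

End complex_measurable.

Lemma cmeasurable_comp d d' (T : measurableType d) (T' : measurableType d')
    (R : realType) (f : T -> R[i]) (k : T' -> T) :
  cmeasurable f -> measurable_fun setT k -> cmeasurable (fun x => f (k x)).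
Proof.
move=> [f1 f2] mk.
by split; [exact: (measurableT_comp f1 mk)|exact: (measurableT_comp f2 mk)].
Qed.

Section complex_integral.
Context d (T : measurableType d) {R : realType}.
Variable nu : {measure set T -> \bar R}.
Implicit Types (f g : T -> R[i]) (h : T -> R).

Lemma cintegrable_dominated f h : cmeasurable f -> measurable_fun setT h ->
  (forall x, normc (f x) <= h x) -> (\int[nu]_x (h x)%:E < +oo)%E ->
  cintegrable nu f.
Proof.
move=> [f1 f2] mh fh hi.
have h0 x : 0 <= h x by exact: le_trans (normc_ge0 _) (fh x).
have ih : nu.-integrable setT (EFin \o h).
  apply/integrableP; split; first exact/measurable_EFinP.
  by under eq_integral => x _ do rewrite /= ger0_norm//.
split; apply: le_integrable ih => //; try exact/measurable_EFinP.
- by move=> x _; rewrite /= lee_fin (ger0_norm (h0 x)) (le_trans (ler_Re_normc _)).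
- by move=> x _; rewrite /= lee_fin (ger0_norm (h0 x)) (le_trans (ler_Im_normc _)).
Qed.

Lemma cintegrable_measurable f : cintegrable nu f -> cmeasurable f.
Proof.
by move=> [/integrableP[/measurable_EFinP ? _] /integrableP[/measurable_EFinP ? _]].
Qed.

Lemma cintegrable_normc f : cintegrable nu f ->
  (\int[nu]_x (normc (f x))%:E < +oo)%E.
Proof.
move=> fi; have mf := cintegrable_measurable fi.
case: fi => [/integrableP[m1 f1] /integrableP[m2 f2]].
apply: (@le_lt_trans _ _ (\int[nu]_x (`|(complex.Re (f x))%:E| + `|(complex.Im (f x))%:E|))%E).
  apply: ge0_le_integral => //.
  - by move=> x _; rewrite lee_fin normc_ge0.
  - by apply/measurable_EFinP; exact: measurable_normc.
  - by apply: emeasurable_funD; exact: measurableT_comp.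
  - by move=> x _; rewrite -EFinD lee_fin normc_le.
rewrite ge0_integralD//; try exact: measurableT_comp.
exact: lte_add_pinfty.
Qed.

Lemma cintegrableD f g : cintegrable nu f -> cintegrable nu g ->
  cintegrable nu (fun x => f x + g x).
Proof.
move=> [f1 f2] [g1 g2]; split.
  by under eq_fun do rewrite ReD EFinD; exact: integrableD.
by under eq_fun do rewrite ImD EFinD; exact: integrableD.
Qed.

Lemma cintegralD f g : cintegrable nu f -> cintegrable nu g ->
  cintegral nu (fun x => f x + g x) = cintegral nu f + cintegral nu g.
Proof.
move=> [f1 f2] [g1 g2]; rewrite /cintegral.
rewrite (@eq_Rintegral _ _ _ nu setT (fun x => complex.Re (f x) + complex.Re (g x))); last first.
  by move=> x _; rewrite ReD.
rewrite [X in _ +i* X = _](@eq_Rintegral _ _ _ nu setT (fun x => complex.Im (f x) + complex.Im (g x))); last first.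
  by move=> x _; rewrite ImD.
by rewrite !RintegralD.
Qed.

Lemma cintegrableZ (z : R[i]) f : cintegrable nu f -> cintegrable nu (fun x => z * f x).
Proof.
move=> [f1 f2]; split.
  under eq_fun do rewrite ReM EFinB EFinM.
  by under eq_fun do rewrite EFinM; apply: integrableB => //; exact: integrableZl.
under eq_fun do rewrite ImM EFinD EFinM.
by under eq_fun do rewrite EFinM; apply: integrableD => //; exact: integrableZl.
Qed.

Lemma cintegralZ (z : R[i]) f : cintegrable nu f ->
  cintegral nu (fun x => z * f x) = z * cintegral nu f.
Proof.
move=> [f1 f2]; rewrite /cintegral.
have i1 (k : R) : nu.-integrable setT (EFin \o (fun x => k * complex.Re (f x))).
  by rewrite (_ : _ \o _ = fun x => k%:E * (complex.Re (f x))%:E)%E//; exact: integrableZl.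
have i2 (k : R) : nu.-integrable setT (EFin \o (fun x => k * complex.Im (f x))).
  by rewrite (_ : _ \o _ = fun x => k%:E * (complex.Im (f x))%:E)%E//; exact: integrableZl.
rewrite (@eq_Rintegral _ _ _ nu setT (fun x => complex.Re z * complex.Re (f x) - complex.Im z * complex.Im (f x))); last first.
  by move=> x _; rewrite ReM.
rewrite [X in _ +i* X = _](@eq_Rintegral _ _ _ nu setT (fun x => complex.Re z * complex.Im (f x) + complex.Im z * complex.Re (f x))); last first.
  by move=> x _; rewrite ImM.
rewrite RintegralB// RintegralD// !RintegralZl//.
by case: z => a b.
Qed.

Lemma eq_cintegral f g : f =1 g -> cintegral nu f = cintegral nu g.
Proof. by move=> /funext->. Qed.

Lemma cintegralB f g : cintegrable nu f -> cintegrable nu g ->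
  cintegral nu (fun x => f x - g x) = cintegral nu f - cintegral nu g.
Proof.
move=> fi gi; rewrite -[- cintegral _ _]mulN1r -cintegralZ// -cintegralD//.
  by apply: eq_cintegral => x; rewrite mulN1r.
exact: cintegrableZ.
Qed.

Lemma cintegrable_conj f : cintegrable nu f -> cintegrable nu (fun x => (f x)^*%C).
Proof.
move=> [f1 f2]; split.
  by under eq_fun do rewrite Re_conj.
under eq_fun do rewrite Im_conj.
exact: integrableN f2.
Qed.

Lemma cintegral_conj f : cintegrable nu f ->
  cintegral nu (fun x => (f x)^*%C) = (cintegral nu f)^*%C.
Proof.
move=> [f1 f2]; rewrite /cintegral /=; congr (_ +i* _).
  by apply: eq_Rintegral => x _; case: (f x).
rewrite -mulN1r -RintegralZl//.
by apply: eq_Rintegral => x _; rewrite mulN1r; case: (f x).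
Qed.

(** The factor 2 comes from estimating real and imaginary part separately; only
limits equal to 0 are drawn from this bound. *)
Lemma normc_cintegral_le f : cintegrable nu f ->
  ((normc (cintegral nu f))%:E <= 2%:E * \int[nu]_x (normc (f x))%:E)%E.
Proof.
move=> fi; have mf := cintegrable_measurable fi; case: (fi) => [f1 f2].
have mn := measurable_normc mf.
have n0 : (0 <= \int[nu]_x (normc (f x))%:E)%E.
  by apply: integral_ge0 => x _; rewrite lee_fin normc_ge0.
have nf : (\int[nu]_x (normc (f x))%:E)%E \is a fin_num.
  by rewrite ge0_fin_numE//; exact: cintegrable_normc.
apply: (@le_trans _ _ (`|\int[nu]_x (complex.Re (f x))%:E| + `|\int[nu]_x (complex.Im (f x))%:E|)%E).
  rewrite -(fineK (integrable_fin_num measurableT f1)) -(fineK (integrable_fin_num measurableT f2)).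
  by rewrite -EFinD lee_fin; exact: normc_le.
rewrite (_ : 2%:E * _ = \int[nu]_x (normc (f x))%:E + \int[nu]_x (normc (f x))%:E)%E; last first.
  by rewrite -mule2n muleC mule_natr.
apply: leeD.
- apply: (le_trans (le_abse_integral _ _ _)) => //; first exact: measurable_int f1.
  apply: ge0_le_integral => //.
  + by apply: measurableT_comp => //; exact: measurable_int f1.
  + exact/measurable_EFinP.
  + by move=> x _; rewrite lee_fin ler_Re_normc.
- apply: (le_trans (le_abse_integral _ _ _)) => //; first exact: measurable_int f2.
  apply: ge0_le_integral => //.
  + by apply: measurableT_comp => //; exact: measurable_int f2.
  + exact/measurable_EFinP.
  + by move=> x _; rewrite lee_fin ler_Im_normc.
Qed.

Lemma cintegral_scales (delta : T -> T) (k : R) f : 0 <= k ->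
  scales_measure nu delta k -> cintegrable nu f ->
  cintegral nu (fun x => f (delta x)) = k%:C * cintegral nu f.
Proof.
move=> k0 s fi; have [m1 m2] := cintegrable_measurable fi; case: fi => [f1 f2].
rewrite /cintegral /Rintegral /=.
rewrite (integral_scales k0 s _ f1)//; last exact/measurable_EFinP.
rewrite (integral_scales k0 s _ f2)//; last exact/measurable_EFinP.
have n1 := integrable_fin_num measurableT f1.
have n2 := integrable_fin_num measurableT f2.
by rewrite !fineM//; simpc.
Qed.

Lemma cintegral_real h : cintegral nu (fun x => (h x)%:C) = (Rintegral nu setT h)%:C.
Proof.
rewrite /cintegral/=; congr (_ +i* _).
by rewrite /Rintegral integral0.
Qed.

(** A version of dominated convergence for sesquilinear integrands of which one
argument converges only in mean square: [t * s_ n + t^-1 * r] is what Young's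
inequality gives for a product of a small and a fixed factor.  One takes [t]
large to make [t^-1 * r] small, then [n] large; [D_ n] collects the terms with
a pointwise limit. *)
Lemma cvg_cintegral (F_ : nat -> T -> R[i]) f (s_ D_ : nat -> T -> R) (r G : T -> R) :
  (forall n, cintegrable nu (F_ n)) -> cintegrable nu f ->
  (forall n, measurable_fun setT (s_ n)) -> (forall n x, 0 <= s_ n x) ->
  (forall n, measurable_fun setT (D_ n)) -> (forall n x, 0 <= D_ n x) ->
  measurable_fun setT r -> (forall x, 0 <= r x) -> measurable_fun setT G ->
  (forall t n x, 0 < t -> normc (F_ n x - f x) <= t * s_ n x + t^-1 * r x + D_ n x) ->
  (\int[nu]_x (s_ n x)%:E)%E @[n --> \oo] --> 0%E ->
  (\int[nu]_x (r x)%:E < +oo)%E ->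
  (forall n x, D_ n x <= G x) -> (\int[nu]_x (G x)%:E < +oo)%E ->
  (forall x, D_ n x @[n --> \oo] --> (0 : R)) ->
  forall e : R, 0 < e ->
    \forall n \near \oo, normc (cintegral nu (F_ n) - cintegral nu f) <= e.
Proof.
move=> iF fi ms s0 mD D0 mr r0 mG dom slim ri DG Gi Dlim e e0.
have G0 x : 0 <= G x by exact: le_trans (D0 0%N x) (DG 0%N x).
have Dint : (\int[nu]_x (D_ n x)%:E)%E @[n --> \oo] --> 0%E.
  have := @dominated_convergence _ _ _ nu setT measurableT (fun n x => (D_ n x)%:E)
    (cst 0%E) (EFin \o G).
  move=> []//.
  - by move=> n; exact/measurable_EFinP.
  - apply: aeW => x _; apply: cvg_EFin; first exact: nearW.
    exact: Dlim.
  - apply/integrableP; split; first exact/measurable_EFinP.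
    by under eq_integral => x _ do rewrite /= ger0_norm//.
  - by apply: aeW => x n _; rewrite /= lee_fin ger0_norm.
  - by rewrite integral0.
pose rr := fine (\int[nu]_x (r x)%:E).
have rr0 : 0 <= rr by apply: fine_ge0; apply: integral_ge0 => x _; rewrite lee_fin.
have rE : (\int[nu]_x (r x)%:E)%E = rr%:E.
  by rewrite fineK// ge0_fin_numE//; apply: integral_ge0 => x _; rewrite lee_fin.
(* Each of the three terms will be at most e / 6; the factor 2 of
   [normc_cintegral_le] brings their sum to e. *)
pose t := 6 * (rr + 1) / e.
have t0 : 0 < t by rewrite divr_gt0// mulr_gt0// ltr_pwDr.
have e1 : 0 < e / (6 * t) by rewrite divr_gt0// mulr_gt0.
have e2 : 0 < e / 6 by lra.
near=> n.
have sn : (\int[nu]_x (s_ n x)%:E <= (e / (6 * t))%:E)%E by near: n; exact: cvge0_le.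
have Dn : (\int[nu]_x (D_ n x)%:E <= (e / 6)%:E)%E by near: n; exact: cvge0_le.
rewrite -cintegralB//.
have iB : cintegrable nu (fun x => F_ n x - f x).
  have /= := cintegrableD (iF n) (cintegrableZ (-1) fi).
  by under eq_fun do rewrite mulN1r.
have mB := cintegrable_measurable iB.
rewrite -lee_fin (le_trans (normc_cintegral_le iB))//.
have : (\int[nu]_x (normc (F_ n x - f x))%:E <=
   \int[nu]_x (t%:E * (s_ n x)%:E + t^-1%:E * (r x)%:E + (D_ n x)%:E))%E.
  apply: ge0_le_integral => //.
  - by move=> x _; rewrite lee_fin normc_ge0.
  - by apply/measurable_EFinP; exact: measurable_normc.
  - apply: emeasurable_funD; last exact/measurable_EFinP.
    by apply: emeasurable_funD; apply: measurable_funeM; exact/measurable_EFinP.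
  - by move=> x _; rewrite -!EFinM -!EFinD lee_fin dom.
have ti0 : 0 <= t^-1 by rewrite invr_ge0 ltW.
rewrite ge0_integralD//; last 4 first.
- by move=> x _; rewrite -!EFinM -!EFinD lee_fin addr_ge0// mulr_ge0// ltW.
- by apply: emeasurable_funD; apply: measurable_funeM; exact/measurable_EFinP.
- by move=> x _; rewrite lee_fin.
- exact/measurable_EFinP.
rewrite ge0_integralD//; last 4 first.
- by move=> x _; rewrite -!EFinM lee_fin mulr_ge0// ltW.
- by apply: measurable_funeM; exact/measurable_EFinP.
- by move=> x _; rewrite -!EFinM lee_fin mulr_ge0.
- by apply: measurable_funeM; exact/measurable_EFinP.
have Z (k : R) (h : T -> R) : measurable_fun setT h -> (forall x, 0 <= h x) -> 0 <= k ->
    (\int[nu]_x (k%:E * (h x)%:E) = k%:E * \int[nu]_x (h x)%:E)%E.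
  move=> mh h0 k0; rewrite ge0_integralZl//; first exact/measurable_EFinP.
  by move=> x _; rewrite lee_fin.
rewrite !Z ?(ltW t0)//.
rewrite rE => H.
apply: (@le_trans _ _ (2%:E * (t%:E * (e / (6 * t))%:E + t^-1%:E * rr%:E + (e / 6)%:E))%E).
  apply: lee_wpmul2l => //; apply: (le_trans H); apply: leeD => //.
  by apply: leeD => //; apply: lee_wpmul2l => //; rewrite lee_fin ltW.
rewrite [leLHS](_ : _ = (2 * (t * (e / (6 * t)) + t^-1 * rr + e / 6))%:E); last by [].
rewrite lee_fin.
have -> : t * (e / (6 * t)) = e / 6 by field; rewrite gt_eqF.
have -> : t^-1 * rr = e / 6 * (rr / (rr + 1)).
  by rewrite /t; field; rewrite !gt_eqF//; lra.
have : rr / (rr + 1) <= 1 by rewrite ler_pdivrMr; lra.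
have : 0 <= rr / (rr + 1) by rewrite divr_ge0//; lra.
nra.
Unshelve. all: by end_near. Qed.

End complex_integral.

(** * Spinors and spin kernels *)

Section spinor_algebra.
Context {R : realType}.
Implicit Types (v u : 'cV[R[i]]_2) (K : 'M[R[i]]_2).

Lemma sandwichE v K u :
  sandwich v K u = \sum_i \sum_j (v i 0)^*%C * K i j * u j 0.
Proof.
rewrite /sandwich mxE exchange_big; apply: eq_bigr => j _ /=.
rewrite mxE big_distrl/=; apply: eq_bigr => i _.
by rewrite !mxE.
Qed.

Lemma sandwich1 v u : sandwich v 1%:M u = inner v u.
Proof. by rewrite /sandwich mulmx1. Qed.

Lemma sandwichZ a v K u : sandwich v (a *: K) u = a * sandwich v K u.
Proof. by rewrite /sandwich -scalemxAr -scalemxAl mxE. Qed.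

Lemma sandwichD v K1 K2 u : sandwich v (K1 + K2) u = sandwich v K1 u + sandwich v K2 u.
Proof. by rewrite /sandwich mulmxDr mulmxDl mxE. Qed.

Lemma sandwichB v K1 K2 u : sandwich v (K1 - K2) u = sandwich v K1 u - sandwich v K2 u.
Proof. by rewrite /sandwich mulmxBr mulmxBl !mxE. Qed.

Lemma sandwichBl v1 v2 K u : sandwich (v1 - v2) K u = sandwich v1 K u - sandwich v2 K u.
Proof.
rewrite !sandwichE -sumrB; apply: eq_bigr => i _; rewrite -sumrB; apply: eq_bigr => j _.
by rewrite !mxE rmorphB !mulrBl.
Qed.

Lemma sandwich_conj v K (L : 'M[R[i]]_2) u : (forall i j, (K i j)^*%C = L j i) ->
  (sandwich v K u)^*%C = sandwich u L v.
Proof.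
move=> KL; rewrite !sandwichE rmorph_sum exchange_big; apply: eq_bigr => j _.
rewrite rmorph_sum; apply: eq_bigr => i _.
rewrite !rmorphM/= -KL conjcK; ring.
Qed.

Lemma inner_conj v u : (inner v u)^*%C = inner u v.
Proof.
rewrite -!sandwich1; apply: sandwich_conj => i j; rewrite !mxE.
by rewrite eq_sym; case: eqP => _; [exact: conjc1|exact: conjc0].
Qed.

Lemma innerZr a v u : inner v (a *: u) = a * inner v u.
Proof. by rewrite /inner -scalemxAr mxE. Qed.

Lemma sqnorm_ge0 u : 0 <= sqnorm u.
Proof. by apply: sumr_ge0 => i _; exact: sqr_ge0. Qed.

Lemma sqnormE u : sqnorm u =
  \sum_i (complex.Re (u i 0) ^+ 2 + complex.Im (u i 0) ^+ 2).
Proof. by apply: eq_bigr => i _; rewrite normc_sqr. Qed.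

Lemma inner_self u : inner u u = (sqnorm u)%:C.
Proof.
rewrite /inner mxE /sqnorm rmorph_sum; apply: eq_bigr => i _.
rewrite !mxE normc_sqr conjCE /=; case: (u i 0) => a b /=.
by apply/eqP; rewrite eq_complex /=; apply/andP; split; apply/eqP; ring.
Qed.

Lemma normc_sum n (F : 'I_n -> R[i]) : normc (\sum_i F i) <= \sum_i normc (F i).
Proof.
elim: n F => [|n IH] F; first by rewrite !big_ord0 normc0.
by rewrite !big_ord_recl (le_trans (le_normcD _ _))// lerD2l.
Qed.

(** The free parameter of Young's inequality is kept: in the estimates for pairs
of momenta it becomes a ratio of Schur weights. *)
Lemma normc_sandwich_le v K u (k t : R) : 0 < t ->
  (forall i j, normc (K i j) <= k) ->
  normc (sandwich v K u) <= k * (t * sqnorm v + t^-1 * sqnorm u).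
Proof.
move=> t0 Kk.
have k0 : 0 <= k by exact: le_trans (normc_ge0 _) (Kk 0 0).
rewrite sandwichE.
apply: (@le_trans _ _ (\sum_i \sum_j k * (normc (v i 0) * normc (u j 0)))).
  apply: (le_trans (normc_sum _)); apply: ler_sum => i _.
  apply: (le_trans (normc_sum _)); apply: ler_sum => j _.
  rewrite !normcM normc_conj.
  rewrite [X in X <= _](_ : _ = normc (K i j) * (normc (v i 0) * normc (u j 0))); last by ring.
  by rewrite ler_wpM2r// mulr_ge0// normc_ge0.
rewrite /sqnorm !big_ord_recl !big_ord0 !addr0.
set v0 := normc _; set u0 := normc (u _ _); set v1 := normc (v _ _); set u1 := normc (u _ _).
rewrite -!mulrDr; apply: ler_wpM2l => //.
have key (x y : R) : 2 * (x * y) <= t * x ^+ 2 + t^-1 * y ^+ 2.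
  have : 0 <= t^-1 * (t * x - y) ^+ 2 by rewrite mulr_ge0 ?sqr_ge0// invr_ge0 ltW.
  have -> : t^-1 * (t * x - y) ^+ 2 = t * x ^+ 2 + t^-1 * y ^+ 2 - 2 * (x * y).
    by field; rewrite gt_eqF.
  lra.
have := key v0 u0; have := key v0 u1; have := key v1 u0; have := key v1 u1.
lra.
Qed.

End spinor_algebra.

Section spin_kernel.
Context {R : realType}.
Implicit Types (p : momentum R).

Lemma pdistC p p' : pdist p p' = pdist p' p.
Proof.
by congr Num.sqrt; apply: eq_bigr => j _; rewrite -sqrrN opprB.
Qed.

Lemma pauli_conj (k : 'I_3) (i j : 'I_2) : (pauli R k i j)^*%C = pauli R k j i.
Proof.
rewrite /pauli /mx2; case: k => -[|[|[|//]]] k /=; rewrite !mxE;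
  case: i => -[|[|//]] i; case: j => -[|[|//]] j //=;
  by apply/eqP; rewrite eq_complex /= ?oppr0 ?opprK ?eqxx.
Qed.

Lemma dot_pauliE p (i j : 'I_2) :
  dot_pauli p i j = \sum_k (Defs.coord p k)%:C * pauli R k i j.
Proof. by rewrite /dot_pauli summxE; apply: eq_bigr => k _; rewrite mxE. Qed.

Lemma dot_pauli_conj p (i j : 'I_2) : (dot_pauli p i j)^*%C = dot_pauli p j i.
Proof.
rewrite !dot_pauliE rmorph_sum; apply: eq_bigr => k _.
rewrite rmorphM/= pauli_conj; congr (_ * _); exact: conjc_real.
Qed.

Lemma normc_dot_pauli p (i j : 'I_2) : normc (dot_pauli p i j) <= pnorm p.
Proof.
rewrite -(@ler_pXn2r _ 2) ?nnegrE ?normc_ge0 ?pnorm_ge0// normc_sqr pnorm_sqr.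
rewrite dot_pauliE !big_ord_recl big_ord0 /Defs.coord /pauli /mx2 /=.
case: i => -[|[|//]] i; case: j => -[|[|//]] j; rewrite !mxE /=;
  simpc; rewrite /=.
all: have := sqr_ge0 (p.1.1 : R); have := sqr_ge0 (p.1.2 : R); have := sqr_ge0 (p.2 : R); nra.
Qed.

Lemma dot_pauli_dilate a p : dot_pauli (dilate a p) = a%:C *: dot_pauli p.
Proof.
rewrite /dot_pauli scaler_sumr; apply: eq_bigr => -[[|[|[|//]]] j] _;
  by rewrite /Defs.coord/= scalerA -rmorphM.
Qed.

Lemma cmeasurable_dot_pauli (i j : 'I_2) :
  cmeasurable (fun p : momentum R => dot_pauli p i j).
Proof.
rewrite (_ : (fun p => _) = fun p => \sum_k (Defs.coord p k)%:C * pauli R k i j); last first.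
  by apply/funext => p; exact: dot_pauliE.
apply: cmeasurable_sum => k; apply: cmeasurableM; last exact: cmeasurable_cst.
by apply: cmeasurable_real; exact: measurable_coord.
Qed.

(** The kernels K, K^1, K^2, the dilated kernel and its difference quotients all
have this shape, so that both the algebra and the estimates can be done on the
real symbols [al] and [be]. *)
Definition spin_kernel (p' p : momentum R) (al be : R) : 'M[R[i]]_2 :=
  ((pdist p p' ^+ 2)^-1)%:C *: (al%:C%:M + be%:C *: (dot_pauli p' *m dot_pauli p)).

Lemma spin_kernelE p' p al be i j : spin_kernel p' p al be i j =
  ((pdist p p' ^+ 2)^-1)%:C * (al%:C *+ (i == j) +
    be%:C * \sum_k dot_pauli p' i k * dot_pauli p k j).
Proof. by rewrite /spin_kernel !mxE. Qed.

Lemma spin_kernel_conj p' p al be i j :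
  (spin_kernel p' p al be i j)^*%C = spin_kernel p p' al be j i.
Proof.
rewrite !spin_kernelE rmorphM; congr (_ * _); first by rewrite pdistC; exact: conjc_real.
rewrite rmorphD; congr (_ + _).
  by rewrite eq_sym; case: eqP => _; [exact: conjc_real|exact: conjc0].
rewrite rmorphM; congr (_ * _); first exact: conjc_real.
rewrite rmorph_sum; apply: eq_bigr => k _.
by rewrite rmorphM/= !dot_pauli_conj mulrC.
Qed.

Lemma normc_spin_kernel p' p al be i j :
  normc (spin_kernel p' p al be i j) <=
  (pdist p p' ^+ 2)^-1 * (`|al| + 2 * (`|be| * (pnorm p' * pnorm p))).
Proof.
rewrite spin_kernelE normcM normc_real ger0_norm ?invr_ge0 ?sqr_ge0//.
apply: ler_wpM2l; first by rewrite invr_ge0 sqr_ge0.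
apply: (le_trans (le_normcD _ _)); apply: lerD.
  by case: eqP => _; [rewrite mulr1n normc_real|rewrite mulr0n normc0].
rewrite normcM normc_real mulrCA ler_wpM2l//.
apply: (le_trans (normc_sum _)).
have b (k : 'I_2) : normc (dot_pauli p' i k * dot_pauli p k j) <= pnorm p' * pnorm p.
  by rewrite normcM; apply: ler_pM; rewrite ?normc_ge0 ?normc_dot_pauli.
rewrite !big_ord_recl big_ord0 addr0 mulr2n mulrDl mul1r.
by apply: lerD.
Qed.

Lemma spin_kernelB p' p al be al' be' :
  spin_kernel p' p al be - spin_kernel p' p al' be' =
  spin_kernel p' p (al - al') (be - be').
Proof.
rewrite /spin_kernel -scalerBr; congr (_ *: _).
have E : ((al - al')%:C)%:M = (al%:C)%:M - (al'%:C)%:M :> 'M[R[i]]_2.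
  by apply/matrixP => i j; rewrite !mxE rmorphB mulrnBl.
by rewrite E rmorphB /= scalerBl opprD addrACA.
Qed.

Lemma spin_kernelZ a p' p al be :
  a%:C *: spin_kernel p' p al be = spin_kernel p' p (a * al) (a * be).
Proof.
rewrite /spin_kernel scalerA mulrC -scalerA; congr (_ *: _).
by rewrite scalerDr scale_scalar_mx scalerA -!rmorphM.
Qed.

End spin_kernel.

Section measurable_sandwich.
Context {R : realType} d (T : measurableType d).
Implicit Types (v u : T -> 'cV[R[i]]_2) (K : T -> 'M[R[i]]_2).

Lemma cmeasurable_sandwich v K u :
  (forall i, cmeasurable (fun x => v x i 0)) ->
  (forall i j, cmeasurable (fun x => K x i j)) ->
  (forall i, cmeasurable (fun x => u x i 0)) ->
  cmeasurable (fun x => sandwich (v x) (K x) (u x)).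
Proof.
move=> mv mK mu.
rewrite (_ : (fun x => _) = fun x => \sum_i \sum_j (v x i 0)^*%C * K x i j * u x j 0); last first.
  by apply/funext => x; exact: sandwichE.
apply: cmeasurable_sum => i; apply: cmeasurable_sum => j.
apply: cmeasurableM => //; apply: cmeasurableM => //.
exact: cmeasurable_conj.
Qed.

Lemma cmeasurable_inner v u :
  (forall i, cmeasurable (fun x => v x i 0)) ->
  (forall i, cmeasurable (fun x => u x i 0)) ->
  cmeasurable (fun x => inner (v x) (u x)).
Proof.
move=> mv mu; under eq_fun do rewrite -sandwich1.
apply: cmeasurable_sandwich => // i j; exact: cmeasurable_cst.
Qed.

Lemma measurable_sqnorm u : (forall i, cmeasurable (fun x => u x i 0)) ->
  measurable_fun setT (fun x => sqnorm (u x)).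
Proof.
move=> mu; apply: measurable_sum => i; apply: measurable_funX.
exact: measurable_normc.
Qed.

End measurable_sandwich.

(** * Strong continuity of dilations on the form domain *)

Lemma cvge0_leD (R : realType) (w u v : nat -> \bar R) :
  (forall n, 0 <= w n)%E -> (forall n, w n <= u n + v n)%E ->
  u n @[n --> \oo] --> 0%E -> v n @[n --> \oo] --> 0%E -> w n @[n --> \oo] --> 0%E.
Proof.
move=> w0 wuv u0 v0; apply: ge0_cvge0 => // e e0.
have e2 : 0 < e / 2 by rewrite divr_gt0.
near=> n; apply: (le_trans (wuv n)).
rewrite (_ : e%:E = (e / 2)%:E + (e / 2)%:E)%E; last by rewrite -EFinD -splitr.
by apply: leeD; near: n; exact: cvge0_le.
Unshelve. all: by end_near. Qed.

Section weighted.
Context {R : realType}.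
Notation mu3 := (@lebesgue3 R).
Implicit Types p : momentum R.

Definition weight p : R := Num.sqrt (1 + pnorm p ^+ 2).

Lemma weight_sqr p : weight p ^+ 2 = 1 + pnorm p ^+ 2.
Proof. by rewrite sqr_sqrtr// addr_ge0// sqr_ge0. Qed.

Lemma weight_ge0 p : 0 <= weight p. Proof. exact: sqrtr_ge0. Qed.

Lemma weight_ge1 p : 1 <= weight p.
Proof.
by rewrite -(@ler_pXn2r _ 2) ?nnegrE ?weight_ge0// weight_sqr expr1n lerDl sqr_ge0.
Qed.

Lemma measurable_weight : measurable_fun setT weight.
Proof.
apply: measurable_fun_sqrt; apply: measurable_funD => //.
by apply: measurable_funX; exact: measurable_pnorm.
Qed.

Lemma measurable_dilate_at a : measurable_fun setT (@dilate R a).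
Proof. exact: (measurableT_comp measurable_dilate (pair1_measurable (a : measurableTypeR R))). Qed.

Lemma weight_dilate_le a p : 1 <= a -> weight (dilate a p) <= a * weight p.
Proof.
move=> a1; have a0 : 0 <= a by exact: le_trans a1.
rewrite -(@ler_pXn2r _ 2) ?nnegrE ?weight_ge0 ?mulr_ge0 ?weight_ge0//.
rewrite exprMn !weight_sqr pnorm_dilate// exprMn mulrDr mulr1 lerD2r.
by rewrite exprn_ege1.
Qed.

Lemma weight_le_dilate a p : 1 <= a -> weight p <= weight (dilate a p).
Proof.
move=> a1; have a0 : 0 <= a by exact: le_trans a1.
rewrite -(@ler_pXn2r _ 2) ?nnegrE ?weight_ge0//.
rewrite !weight_sqr pnorm_dilate// exprMn lerD2l ler_peMl ?sqr_ge0//.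
by rewrite exprn_ege1.
Qed.

(** Both dilations by [a > 1] and by [a < 1] must preserve the form domain, since
[a^-1] occurs in the test functions. *)
Lemma weight_le_dilate_gt0 a p : 0 < a -> weight p <= (1 + a^-1) * weight (dilate a p).
Proof.
move=> a0; have i0 : 0 < a^-1 by rewrite invr_gt0.
rewrite -(@ler_pXn2r _ 2) ?nnegrE ?weight_ge0//; last first.
  by rewrite mulr_ge0 ?weight_ge0// addr_ge0// ltW.
rewrite exprMn !weight_sqr pnorm_dilate ?ltW// exprMn.
have -> : (1 + a^-1) ^+ 2 * (1 + a ^+ 2 * pnorm p ^+ 2) =
  1 + pnorm p ^+ 2 + ((a^-1) ^+ 2 + a^-1 * 2 + (a ^+ 2 + 2 * a) * pnorm p ^+ 2).
  by field; rewrite gt_eqF.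
have : 0 <= (a ^+ 2 + 2 * a) * pnorm p ^+ 2.
  by apply: mulr_ge0; [have := sqr_ge0 a; lra|exact: sqr_ge0].
have := sqr_ge0 a^-1; lra.
Qed.

(** For nonnegative [x] and [y], (x - y)^2 <= |x^2 - y^2|, which reduces the
claim to the continuity of dilations in L^1 for [weight * g ^+ 2].  Moving the
weight under the dilation costs a factor [a - 1]. *)
Lemma dilation_continuous_ge0 (g : momentum R -> R) (a_ : nat -> R) :
  measurable_fun setT g -> (forall p, 0 <= g p) ->
  (\int[mu3]_p (weight p * g p ^+ 2)%:E < +oo)%E ->
  (forall n, 1 <= a_ n <= 2) -> a_ n @[n --> \oo] --> (1 : R) ->
  (\int[mu3]_p (weight p * (g (dilate (a_ n) p) - g p) ^+ 2)%:E)%E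
    @[n --> \oo] --> 0%E.
Proof.
move=> mg g0 gi a12 a1.
pose h p := weight p * g p ^+ 2.
have h0 p : 0 <= h p by rewrite mulr_ge0 ?weight_ge0// sqr_ge0.
have mh : measurable_fun setT h.
  by apply: measurable_funM; [exact: measurable_weight|exact: measurable_funX].
have mhd n : measurable_fun setT (fun p => h (dilate (a_ n) p)).
  exact: (measurableT_comp mh (measurable_dilate_at _)).
have mgd n : measurable_fun setT (fun p => g (dilate (a_ n) p)).
  exact: (measurableT_comp mg (measurable_dilate_at _)).
have mD n : measurable_fun setT (fun p => `|h (dilate (a_ n) p) - h p|).
  by apply: measurableT_comp => //; exact: measurable_funB.
have an n : 0 < a_ n by have /andP[+ _] := a12 n; apply: lt_le_trans.
have an0 n : 0 <= a_ n - 1 by have /andP[+ _] := a12 n; rewrite subr_ge0.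
apply: (@cvge0_leD _ _ (fun n => \int[mu3]_p `|h (dilate (a_ n) p) - h p|%:E)%E
  (fun n => (a_ n - 1)%:E * \int[mu3]_p (h p)%:E)%E).
- by move=> n; apply: integral_ge0 => p _; rewrite lee_fin mulr_ge0 ?weight_ge0 ?sqr_ge0.
- move=> n.
  apply: (@le_trans _ _ (\int[mu3]_p (`|h (dilate (a_ n) p) - h p|%:E +
     (a_ n - 1)%:E * (h (dilate (a_ n) p))%:E))%E).
    apply: ge0_le_integral => //.
    + by move=> p _; rewrite lee_fin mulr_ge0 ?weight_ge0 ?sqr_ge0.
    + apply/measurable_EFinP; apply: measurable_funM; first exact: measurable_weight.
      by apply: measurable_funX; exact: measurable_funB.
    + apply: emeasurable_funD; first exact/measurable_EFinP.
      by apply: measurable_funeM; exact/measurable_EFinP.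
    + move=> p _; rewrite -EFinM -EFinD lee_fin /h.
      have /andP[a1' _] := a12 n.
      have := weight_le_dilate p a1'; have := weight_dilate_le p a1'.
      have := weight_ge0 p; have := weight_ge0 (dilate (a_ n) p).
      have := g0 p; have := g0 (dilate (a_ n) p).
      move: (g (dilate _ p)) (g p) (weight (dilate _ p)) (weight p) => x y w v x0 y0 w0 v0 wv vw.
      have H1 : (x - y) ^+ 2 <= `|x ^+ 2 - y ^+ 2|.
        have -> : x ^+ 2 - y ^+ 2 = (x - y) * (x + y) by ring.
        rewrite normrM -real_normK ?num_real// expr2 ler_wpM2l//.
        rewrite (@ger0_norm _ (x + y)) ?addr_ge0// ler_norml; apply/andP; split; lra.
      have H2 : v * `|x ^+ 2 - y ^+ 2| <= `|w * x ^+ 2 - v * y ^+ 2| + (w - v) * x ^+ 2.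
        rewrite -{1}(ger0_norm v0) -normrM.
        have -> : v * (x ^+ 2 - y ^+ 2) = (w * x ^+ 2 - v * y ^+ 2) - (w - v) * x ^+ 2 by ring.
        rewrite (le_trans (ler_normB _ _))// lerD2l ger0_norm// mulr_ge0 ?sqr_ge0//; lra.
      have H3 : (w - v) * x ^+ 2 <= (a_ n - 1) * (w * x ^+ 2).
        rewrite mulrA ler_wpM2r ?sqr_ge0//.
        have : (a_ n - 1) * v <= (a_ n - 1) * w by apply: ler_wpM2l.
        lra.
      have H4 := ler_wpM2l v0 H1.
      lra.
  rewrite ge0_integralD//; last 3 first.
  + exact/measurable_EFinP.
  + by move=> p _; rewrite -EFinM lee_fin mulr_ge0.
  + by apply: measurable_funeM; exact/measurable_EFinP.
  apply: leeD => //.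
  rewrite ge0_integralZl//; last 3 first.
  + exact/measurable_EFinP.
  + by move=> p _; rewrite lee_fin.
  + by rewrite lee_fin.
  apply: lee_wpmul2l; first by rewrite lee_fin.
  have [_ /(_ (EFin \o h))/= ->//] := scales_lebesgue3 (an n).
  + rewrite -[leRHS]mul1e; apply: lee_wpmul2r.
      by apply: integral_ge0 => p _; rewrite lee_fin.
    have /andP[a1' _] := a12 n.
    by rewrite lee_fin invf_le1 ?exprn_gt0// exprn_ege1.
  + exact/measurable_EFinP.
- apply: (@dilation_continuous_L1 _ _ _ mu3 (@dilate R) measurable_dilate _ 3%N) => //.
  + by move=> s t x _ _; exact: dilate_dilate.
  + exact: scales_lebesgue3.
- have hf : (\int[mu3]_p (h p)%:E)%E \is a fin_num.
    by rewrite ge0_fin_numE//; apply: integral_ge0 => p _; rewrite lee_fin.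
  rewrite -(fineK hf) -[X in _ --> X](_ : (0 * fine (\int[mu3]_p (h p)%:E))%:E = 0%E); last first.
    by rewrite mul0r.
  apply: cvg_EFin; first exact: nearW.
  apply: cvgM; last exact: cvg_cst.
  by rewrite -[X in _ --> X](subrr 1); apply: cvgB => //; exact: cvg_cst.
Qed.

(** The inequality used for nonnegative functions fails across a sign change, so
positive and negative part are treated separately. *)
Lemma dilation_continuous_real (f : momentum R -> R) (a_ : nat -> R) :
  measurable_fun setT f ->
  (\int[mu3]_p (weight p * f p ^+ 2)%:E < +oo)%E ->
  (forall n, 1 <= a_ n <= 2) -> a_ n @[n --> \oo] --> (1 : R) ->
  (\int[mu3]_p (weight p * (f (dilate (a_ n) p) - f p) ^+ 2)%:E)%E
    @[n --> \oo] --> 0%E.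
Proof.
move=> mf fi a12 a1.
have mw := measurable_weight.
have key (g : momentum R -> R) : measurable_fun setT g -> (forall p, 0 <= g p) ->
    (forall p, g p ^+ 2 <= 2 * f p ^+ 2) ->
    (2%:E * \int[mu3]_p (weight p * (g (dilate (a_ n) p) - g p) ^+ 2)%:E)%E
    @[n --> \oo] --> 0%E.
  move=> mg g0 gf.
  have H : (\int[mu3]_p (weight p * (g (dilate (a_ n) p) - g p) ^+ 2)%:E)%E
      @[n --> \oo] --> 0%E.
    apply: dilation_continuous_ge0 => //.
    apply: (@le_lt_trans _ _ (\int[mu3]_p (2%:E * (weight p * f p ^+ 2)%:E))%E).
      apply: ge0_le_integral => //.
      - by move=> p _; rewrite lee_fin mulr_ge0 ?weight_ge0 ?sqr_ge0.
      - by apply/measurable_EFinP; apply: measurable_funM => //; exact: measurable_funX.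
      - apply: measurable_funeM; apply/measurable_EFinP; apply: measurable_funM => //.
        exact: measurable_funX.
      - move=> p _; rewrite -EFinM lee_fin [X in _ <= X]mulrCA; apply: ler_wpM2l => //.
        exact: weight_ge0.
    rewrite ge0_integralZl//.
    - by rewrite lte_mul_pinfty.
    - by apply/measurable_EFinP; apply: measurable_funM => //; exact: measurable_funX.
    - by move=> p _; rewrite lee_fin mulr_ge0 ?weight_ge0 ?sqr_ge0.
  apply: (@cvge0_leD _ _ _ _ _ _ H H).
  - move=> n; rewrite mule_ge0//; apply: integral_ge0 => p _.
    by rewrite lee_fin mulr_ge0 ?weight_ge0 ?sqr_ge0.
  - by move=> n; rewrite muleC -[2%:E]/(2%:R%:E) mule_natr mule2n.
pose fp p := Num.max (f p) 0; pose fm p := Num.max (- f p) 0.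
have mfp : measurable_fun setT fp by exact: measurable_maxr.
have mfm : measurable_fun setT fm.
  by apply: measurable_maxr => //; exact: measurable_funN.
have mfd n : measurable_fun setT (fun p => f (dilate (a_ n) p)).
  exact: (measurableT_comp mf (measurable_dilate_at _)).
have mfpd n : measurable_fun setT (fun p => fp (dilate (a_ n) p)).
  exact: (measurableT_comp mfp (measurable_dilate_at _)).
have mfmd n : measurable_fun setT (fun p => fm (dilate (a_ n) p)).
  exact: (measurableT_comp mfm (measurable_dilate_at _)).
have fE p : f p = fp p - fm p by rewrite /fp /fm; case: (leP (f p) 0) => ?; case: leP => ?; lra.
have kp := key fp mfp; have km := key fm mfm.
apply: (@cvge0_leD _ _ _ _ _ _ (kp _ _) (km _ _)).
- by move=> n; apply: integral_ge0 => p _; rewrite lee_fin mulr_ge0 ?weight_ge0 ?sqr_ge0.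
- move=> n.
  have mp : measurable_fun setT (fun p => (weight p * (fp (dilate (a_ n) p) - fp p) ^+ 2)%:E).
    apply/measurable_EFinP; apply: measurable_funM => //.
    by apply: measurable_funX; exact: measurable_funB.
  have mm : measurable_fun setT (fun p => (weight p * (fm (dilate (a_ n) p) - fm p) ^+ 2)%:E).
    apply/measurable_EFinP; apply: measurable_funM => //.
    by apply: measurable_funX; exact: measurable_funB.
  have pp p : (0 <= (weight p * (fp (dilate (a_ n) p) - fp p) ^+ 2)%:E)%E.
    by rewrite lee_fin mulr_ge0 ?weight_ge0 ?sqr_ge0.
  have pm p : (0 <= (weight p * (fm (dilate (a_ n) p) - fm p) ^+ 2)%:E)%E.
    by rewrite lee_fin mulr_ge0 ?weight_ge0 ?sqr_ge0.
  rewrite -ge0_integralZl// -ge0_integralZl// -ge0_integralD//; last 4 first.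
  + by move=> p _; rewrite mule_ge0.
  + exact: measurable_funeM.
  + by move=> p _; rewrite mule_ge0.
  + exact: measurable_funeM.
  apply: ge0_le_integral => //.
  + by move=> p _; rewrite lee_fin mulr_ge0 ?weight_ge0 ?sqr_ge0.
  + apply/measurable_EFinP; apply: measurable_funM => //.
    by apply: measurable_funX; exact: measurable_funB.
  + by apply: emeasurable_funD; exact: measurable_funeM.
  + move=> p _; rewrite -!EFinM -EFinD lee_fin !fE.
    move: (fp _) (fm _) (fp _) (fm _) (weight p) (weight_ge0 p) => x y x' y' w w0.
    have : 0 <= w * ((x - x') + (y - y')) ^+ 2 by rewrite mulr_ge0 ?sqr_ge0.
    have -> : w * ((x - x') + (y - y')) ^+ 2 = 2 * (w * (x - x') ^+ 2) + 2 * (w * (y - y') ^+ 2) - w * (x - y - (x' - y')) ^+ 2 by ring.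
    lra.
- by move=> p; rewrite /fp le_max lexx orbT.
- by move=> p; have sq := sqr_ge0 (f p); have h0 : (0 : R) ^+ 2 = 0 by [rewrite expr0n]; rewrite /fp; case: (leP (f p) 0) => ?; rewrite ?h0; lra.
- by move=> p; rewrite /fm le_max lexx orbT.
- by move=> p; have sq := sqr_ge0 (f p); have h0 : (0 : R) ^+ 2 = 0 by [rewrite expr0n]; rewrite /fm; case: (leP (- f p) 0) => ?; rewrite ?h0 ?sqrrN; lra.
Qed.

Lemma br_domain_cmeasurable (phi : spinor R) : br_domain phi ->
  forall i, cmeasurable (fun p => phi p i 0).
Proof. by move=> [mphi _] i; exact: mphi. Qed.

Lemma dilation_continuous_spinor (phi : spinor R) (a_ : nat -> R) :
  br_domain phi ->
  (forall n, 1 <= a_ n <= 2) -> a_ n @[n --> \oo] --> (1 : R) ->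
  (\int[mu3]_p (weight p * sqnorm (phi (dilate (a_ n) p) - phi p))%:E)%E
    @[n --> \oo] --> 0%E.
Proof.
move=> dphi a12 a1; have mphi := br_domain_cmeasurable dphi; case: dphi => _ iphi.
have mw := measurable_weight.
have msq : measurable_fun setT (fun p => sqnorm (phi p)) by exact: measurable_sqnorm.
have key (f : momentum R -> R) : measurable_fun setT f ->
    (forall p, f p ^+ 2 <= sqnorm (phi p)) ->
    (\int[mu3]_p (weight p * (f (dilate (a_ n) p) - f p) ^+ 2)%:E)%E
    @[n --> \oo] --> 0%E.
  move=> mf fle; apply: dilation_continuous_real => //.
  apply: le_lt_trans iphi; apply: ge0_le_integral => //.
  - by move=> p _; rewrite lee_fin mulr_ge0 ?weight_ge0 ?sqr_ge0.
  - by apply/measurable_EFinP; apply: measurable_funM => //; exact: measurable_funX.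
  - by apply/measurable_EFinP; exact: measurable_funM.
  - by move=> p _; rewrite lee_fin; apply: ler_wpM2l => //; exact: weight_ge0.
pose re i p := complex.Re (phi p i 0); pose im i p := complex.Im (phi p i 0).
have mre i : measurable_fun setT (re i) by have [] := mphi i.
have mim i : measurable_fun setT (im i) by have [] := mphi i.
have le2 (i : 'I_2) p : re i p ^+ 2 + im i p ^+ 2 <= sqnorm (phi p).
  rewrite sqnormE (bigD1 i)//= lerDl; apply: sumr_ge0 => j _.
  by rewrite addr_ge0// sqr_ge0.
have kre i := key (re i) (mre i) (fun p => le_trans (ler_wpDr (sqr_ge0 _) (lexx _)) (le2 i p)).
have kim i := key (im i) (mim i) (fun p => le_trans (ler_wpDl (sqr_ge0 _) (lexx _)) (le2 i p)).
have md (f : momentum R -> R) n : measurable_fun setT f ->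
    measurable_fun setT (fun p => (weight p * (f (dilate (a_ n) p) - f p) ^+ 2)%:E).
  move=> mf; apply/measurable_EFinP; apply: measurable_funM => //.
  apply: measurable_funX; apply: measurable_funB => //.
  exact: (measurableT_comp mf (measurable_dilate_at _)).
have pd (f : momentum R -> R) n p : (0 <= (weight p * (f (dilate (a_ n) p) - f p) ^+ 2)%:E)%E.
  by rewrite lee_fin mulr_ge0 ?weight_ge0 ?sqr_ge0.
have pI (f : momentum R -> R) n : (0 <= \int[mu3]_p (weight p * (f (dilate (a_ n) p) - f p) ^+ 2)%:E)%E.
  by apply: integral_ge0.
have k0 := @cvge0_leD _ (fun n => \int[mu3]_p (weight p * (re 0 (dilate (a_ n) p) - re 0 p) ^+ 2)%:E +
   \int[mu3]_p (weight p * (im 0 (dilate (a_ n) p) - im 0 p) ^+ 2)%:E)%E _ _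
   (fun n => adde_ge0 (pI _ _) (pI _ _)) (fun n => lexx _) (kre 0) (kim 0).
have k1 := @cvge0_leD _ (fun n => \int[mu3]_p (weight p * (re 1 (dilate (a_ n) p) - re 1 p) ^+ 2)%:E +
   \int[mu3]_p (weight p * (im 1 (dilate (a_ n) p) - im 1 p) ^+ 2)%:E)%E _ _
   (fun n => adde_ge0 (pI _ _) (pI _ _)) (fun n => lexx _) (kre 1) (kim 1).
apply: (@cvge0_leD _ _ _ _ _ _ k0 k1).
- by move=> n; apply: integral_ge0 => p _; rewrite lee_fin mulr_ge0 ?weight_ge0 ?sqnorm_ge0.
- move=> n; rewrite -!ge0_integralD//; try by [exact: md|exact: emeasurable_funD (md _ _ _) (md _ _ _)|move=> p _; exact: adde_ge0].
  apply: ge0_le_integral => //.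
  + by move=> p _; rewrite lee_fin mulr_ge0 ?weight_ge0 ?sqnorm_ge0.
  + apply/measurable_EFinP; apply: measurable_funM => //; apply: measurable_sqnorm => i.
    under eq_fun do rewrite !mxE.
    apply: cmeasurableD; first exact: (cmeasurable_comp (mphi i) (measurable_dilate_at _)).
    by under eq_fun do rewrite -mulN1r; apply: cmeasurableM => //; exact: cmeasurable_cst.
  + by apply: emeasurable_funD; apply: emeasurable_funD; exact: md.
  + move=> p _; rewrite -!EFinD lee_fin -!mulrDr /re /im sqnormE !big_ord_recl big_ord0 addr0.
    rewrite (_ : lift ord0 ord0 = 1); last exact: val_inj.
    by rewrite !mxE !ReB !ImB.
Qed.

End weighted.

(** * The Hardy-Kato bound for pairs of momenta *)

Section schur_pairs.
Context {R : realType}.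
Notation mu3 := (@lebesgue3 R).
Notation mu33 := (@lebesgue33 R).
Notation pair := (momentum R * momentum R)%type.

(** The parameter to be used in Young's inequality: with it, each of the two
squares can be integrated over the other momentum by [schur_space]. *)
Definition weight_ratio (q : pair) : R := Omega q.1 ^+ 2 / Omega q.2 ^+ 2.

Lemma weight_ratio_gt0 q : 0 < weight_ratio q.
Proof. by rewrite divr_gt0// exprn_gt0// Omega_gt0. Qed.

Lemma measurable_weight_ratio : measurable_fun setT weight_ratio.
Proof.
apply: measurable_funM; [|apply: measurable_funV]; apply: measurable_funX.
- exact: (measurableT_comp (@measurable_Omega R) measurable_fst).
- exact: (measurableT_comp (@measurable_Omega R) measurable_snd).
Qed.

Lemma measurable_inv_pdist :
  measurable_fun setT (fun q : pair => (pdist q.1 q.2 ^+ 2)^-1).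
Proof. by apply: measurable_funV; apply: measurable_funX; exact: measurable_pdist. Qed.

Definition schur_const : R := 2 * 108 ^+ 3.

Lemma schur_const_gt0 : 0 < schur_const.
Proof. by rewrite mulr_gt0// exprn_gt0. Qed.

(** Integrating over the second momentum leaves [Omega q.1], which is at most twice
the weight of the form domain. *)
Lemma schur_fst (w : momentum R -> R) : measurable_fun setT w -> (forall p, 0 <= w p) ->
  (\int[mu33]_q ((pdist q.1 q.2 ^+ 2)^-1 * (weight_ratio q * w q.1))%:E <=
   schur_const%:E * \int[mu3]_p (weight p * w p)%:E)%E.
Proof.
move=> mw w0.
have mq : measurable_fun setT
    (fun q : pair => ((pdist q.1 q.2 ^+ 2)^-1 * (weight_ratio q * w q.1))%:E).
  apply/measurable_EFinP; apply: measurable_funM; first exact: measurable_inv_pdist.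
  by apply: measurable_funM; [exact: measurable_weight_ratio|exact: (measurableT_comp mw measurable_fst)].
have q0 q : (0 <= ((pdist q.1 q.2 ^+ 2)^-1 * (weight_ratio q * w q.1))%:E)%E.
  by rewrite lee_fin mulr_ge0 ?invr_ge0 ?sqr_ge0// mulr_ge0// ltW// weight_ratio_gt0.
rewrite (@fubini_tonelli1 _ _ _ _ R mu3 mu3 _ mq q0) /fubini_F /=.
have mww : measurable_fun setT (fun p => (weight p * w p)%:E).
  by apply/measurable_EFinP; apply: measurable_funM => //; exact: measurable_weight.
have ww0 p : (0 <= (weight p * w p)%:E)%E by rewrite lee_fin mulr_ge0 ?weight_ge0.
rewrite -ge0_integralZl//; last by rewrite lee_fin ltW// schur_const_gt0.
apply: ge0_le_integral => //.
- by move=> p _; apply: integral_ge0 => p' _; exact: (q0 (p, p')).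
- exact: (@measurable_fun_fubini_tonelli_F _ _ _ _ R mu3 _ mq q0).
- apply: measurable_funeM; apply/measurable_EFinP; apply: measurable_funM => //.
  exact: measurable_weight.
move=> p _.
have O0 := Omega_gt0 p.
have mp : measurable_fun setT (fun p' : momentum R =>
    ((pdist p p' ^+ 2)^-1)%:E * ((Omega p' ^+ 2)^-1)%:E : \bar R)%E.
  apply: emeasurable_funM; apply/measurable_EFinP.
    exact: (measurableT_comp measurable_inv_pdist (pair1_measurable p)).
  by apply: measurable_funV; apply: measurable_funX; exact: measurable_Omega.
rewrite (eq_integral (fun p' => (Omega p ^+ 2 * w p)%:E *
   (((pdist p p' ^+ 2)^-1)%:E * ((Omega p' ^+ 2)^-1)%:E))%E); last first.
  by move=> p' _; rewrite -!EFinM /weight_ratio/=; congr EFin; ring.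
rewrite ge0_integralZl//; last 2 first.
- by move=> p' _; rewrite -EFinM lee_fin mulr_ge0 ?invr_ge0 ?sqr_ge0.
- by rewrite lee_fin mulr_ge0 ?sqr_ge0.
apply: (@le_trans _ _ ((Omega p ^+ 2 * w p)%:E * (108 ^+ 3 / Omega p)%:E)%E).
  apply: lee_wpmul2l; last exact: schur_space.
  by rewrite lee_fin mulr_ge0 ?sqr_ge0.
rewrite -!EFinM lee_fin.
have -> : Omega p ^+ 2 * w p * (108 ^+ 3 / Omega p) = 108 ^+ 3 * (Omega p * w p).
  by field; rewrite gt_eqF.
rewrite /schur_const; set K := 108 ^+ 3.
rewrite (_ : 2 * K * (weight p * w p) = K * (2 * weight p * w p)); last by ring.
apply: ler_wpM2l; first by rewrite exprn_ge0.
by apply: ler_wpM2r => //; exact: Omega_le.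
Qed.

Lemma schur_snd (w : momentum R -> R) : measurable_fun setT w -> (forall p, 0 <= w p) ->
  (\int[mu33]_q ((pdist q.1 q.2 ^+ 2)^-1 * ((weight_ratio q)^-1 * w q.2))%:E <=
   schur_const%:E * \int[mu3]_p (weight p * w p)%:E)%E.
Proof.
move=> mw w0; apply: le_trans (schur_fst mw w0).
have mq : measurable_fun setT
    (fun q : pair => ((pdist q.1 q.2 ^+ 2)^-1 * (weight_ratio q * w q.1))%:E).
  apply/measurable_EFinP; apply: measurable_funM; first exact: measurable_inv_pdist.
  by apply: measurable_funM; [exact: measurable_weight_ratio|exact: (measurableT_comp mw measurable_fst)].
have q0 q : (0 <= ((pdist q.1 q.2 ^+ 2)^-1 * (weight_ratio q * w q.1))%:E)%E.
  by rewrite lee_fin mulr_ge0 ?invr_ge0 ?sqr_ge0// mulr_ge0// ltW// weight_ratio_gt0.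
rewrite -(@ge0_integral_swap _ _ R mu3 _ mq q0).
rewrite le_eqVlt; apply/orP; left; apply/eqP; apply: eq_integral => q _ /=.
by rewrite pdistC /weight_ratio invf_div.
Qed.

End schur_pairs.

(** * Energy and normalisation factor under dilation *)

Section symbols.
Context {R : realType}.
Variables (m c : R).
Hypotheses (m0 : 0 < m) (c0 : 0 < c).
Notation E := (energy m c).
Notation N := (nfactor m c).
Notation e0 := (energy m c 0).
Implicit Types (a r : R).

Lemma energy0 : e0 = m * c ^+ 2.
Proof.
rewrite /energy expr0n mulr0 add0r.
have -> : m ^+ 2 * c ^+ 4 = (m * c ^+ 2) ^+ 2 by ring.
by rewrite sqrtr_sqr ger0_norm// mulr_ge0 ?sqr_ge0// ltW.
Qed.

Lemma energy0_gt0 : 0 < e0.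
Proof. by rewrite energy0 mulr_gt0// exprn_gt0. Qed.

Lemma energy_sqr r : E r ^+ 2 = c ^+ 2 * r ^+ 2 + e0 ^+ 2.
Proof.
rewrite energy0 sqr_sqrtr; first by ring.
by rewrite addr_ge0// mulr_ge0 ?sqr_ge0// exprn_even_ge0.
Qed.

Lemma energy_ge0 r : 0 <= E r. Proof. exact: sqrtr_ge0. Qed.

Lemma energy_ge_e0 r : e0 <= E r.
Proof.
rewrite -(@ler_pXn2r _ 2) ?nnegrE ?energy_ge0// (energy_sqr r) lerDr.
by rewrite mulr_ge0 ?sqr_ge0.
Qed.

Lemma energy_gt0 r : 0 < E r.
Proof. exact: lt_le_trans energy0_gt0 (energy_ge_e0 r). Qed.

Lemma energy_ge_cr r : 0 <= r -> c * r <= E r.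
Proof.
move=> r0; rewrite -(@ler_pXn2r _ 2) ?nnegrE ?energy_ge0 ?mulr_ge0 ?(ltW c0)//.
by rewrite (energy_sqr r) exprMn lerDl sqr_ge0.
Qed.

Lemma nfactor_sqr r : N r ^+ 2 = 2 * E r * (E r + e0).
Proof.
rewrite sqr_sqrtr// !mulr_ge0 ?energy_ge0//.
by rewrite addr_ge0 ?energy_ge0// energy_ge0.
Qed.

Lemma nfactor_ge0 r : 0 <= N r. Proof. exact: sqrtr_ge0. Qed.

Lemma nfactor_ge r : E r <= N r.
Proof.
rewrite -(@ler_pXn2r _ 2) ?nnegrE ?energy_ge0 ?nfactor_ge0// nfactor_sqr.
have := energy_gt0 r; have := energy0_gt0; nra.
Qed.

Lemma nfactor_gt0 r : 0 < N r.
Proof. exact: lt_le_trans (energy_gt0 r) (nfactor_ge r). Qed.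

Lemma energy_scale a r : 1 <= a -> 0 <= r -> E r <= E (a * r).
Proof.
move=> a1 r0; rewrite -(@ler_pXn2r _ 2) ?nnegrE ?energy_ge0// (energy_sqr (a * r)) (energy_sqr r) lerD2r.
rewrite ler_pM2l ?exprn_gt0// ler_pXn2r ?nnegrE ?mulr_ge0//; last by exact: le_trans a1.
by rewrite ler_peMl.
Qed.

Lemma nfactor_scale a r : 1 <= a -> 0 <= r -> N r <= N (a * r).
Proof.
move=> a1 r0; have h := energy_scale a1 r0.
rewrite -(@ler_pXn2r _ 2) ?nnegrE ?nfactor_ge0// !nfactor_sqr.
have := energy_gt0 r; have := energy0_gt0; nra.
Qed.

(** The difference quotients are written without division by [a - 1], by
rationalising square roots; bounds uniform up to [a = 1] and the limits can
then be read off. *)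
Definition dE a r := c ^+ 2 * r ^+ 2 * (a + 1) / (E (a * r) + E r).
Definition dN a r := (2 * (c ^+ 2 * r ^+ 2 * (a + 1)) + 2 * e0 * dE a r) / (N (a * r) + N r).

(** The symbol of K^1 is the product of [upper] at the two momenta; that of K^2 is
built from [c / N], whose difference quotient is [dlower]. *)
Definition upper r := (E r + e0) / N r.
Definition dupper a r := (dE a r * N r - (E r + e0) * dN a r) / (N (a * r) * N r).
Definition dlower a r := (N r - dN a r) / (N (a * r) * N r).

Lemma dE_eq a r : E (a * r) - E r = (a - 1) * dE a r.
Proof.
have s0 : E (a * r) + E r != 0 by rewrite gt_eqF// addr_gt0// energy_gt0.
apply: (mulIf s0); rewrite /dE mulrA divfK//.
have -> : (E (a * r) - E r) * (E (a * r) + E r) = E (a * r) ^+ 2 - E r ^+ 2 by ring.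
by rewrite (energy_sqr (a * r)) (energy_sqr r); ring.
Qed.

Lemma dN_eq a r : N (a * r) - N r = (a - 1) * dN a r.
Proof.
have s0 : N (a * r) + N r != 0 by rewrite gt_eqF// addr_gt0// nfactor_gt0.
apply: (mulIf s0); rewrite /dN mulrA divfK//.
have -> : (N (a * r) - N r) * (N (a * r) + N r) = N (a * r) ^+ 2 - N r ^+ 2 by ring.
have -> : (a - 1) * (2 * (c ^+ 2 * r ^+ 2 * (a + 1)) + 2 * e0 * dE a r) =
  2 * (E (a * r) ^+ 2 - E r ^+ 2) + 2 * e0 * (E (a * r) - E r).
  by rewrite dE_eq (energy_sqr (a * r)) (energy_sqr r); ring.
by rewrite !nfactor_sqr; ring.
Qed.

Lemma dupper_eq a r : upper (a * r) - upper r = (a - 1) * dupper a r.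
Proof.
have n0 : N (a * r) != 0 by rewrite gt_eqF// nfactor_gt0.
have n1 : N r != 0 by rewrite gt_eqF// nfactor_gt0.
transitivity (((E (a * r) - E r) * N r - (E r + e0) * (N (a * r) - N r)) /
    (N (a * r) * N r)).
  by rewrite /upper; field; rewrite n0 n1.
by rewrite dE_eq dN_eq /dupper; field; rewrite n0 n1.
Qed.

Lemma dlower_eq a r : a / N (a * r) - (N r)^-1 = (a - 1) * dlower a r.
Proof.
have n0 : N (a * r) != 0 by rewrite gt_eqF// nfactor_gt0.
have n1 : N r != 0 by rewrite gt_eqF// nfactor_gt0.
rewrite /dlower mulrA mulrBr -dN_eq.
by field; rewrite n0 n1.
Qed.

Lemma dE_bounds a r : 1 <= a <= 2 -> 0 <= r -> 0 <= dE a r <= 2 * E r.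
Proof.
move=> /andP[a1 a2] r0; have h := energy_scale a1 r0; have e := energy_gt0 r.
have E2 := energy_sqr r.
have s0 : 0 < E (a * r) + E r by lra.
have cr : 0 <= c ^+ 2 * r ^+ 2 by rewrite mulr_ge0 ?sqr_ge0.
have e02 := sqr_ge0 e0.
rewrite /dE; apply/andP; split.
  by apply: divr_ge0; [apply: mulr_ge0 => //; lra|exact: ltW].
rewrite ler_pdivrMr//.
have : c ^+ 2 * r ^+ 2 * (a + 1) <= c ^+ 2 * r ^+ 2 * 3 by apply: ler_wpM2l => //; lra.
have : 2 * E r * (2 * E r) <= 2 * E r * (E (a * r) + E r).
  by apply: ler_wpM2l; lra.
nra.
Qed.

Lemma dN_bounds a r : 1 <= a <= 2 -> 0 <= r -> 0 <= dN a r <= 5 * E r.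
Proof.
move=> a12 r0; have /andP[d0 d1] := dE_bounds a12 r0; have /andP[a1 a2] := a12.
have h := nfactor_scale a1 r0; have e := energy_gt0 r; have n := nfactor_ge r.
have E2 := energy_sqr r; have e00 := energy0_gt0; have e01 := energy_ge_e0 r.
have s0 : 0 < N (a * r) + N r by lra.
have cr : 0 <= c ^+ 2 * r ^+ 2 by rewrite mulr_ge0 ?sqr_ge0.
have e02 := sqr_ge0 e0.
have t1 : 0 <= c ^+ 2 * r ^+ 2 * (a + 1) by rewrite mulr_ge0//; lra.
have t2 : c ^+ 2 * r ^+ 2 * (a + 1) <= E r ^+ 2 * 3.
  apply: (@le_trans _ _ (c ^+ 2 * r ^+ 2 * 3)); first by apply: ler_wpM2l => //; lra.
  by apply: ler_wpM2r => //; lra.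
have t3 : 0 <= e0 * dE a r by rewrite mulr_ge0// ltW.
have t4 : e0 * dE a r <= E r * (2 * E r) by apply: ler_pM => //; exact: ltW.
rewrite /dN; apply/andP; split; first by rewrite divr_ge0//; lra.
rewrite ler_pdivrMr//.
have : 5 * E r * (2 * E r) <= 5 * E r * (N (a * r) + N r) by apply: ler_wpM2l; lra.
nra.
Qed.

Lemma upper_bounds r : 0 <= upper r <= 2.
Proof.
have e := energy_gt0 r; have n := nfactor_ge r; have e00 := energy0_gt0.
have e01 := energy_ge_e0 r; have n0 := nfactor_gt0 r.
rewrite /upper divr_ge0/= ?ler_pdivrMr//; lra.
Qed.

Lemma dupper_bound a r : 1 <= a <= 2 -> 0 <= r -> `|dupper a r| <= 14.
Proof.
move=> a12 r0; have /andP[d0 d1] := dE_bounds a12 r0; have /andP[a1 a2] := a12.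
have /andP[n0 n1] := dN_bounds a12 r0.
have h := nfactor_scale a1 r0; have e := energy_gt0 r; have n := nfactor_ge r.
have e00 := energy0_gt0; have e01 := energy_ge_e0 r.
have np := nfactor_gt0 r.
have nn : 0 < N (a * r) * N r by rewrite mulr_gt0// nfactor_gt0.
rewrite /dupper normrM normfV (gtr0_norm nn) ler_pdivrMr//.
have b1 : 0 <= dE a r * N r by rewrite mulr_ge0// ltW.
have b2 : dE a r * N r <= 2 * E r * N r by apply: ler_wpM2r => //; exact: ltW.
have b3 : 0 <= (E r + e0) * dN a r by rewrite mulr_ge0//; lra.
have b4 : (E r + e0) * dN a r <= (2 * E r) * (5 * N r).
  by apply: ler_pM => //; lra.
have b5 : E r * N r <= N (a * r) * N r by apply: ler_wpM2r; lra.
by rewrite ler_norml; apply/andP; split; lra.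
Qed.

Lemma dlower_bound a r : 1 <= a <= 2 -> 0 <= r -> c * r * `|dlower a r| <= 6.
Proof.
move=> a12 r0; have /andP[a1 a2] := a12.
have /andP[n0 n1] := dN_bounds a12 r0.
have h := nfactor_scale a1 r0; have e := energy_gt0 r; have n := nfactor_ge r.
have np := nfactor_gt0 r; have cr := energy_ge_cr r0.
have cr0 : 0 <= c * r by rewrite mulr_ge0// ltW.
have nn : 0 < N (a * r) * N r by rewrite mulr_gt0// nfactor_gt0.
rewrite /dlower normrM normfV (gtr0_norm nn) mulrA ler_pdivrMr//.
have b1 : `|N r - dN a r| <= 6 * N r by rewrite ler_norml; apply/andP; split; lra.
have b2 : c * r <= N (a * r) by lra.
have := ler_pM cr0 (normr_ge0 _) b2 b1; lra.
Qed.

Lemma lower_le1 a r : 1 <= a -> 0 <= r -> 0 <= c * r * (a / N (a * r)) <= 1.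
Proof.
move=> a1 r0; have ar : 0 <= a * r by rewrite mulr_ge0//; lra.
have cr := energy_ge_cr ar; have n := nfactor_ge (a * r); have np := nfactor_gt0 (a * r).
have -> : c * r * (a / N (a * r)) = c * (a * r) / N (a * r) by ring.
apply/andP; split; last by rewrite ler_pdivrMr//; lra.
by apply: divr_ge0; [apply: mulr_ge0 => //; exact: ltW|exact: ltW].
Qed.

Section limits.
Variable a_ : nat -> R.
Hypothesis a1 : a_ n @[n --> \oo] --> (1 : R).

Lemma cvg_scale r : a_ n * r @[n --> \oo] --> r.
Proof. by rewrite -[X in _ --> X]mul1r; apply: cvgM => //; exact: cvg_cst. Qed.

Lemma cvg_energy r : E (a_ n * r) @[n --> \oo] --> E r.
Proof.
apply: (@continuous_cvg _ _ _ _ _ _ (fun x => Num.sqrt x)); first exact: sqrt_continuous.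
apply: cvgD; last exact: cvg_cst.
apply: cvgM; first exact: cvg_cst.
apply: (@continuous_cvg _ _ _ _ _ _ (fun x : R => x ^+ 2)); first exact: exprn_continuous.
exact: cvg_scale.
Qed.

Lemma cvg_nfactor r : N (a_ n * r) @[n --> \oo] --> N r.
Proof.
apply: (@continuous_cvg _ _ _ _ _ _ (fun x => Num.sqrt x)); first exact: sqrt_continuous.
apply: cvgM.
  by apply: cvgM; [exact: cvg_cst|exact: cvg_energy].
by apply: cvgD; [exact: cvg_energy|exact: cvg_cst].
Qed.

Lemma cvg_dE r : dE (a_ n) r @[n --> \oo] --> c ^+ 2 * r ^+ 2 / E r.
Proof.
have e := energy_gt0 r.
have -> : c ^+ 2 * r ^+ 2 / E r = c ^+ 2 * r ^+ 2 * (1 + 1) / (E r + E r).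
  by field; rewrite !gt_eqF// addr_gt0.
apply: cvgM.
  by apply: cvgM; [exact: cvg_cst|apply: cvgD => //; exact: cvg_cst].
apply: cvgV; first by rewrite gt_eqF// addr_gt0.
by apply: cvgD; [exact: cvg_energy|exact: cvg_cst].
Qed.

Lemma cvg_dN r : dN (a_ n) r @[n --> \oo] -->
  (2 * (c ^+ 2 * r ^+ 2) + e0 * (c ^+ 2 * r ^+ 2 / E r)) / N r.
Proof.
have n := nfactor_gt0 r; have e := energy_gt0 r.
have -> : (2 * (c ^+ 2 * r ^+ 2) + e0 * (c ^+ 2 * r ^+ 2 / E r)) / N r =
  (2 * (c ^+ 2 * r ^+ 2 * (1 + 1)) + 2 * e0 * (c ^+ 2 * r ^+ 2 / E r)) / (N r + N r).
  by field; rewrite !gt_eqF// addr_gt0.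
apply: cvgM; last first.
  apply: cvgV; first by rewrite gt_eqF// addr_gt0.
  by apply: cvgD; [exact: cvg_nfactor|exact: cvg_cst].
apply: cvgD.
  apply: cvgM; first exact: cvg_cst.
  by apply: cvgM; [exact: cvg_cst|apply: cvgD => //; exact: cvg_cst].
by apply: cvgM; [exact: cvg_cst|exact: cvg_dE].
Qed.

Lemma cvg_upper r : upper (a_ n * r) @[n --> \oo] --> upper r.
Proof.
apply: cvgM.
  by apply: cvgD; [exact: cvg_energy|exact: cvg_cst].
by apply: cvgV; [rewrite gt_eqF// nfactor_gt0|exact: cvg_nfactor].
Qed.

Lemma cvg_lower r : a_ n / N (a_ n * r) @[n --> \oo] --> (N r)^-1.
Proof.
rewrite -[X in _ --> X]mul1r; apply: cvgM => //.
by apply: cvgV; [rewrite gt_eqF// nfactor_gt0|exact: cvg_nfactor].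
Qed.

(** The limit is the derivative of [upper (a * r)] in [a] at 1, simplified with
n^2 = 2 e (e + e(0)) and c^2 r^2 = e^2 - e(0)^2. *)
Lemma cvg_dupper r : dupper (a_ n) r @[n --> \oo] -->
  - (e0 / 2) * ((E r)^-1 - e0 / E r ^+ 2) * upper r.
Proof.
have n := nfactor_gt0 r; have e := energy_gt0 r; have e00 := energy0_gt0.
have cr : c ^+ 2 * r ^+ 2 = E r ^+ 2 - e0 ^+ 2 by rewrite energy_sqr; ring.
have n2 := nfactor_sqr r.
have -> : - (e0 / 2) * ((E r)^-1 - e0 / E r ^+ 2) * upper r =
  (c ^+ 2 * r ^+ 2 / E r * N r - (E r + e0) *
    ((2 * (c ^+ 2 * r ^+ 2) + e0 * (c ^+ 2 * r ^+ 2 / E r)) / N r)) / (N r * N r).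
  rewrite cr /upper; apply: (mulIf (x := N r ^+ 3)); first by rewrite expf_neq0// gt_eqF.
  transitivity (- (e0 / 2) * ((E r)^-1 - e0 / E r ^+ 2) * (E r + e0) * N r ^+ 2).
    by field; rewrite !gt_eqF.
  transitivity ((E r ^+ 2 - e0 ^+ 2) / E r * N r ^+ 2 - (E r + e0) *
    ((2 * (E r ^+ 2 - e0 ^+ 2) + e0 * ((E r ^+ 2 - e0 ^+ 2) / E r)))).
    by rewrite n2; field; rewrite !gt_eqF.
  by field; rewrite !gt_eqF.
apply: cvgM; last first.
  apply: cvgV; first by rewrite gt_eqF// mulr_gt0.
  by apply: cvgM; [exact: cvg_nfactor|exact: cvg_cst].
apply: cvgB.
  by apply: cvgM; [exact: cvg_dE|exact: cvg_cst].
by apply: cvgM; [exact: cvg_cst|exact: cvg_dN].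
Qed.

Lemma cvg_dlower r : dlower (a_ n) r @[n --> \oo] -->
  (e0 / 2) * ((E r)^-1 + e0 / E r ^+ 2) / N r.
Proof.
have n := nfactor_gt0 r; have e := energy_gt0 r; have e00 := energy0_gt0.
have cr : c ^+ 2 * r ^+ 2 = E r ^+ 2 - e0 ^+ 2 by rewrite energy_sqr; ring.
have n2 := nfactor_sqr r.
have -> : (e0 / 2) * ((E r)^-1 + e0 / E r ^+ 2) / N r =
  (N r - (2 * (c ^+ 2 * r ^+ 2) + e0 * (c ^+ 2 * r ^+ 2 / E r)) / N r) / (N r * N r).
  rewrite cr; apply: (mulIf (x := N r ^+ 3)); first by rewrite expf_neq0// gt_eqF.
  transitivity ((e0 / 2) * ((E r)^-1 + e0 / E r ^+ 2) * N r ^+ 2).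
    by field; rewrite !gt_eqF.
  transitivity (N r ^+ 2 - (2 * (E r ^+ 2 - e0 ^+ 2) + e0 * ((E r ^+ 2 - e0 ^+ 2) / E r))).
    by rewrite n2; field; rewrite !gt_eqF.
  by field; rewrite !gt_eqF.
apply: cvgM; last first.
  apply: cvgV; first by rewrite gt_eqF// mulr_gt0.
  by apply: cvgM; [exact: cvg_nfactor|exact: cvg_cst].
by apply: cvgB; [exact: cvg_cst|exact: cvg_dN].
Qed.

End limits.

End symbols.

(** * Integrability and limits of the terms of the form *)

Section form_integrals.
Context {R : realType}.
Notation mu3 := (@lebesgue3 R).
Notation mu33 := (@lebesgue33 R).
Notation pair := (momentum R * momentum R)%type.
Implicit Types (u v phi : spinor R).

Lemma normc_inner_le (v u : 'cV[R[i]]_2) (t : R) : 0 < t ->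
  normc (inner v u) <= t * sqnorm v + t^-1 * sqnorm u.
Proof.
move=> t0; rewrite -sandwich1 -[leRHS]mul1r; apply: normc_sandwich_le => // i j.
by rewrite mxE; case: eqP => _; [rewrite mulr1n normc1|rewrite mulr0n normc0].
Qed.

Lemma br_domain_dilate phi a : 0 < a -> br_domain phi ->
  br_domain (fun p => phi (dilate a p)).
Proof.
move=> a0 dphi; have mphi := br_domain_cmeasurable dphi; case: dphi => _ iphi.
have md := @measurable_dilate_at R a.
have msq := measurable_sqnorm mphi; have mw := @measurable_weight R.
have mm : measurable_fun setT (fun p => (weight p * sqnorm (phi p))%:E).
  by apply/measurable_EFinP; exact: measurable_funM.
have pp p : (0 <= (weight p * sqnorm (phi p))%:E)%E.
  by rewrite lee_fin mulr_ge0 ?weight_ge0 ?sqnorm_ge0.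
split; first by move=> i; exact: (cmeasurable_comp (mphi i) md).
have k0 : 0 <= 1 + a^-1 by rewrite addr_ge0// invr_ge0 ltW.
apply: (@le_lt_trans _ _ (\int[mu3]_p ((1 + a^-1)%:E *
    (weight (dilate a p) * sqnorm (phi (dilate a p)))%:E))%E).
  apply: ge0_le_integral => //.
  - by move=> p _; rewrite lee_fin mulr_ge0 ?weight_ge0 ?sqnorm_ge0.
  - apply/measurable_EFinP; apply: measurable_funM => //.
    exact: (measurableT_comp msq md).
  - apply: measurable_funeM; exact: (measurableT_comp mm md).
  - move=> p _; rewrite -EFinM lee_fin mulrA; apply: ler_wpM2r; first exact: sqnorm_ge0.
    exact: weight_le_dilate_gt0.
rewrite ge0_integralZl//; last first.
  exact: (measurableT_comp mm md).
have [_ /(_ _ mm pp) ->] := scales_lebesgue3 a0.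
rewrite muleA -EFinM lte_mul_pinfty// lee_fin mulr_ge0// invr_ge0 exprn_ge0//.
exact: ltW.
Qed.

Lemma cintegrable_local (w : momentum R -> R) (C : R) u v :
  measurable_fun setT w -> (forall p, `|w p| <= C * weight p) ->
  br_domain u -> br_domain v ->
  cintegrable mu3 (fun p => (w p)%:C * inner (u p) (v p)).
Proof.
move=> mw wC du dv.
have mu := br_domain_cmeasurable du; have mv := br_domain_cmeasurable dv.
have msu := measurable_sqnorm mu; have msv := measurable_sqnorm mv.
have mW := @measurable_weight R.
have C0 : 0 <= C.
  have w1 := @weight_ge1 R (0, 0, 0).
  have := le_trans (normr_ge0 _) (wC (0, 0, 0)).
  by rewrite pmulr_lge0//; exact: lt_le_trans w1.
apply: (@cintegrable_dominated _ _ _ _ _ (fun p => C * (weight p * sqnorm (u p) + weight p * sqnorm (v p)))).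
- apply: cmeasurableM; first exact: cmeasurable_real.
  exact: cmeasurable_inner.
- apply: measurable_funM => //.
  by apply: measurable_funD; exact: measurable_funM.
- move=> p; rewrite normcM normc_real -mulrDr mulrA; apply: ler_pM => //.
    exact: normc_ge0.
  by have := normc_inner_le (u p) (v p) (@ltr01 R); rewrite invr1 !mul1r.
have pu p : (0 <= (weight p * sqnorm (u p))%:E)%E by rewrite lee_fin mulr_ge0 ?weight_ge0 ?sqnorm_ge0.
have pv p : (0 <= (weight p * sqnorm (v p))%:E)%E by rewrite lee_fin mulr_ge0 ?weight_ge0 ?sqnorm_ge0.
have mmu : measurable_fun setT (fun p => (weight p * sqnorm (u p))%:E).
  by apply/measurable_EFinP; exact: measurable_funM.
have mmv : measurable_fun setT (fun p => (weight p * sqnorm (v p))%:E).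
  by apply/measurable_EFinP; exact: measurable_funM.
under eq_integral => p _ do rewrite EFinM EFinD.
rewrite ge0_integralZl//; last 2 first.
- exact: emeasurable_funD.
- by move=> p _; exact: adde_ge0.
rewrite ge0_integralD//; apply: lte_mul_pinfty => //.
case: du => _ du; case: dv => _ dv.
exact: lte_add_pinfty.
Qed.

(** The difference is split into a term with phi_a - phi, small in the weighted
norm, and a term with [w_ n - w], small pointwise. *)
Lemma cvg_local phi (a_ : nat -> R) (w_ : nat -> momentum R -> R) (w : momentum R -> R) (C : R) :
  br_domain phi -> (forall n, 1 <= a_ n <= 2) -> a_ n @[n --> \oo] --> (1 : R) ->
  (forall n, measurable_fun setT (w_ n)) -> measurable_fun setT w ->
  (forall n p, `|w_ n p| <= C * weight p) -> (forall p, `|w p| <= C * weight p) ->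
  (forall p, w_ n p @[n --> \oo] --> w p) ->
  forall e : R, 0 < e -> \forall n \near \oo,
    normc (cintegral mu3 (fun p => (w_ n p)%:C * inner (phi (dilate (a_ n) p)) (phi p)) -
           cintegral mu3 (fun p => (w p)%:C * inner (phi p) (phi p))) <= e.
Proof.
move=> dphi a12 a1 mw_ mw w_C wC w_w.
have mphi := br_domain_cmeasurable dphi.
have msq := measurable_sqnorm mphi; have mW := @measurable_weight R.
have an n : 0 < a_ n by have /andP[+ _] := a12 n; apply: lt_le_trans.
have dphid n := br_domain_dilate (an n) dphi.
have mS n : measurable_fun setT (fun p => sqnorm (phi (dilate (a_ n) p) - phi p)).
  apply: measurable_sqnorm => i; under eq_fun do rewrite !mxE.
  apply: cmeasurableD; first exact: (cmeasurable_comp (mphi i) (measurable_dilate_at _)).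
  by under eq_fun do rewrite -mulN1r; apply: cmeasurableM => //; exact: cmeasurable_cst.
have C0 : 0 <= C.
  have w1 := @weight_ge1 R (0, 0, 0).
  have := le_trans (normr_ge0 _) (wC (0, 0, 0)).
  by rewrite pmulr_lge0//; exact: lt_le_trans w1.
have mWN : measurable_fun setT (fun p => weight p * sqnorm (phi p)) by exact: measurable_funM.
have WN0 p : 0 <= weight p * sqnorm (phi p) by rewrite mulr_ge0 ?weight_ge0 ?sqnorm_ge0.
have fin (k : R) : 0 <= k -> (\int[mu3]_p (k * (weight p * sqnorm (phi p)))%:E < +oo)%E.
  move=> k0; under eq_integral => p _ do rewrite EFinM.
  rewrite ge0_integralZl//; last 2 first.
  - exact/measurable_EFinP.
  - by move=> p _; rewrite lee_fin.
  by apply: lte_mul_pinfty => //; case: dphi.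
apply: (@cvg_cintegral _ _ _ mu3 _ _
  (fun n p => C * (weight p * sqnorm (phi (dilate (a_ n) p) - phi p)))
  (fun n p => `|w_ n p - w p| * (2 * sqnorm (phi p)))
  (fun p => C * (weight p * sqnorm (phi p)))
  (fun p => 4 * C * (weight p * sqnorm (phi p)))).
- by move=> n; apply: (@cintegrable_local _ C).
- exact: (@cintegrable_local _ C).
- by move=> n; apply: measurable_funM => //; exact: measurable_funM.
- by move=> n p; rewrite mulr_ge0// mulr_ge0 ?weight_ge0 ?sqnorm_ge0.
- move=> n; apply: measurable_funM; last exact: measurable_funM.
  by apply: measurableT_comp => //; exact: measurable_funB.
- by move=> n p; rewrite mulr_ge0// mulr_ge0 ?sqnorm_ge0.
- exact: measurable_funM.
- by move=> p; rewrite mulr_ge0.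
- exact: measurable_funM.
- move=> t n p t0.
  set x := phi (dilate _ p); set y := phi p.
  have -> : (w_ n p)%:C * inner x y - (w p)%:C * inner y y =
      (w_ n p)%:C * inner (x - y) y + (w_ n p - w p)%:C * inner y y.
    by rewrite -!sandwich1 sandwichBl rmorphB /= mulrBr mulrBl addrA subrK.
  apply: (le_trans (le_normcD _ _)); apply: lerD.
    rewrite normcM normc_real.
    apply: (@le_trans _ _ (C * weight p * (t * sqnorm (x - y) + t^-1 * sqnorm y))).
      by apply: ler_pM => //; [exact: normc_ge0|exact: normc_inner_le].
    by rewrite le_eqVlt; apply/orP; left; apply/eqP; ring.
  rewrite normcM normc_real; apply: ler_wpM2l => //.
  by have := normc_inner_le y y (@ltr01 R); rewrite invr1 !mul1r mulr2n mulrDl !mul1r.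
- have H := dilation_continuous_spinor dphi a12 a1.
  have H' : (C%:E * (\int[mu3]_p (weight p * sqnorm (phi (dilate (a_ n) p) - phi p))%:E))%E
     @[n --> \oo] --> 0%E.
    by rewrite -[X in _ --> X](mule0 C%:E); apply: cvgeZl.
  rewrite (_ : (fun n => _) = (fun n => C%:E *
    (\int[mu3]_p (weight p * sqnorm (phi (dilate (a_ n) p) - phi p))%:E))%E)//.
  apply/funext => n; under eq_integral => p _ do rewrite EFinM.
  rewrite ge0_integralZl//; first by apply/measurable_EFinP; exact: measurable_funM.
  by move=> p _; rewrite lee_fin mulr_ge0 ?weight_ge0 ?sqnorm_ge0.
- exact: fin.
- move=> n p; rewrite [X in _ <= X](_ : _ = 2 * C * weight p * (2 * sqnorm (phi p))); last by ring.
  apply: ler_wpM2r; first by rewrite mulr_ge0 ?sqnorm_ge0.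
  rewrite (le_trans (ler_normB _ _))// -mulrA mulr2n mulrDl mul1r.
  by apply: lerD.
- by apply: fin; rewrite mulr_ge0.
- move=> p; rewrite -[X in _ --> X](mul0r (2 * sqnorm (phi p))).
  apply: cvgM; last exact: cvg_cst.
  rewrite -[X in _ --> X](normr0 R); apply: cvg_norm.
  by rewrite -[X in _ --> X](subrr (w p)); apply: cvgB => //; exact: cvg_cst.
Qed.

Lemma measurable_spin_kernel (al be : pair -> R) i j :
  measurable_fun setT al -> measurable_fun setT be ->
  cmeasurable (fun q : pair => spin_kernel q.1 q.2 (al q) (be q) i j).
Proof.
move=> ma mb; under eq_fun do rewrite spin_kernelE pdistC.
apply: cmeasurableM; first by apply: cmeasurable_real; exact: measurable_inv_pdist.
apply: cmeasurableD.
  case: eqP => _; first by under eq_fun do rewrite mulr1n; exact: cmeasurable_real.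
  by under eq_fun do rewrite mulr0n; exact: cmeasurable_cst.
apply: cmeasurableM; first exact: cmeasurable_real.
apply: cmeasurable_sum => k; apply: cmeasurableM.
- exact: (cmeasurable_comp (cmeasurable_dot_pauli i k) measurable_fst).
- exact: (cmeasurable_comp (cmeasurable_dot_pauli k j) measurable_snd).
Qed.

(** Bound for the entries of |p - p'|^2 times the spin kernel: each component of
p.sigma is at most |p|, and a product of two such matrices has two terms per
entry. *)
Definition symbol_size (q : pair) (al be : R) : R :=
  `|al| + 2 * (`|be| * (pnorm q.1 * pnorm q.2)).

Lemma symbol_size_ge0 q al be : 0 <= symbol_size q al be.
Proof. by rewrite addr_ge0// !mulr_ge0// pnorm_ge0. Qed.

Lemma measurable_symbol_size (al be : pair -> R) :
  measurable_fun setT al -> measurable_fun setT be ->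
  measurable_fun setT (fun q => symbol_size q (al q) (be q)).
Proof.
move=> ma mb; apply: measurable_funD; first exact: measurableT_comp.
apply: measurable_funM => //; apply: measurable_funM; first exact: measurableT_comp.
by apply: measurable_funM; [exact: (measurableT_comp (@measurable_pnorm R) measurable_fst)
  |exact: (measurableT_comp (@measurable_pnorm R) measurable_snd)].
Qed.

Lemma symbol_sizeB q al be al' be' : symbol_size q (al - al') (be - be') <=
  symbol_size q al be + symbol_size q al' be'.
Proof.
rewrite /symbol_size.
have h1 := ler_normB al al'; have h2 := ler_normB be be'.
have pp : 0 <= pnorm q.1 * pnorm q.2 by rewrite mulr_ge0// pnorm_ge0.
have := ler_wpM2r pp h2; lra.
Qed.

Lemma normc_sandwich_spin_le q al be (x y : 'cV[R[i]]_2) (t : R) : 0 < t ->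
  normc (sandwich x (spin_kernel q.1 q.2 al be) y) <=
  symbol_size q al be * (t * ((pdist q.1 q.2 ^+ 2)^-1 * (weight_ratio q * sqnorm x)) +
                         t^-1 * ((pdist q.1 q.2 ^+ 2)^-1 * ((weight_ratio q)^-1 * sqnorm y))).
Proof.
move=> t0; have tr : 0 < t * weight_ratio q by rewrite mulr_gt0// weight_ratio_gt0.
have := @normc_sandwich_le R x _ y _ _ tr (normc_spin_kernel q.1 q.2 al be).
move=> H; apply: (le_trans H); rewrite le_eqVlt; apply/orP; left; apply/eqP.
rewrite [pdist q.2 q.1]pdistC /symbol_size (invfM t); ring.
Qed.

Lemma measurable_schur_fst (f : momentum R -> R) : measurable_fun setT f ->
  measurable_fun setT (fun q : pair => (pdist q.1 q.2 ^+ 2)^-1 * (weight_ratio q * f q.1)).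
Proof.
move=> mf; apply: measurable_funM; first exact: measurable_inv_pdist.
apply: measurable_funM; first exact: measurable_weight_ratio.
exact: (measurableT_comp mf measurable_fst).
Qed.

Lemma measurable_schur_snd (f : momentum R -> R) : measurable_fun setT f ->
  measurable_fun setT (fun q : pair => (pdist q.1 q.2 ^+ 2)^-1 * ((weight_ratio q)^-1 * f q.2)).
Proof.
move=> mf; apply: measurable_funM; first exact: measurable_inv_pdist.
apply: measurable_funM; first by apply: measurable_funV; exact: measurable_weight_ratio.
exact: (measurableT_comp mf measurable_snd).
Qed.

Lemma schur_fst_ge0 (f : momentum R -> R) (q : pair) : (forall p, 0 <= f p) ->
  0 <= (pdist q.1 q.2 ^+ 2)^-1 * (weight_ratio q * f q.1).
Proof. by move=> f0; rewrite mulr_ge0 ?invr_ge0 ?sqr_ge0// mulr_ge0// ltW// weight_ratio_gt0. Qed.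

Lemma schur_snd_ge0 (f : momentum R -> R) (q : pair) : (forall p, 0 <= f p) ->
  0 <= (pdist q.1 q.2 ^+ 2)^-1 * ((weight_ratio q)^-1 * f q.2).
Proof. by move=> f0; rewrite mulr_ge0 ?invr_ge0 ?sqr_ge0// mulr_ge0// invr_ge0 ltW// weight_ratio_gt0. Qed.

Lemma schur_finite (C : R) (f g : momentum R -> R) : 0 <= C ->
  measurable_fun setT f -> measurable_fun setT g ->
  (forall p, 0 <= f p) -> (forall p, 0 <= g p) ->
  (\int[mu3]_p (weight p * f p)%:E < +oo)%E -> (\int[mu3]_p (weight p * g p)%:E < +oo)%E ->
  (\int[mu33]_q (C * ((pdist q.1 q.2 ^+ 2)^-1 * (weight_ratio q * f q.1) +
      (pdist q.1 q.2 ^+ 2)^-1 * ((weight_ratio q)^-1 * g q.2)))%:E < +oo)%E.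
Proof.
move=> C0 mf mg f0 g0 fi gi.
have m1 := measurable_schur_fst mf; have m2 := measurable_schur_snd mg.
have p1 q := schur_fst_ge0 q f0; have p2 q := schur_snd_ge0 q g0.
under eq_integral => q _ do rewrite EFinM EFinD.
rewrite ge0_integralZl//; last 2 first.
- by apply: emeasurable_funD; exact/measurable_EFinP.
- by move=> q _; rewrite -EFinD lee_fin addr_ge0.
have sc := @schur_const_gt0 R.
rewrite ge0_integralD//; last 4 first.
- by move=> q _; rewrite lee_fin.
- exact/measurable_EFinP.
- by move=> q _; rewrite lee_fin.
- exact/measurable_EFinP.
apply: lte_mul_pinfty => //; apply: lte_add_pinfty.
- by apply: (le_lt_trans (schur_fst mf f0)); apply: lte_mul_pinfty => //; rewrite lee_fin ltW.
- by apply: (le_lt_trans (schur_snd mg g0)); apply: lte_mul_pinfty => //; rewrite lee_fin ltW.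
Qed.

Lemma cmeasurable_pairs (al be : pair -> R) u v :
  measurable_fun setT al -> measurable_fun setT be ->
  br_domain u -> br_domain v ->
  cmeasurable (fun q : pair => sandwich (u q.1) (spin_kernel q.1 q.2 (al q) (be q)) (v q.2)).
Proof.
move=> ma mb du dv; apply: cmeasurable_sandwich.
- by move=> i; exact: (cmeasurable_comp (br_domain_cmeasurable du i) measurable_fst).
- by move=> i j; exact: measurable_spin_kernel.
- by move=> i; exact: (cmeasurable_comp (br_domain_cmeasurable dv i) measurable_snd).
Qed.

Lemma cintegrable_pairs (al be : pair -> R) (C : R) u v :
  measurable_fun setT al -> measurable_fun setT be ->
  (forall q, symbol_size q (al q) (be q) <= C) ->
  br_domain u -> br_domain v ->
  cintegrable mu33
    (fun q => sandwich (u q.1) (spin_kernel q.1 q.2 (al q) (be q)) (v q.2)).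
Proof.
move=> ma mb qC du dv.
have msu := measurable_sqnorm (br_domain_cmeasurable du).
have msv := measurable_sqnorm (br_domain_cmeasurable dv).
have C0 : 0 <= C.
  exact: le_trans (symbol_size_ge0 ((0, 0, 0), (0, 0, 0)) _ _) (qC ((0, 0, 0), (0, 0, 0))).
have su0 p : 0 <= sqnorm (u p) by exact: sqnorm_ge0.
have sv0 p : 0 <= sqnorm (v p) by exact: sqnorm_ge0.
apply: (@cintegrable_dominated _ _ _ _ _ (fun q : pair =>
  C * ((pdist q.1 q.2 ^+ 2)^-1 * (weight_ratio q * sqnorm (u q.1)) +
       (pdist q.1 q.2 ^+ 2)^-1 * ((weight_ratio q)^-1 * sqnorm (v q.2))))).
- exact: cmeasurable_pairs.
- apply: measurable_funM => //; apply: measurable_funD.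
    exact: (measurable_schur_fst msu).
  exact: (measurable_schur_snd msv).
- move=> q; have := normc_sandwich_spin_le q (al q) (be q) (u q.1) (v q.2) (@ltr01 R).
  rewrite invr1 !mul1r => H; apply: (le_trans H); apply: ler_wpM2r => //.
  by rewrite addr_ge0 ?(schur_fst_ge0 q su0) ?(schur_snd_ge0 q sv0).
- by case: du => _ du; case: dv => _ dv; exact: (schur_finite C0 msu msv su0 sv0 du dv).
Qed.

(** As for a single momentum, with the Schur test replacing the boundedness of
the weight: only the first spinor is dilated, so the difference splits into a
term with phi_a - phi and a term with the difference of the symbols. *)
Lemma cvg_pairs phi (a_ : nat -> R) (al_ be_ : nat -> pair -> R) (al be : pair -> R) (C : R) :
  br_domain phi -> (forall n, 1 <= a_ n <= 2) -> a_ n @[n --> \oo] --> (1 : R) ->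
  (forall n, measurable_fun setT (al_ n)) -> (forall n, measurable_fun setT (be_ n)) ->
  measurable_fun setT al -> measurable_fun setT be ->
  (forall n q, symbol_size q (al_ n q) (be_ n q) <= C) ->
  (forall q, symbol_size q (al q) (be q) <= C) ->
  (forall q, al_ n q @[n --> \oo] --> al q) ->
  (forall q, be_ n q @[n --> \oo] --> be q) ->
  forall e : R, 0 < e -> \forall n \near \oo,
    normc (cintegral mu33 (fun q => sandwich (phi (dilate (a_ n) q.1))
              (spin_kernel q.1 q.2 (al_ n q) (be_ n q)) (phi q.2)) -
           cintegral mu33 (fun q => sandwich (phi q.1)
              (spin_kernel q.1 q.2 (al q) (be q)) (phi q.2))) <= e.
Proof.
move=> dphi a12 a1 mal_ mbe_ mal mbe C_ CC al_al be_be.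
have mphi := br_domain_cmeasurable dphi.
have msq := measurable_sqnorm mphi; have mW := @measurable_weight R.
have an n : 0 < a_ n by have /andP[+ _] := a12 n; apply: lt_le_trans.
have dphid n := br_domain_dilate (an n) dphi.
have mS n : measurable_fun setT (fun p => sqnorm (phi (dilate (a_ n) p) - phi p)).
  apply: measurable_sqnorm => i; under eq_fun do rewrite !mxE.
  apply: cmeasurableD; first exact: (cmeasurable_comp (mphi i) (measurable_dilate_at _)).
  by under eq_fun do rewrite -mulN1r; apply: cmeasurableM => //; exact: cmeasurable_cst.
have S0 n p : 0 <= sqnorm (phi (dilate (a_ n) p) - phi p) by exact: sqnorm_ge0.
have N0 p : 0 <= sqnorm (phi p) by exact: sqnorm_ge0.
have C0 : 0 <= C.
  exact: le_trans (symbol_size_ge0 ((0, 0, 0), (0, 0, 0)) _ _) (CC ((0, 0, 0), (0, 0, 0))).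
have mBn n : measurable_fun setT (fun q => al_ n q - al q) by exact: measurable_funB.
have mBb n : measurable_fun setT (fun q => be_ n q - be q) by exact: measurable_funB.
pose A q := (pdist q.1 q.2 ^+ 2)^-1 * (weight_ratio q * sqnorm (phi q.1)).
pose B q := (pdist q.1 q.2 ^+ 2)^-1 * ((weight_ratio q)^-1 * sqnorm (phi q.2)).
have A0 q : 0 <= A q by exact: (schur_fst_ge0 q N0).
have B0 q : 0 <= B q by exact: (schur_snd_ge0 q N0).
have mA : measurable_fun setT A by exact: (measurable_schur_fst msq).
have mB : measurable_fun setT B by exact: (measurable_schur_snd msq).
have iphi : (\int[mu3]_p (weight p * sqnorm (phi p))%:E < +oo)%E by case: dphi.
apply: (@cvg_cintegral _ _ _ mu33 _ _
  (fun n q => C * ((pdist q.1 q.2 ^+ 2)^-1 * (weight_ratio q * sqnorm (phi (dilate (a_ n) q.1) - phi q.1))))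
  (fun n q => symbol_size q (al_ n q - al q) (be_ n q - be q) * (A q + B q))
  (fun q => C * B q)
  (fun q => 2 * C * (A q + B q))).
- by move=> n; exact: (@cintegrable_pairs (al_ n) (be_ n) C (fun p => phi (dilate (a_ n) p)) phi).
- exact: (@cintegrable_pairs al be C phi phi).
- by move=> n; apply: measurable_funM => //; exact: (measurable_schur_fst (mS n)).
- by move=> n q; rewrite mulr_ge0// (schur_fst_ge0 q (S0 n)).
- move=> n; apply: measurable_funM; first exact: measurable_symbol_size.
  exact: measurable_funD.
- by move=> n q; rewrite mulr_ge0 ?symbol_size_ge0// addr_ge0.
- exact: measurable_funM.
- by move=> q; rewrite mulr_ge0.
- by apply: measurable_funM => //; exact: measurable_funD.
- move=> t n q t0.
  set x := phi (dilate _ q.1); set y := phi q.1; set z := phi q.2.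
  set K := spin_kernel _ _ _ _; set L := spin_kernel _ _ _ _.
  have -> : sandwich x K z - sandwich y L z = sandwich (x - y) K z + sandwich y (K - L) z.
    by rewrite sandwichBl sandwichB addrA subrK.
  have ti0 : 0 <= t^-1 by rewrite invr_ge0 ltW.
  have xy0 : 0 <= (pdist q.1 q.2 ^+ 2)^-1 * (weight_ratio q * sqnorm (x - y)).
    exact: (schur_fst_ge0 q (S0 n)).
  apply: (le_trans (le_normcD _ _)); apply: lerD.
    have H := normc_sandwich_spin_le q (al_ n q) (be_ n q) (x - y) z t0.
    apply: (le_trans H).
    apply: (@le_trans _ _ (C * (t * ((pdist q.1 q.2 ^+ 2)^-1 * (weight_ratio q * sqnorm (x - y))) + t^-1 * B q))).
      apply: ler_wpM2r => //; apply: addr_ge0; apply: mulr_ge0 => //; first exact: ltW.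
      exact: (B0 q).
    by rewrite le_eqVlt; apply/orP; left; apply/eqP; ring.
  rewrite /K /L spin_kernelB.
  by have := normc_sandwich_spin_le q (al_ n q - al q) (be_ n q - be q) y z (@ltr01 R);
    rewrite invr1 !mul1r.
- have H := dilation_continuous_spinor dphi a12 a1.
  have H' : ((C * schur_const)%R%:E * \int[mu3]_p (weight p * sqnorm (phi (dilate (a_ n) p) - phi p))%:E)%E
     @[n --> \oo] --> 0%E.
    by rewrite -[X in _ --> X](mule0 (C * schur_const)%:E); apply: cvgeZl.
  apply: (@cvge0_leD _ _ _ (fun=> 0%E) _ _ H'); last exact: cvg_cst.
  + move=> n; apply: integral_ge0 => q _; rewrite lee_fin mulr_ge0//.
    exact: (schur_fst_ge0 q (S0 n)).
  + move=> n; rewrite adde0; under eq_integral => q _ do rewrite EFinM.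
    rewrite ge0_integralZl//; last 2 first.
    * by apply/measurable_EFinP; exact: (measurable_schur_fst (mS n)).
    * by move=> q _; rewrite lee_fin (schur_fst_ge0 q (S0 n)).
    rewrite EFinM -muleA; apply: lee_wpmul2l; first by rewrite lee_fin.
    exact: (schur_fst (mS n) (S0 n)).
- apply: le_lt_trans (schur_finite C0 msq msq N0 N0 iphi iphi).
  apply: ge0_le_integral => //.
  + by move=> q _; rewrite lee_fin mulr_ge0.
  + by apply/measurable_EFinP; exact: measurable_funM.
  + by apply/measurable_EFinP; apply: measurable_funM => //; exact: measurable_funD.
  + by move=> q _; rewrite lee_fin; apply: ler_wpM2l => //; rewrite -/(A q) -/(B q) lerDr.
- move=> n q; apply: ler_wpM2r; first by rewrite addr_ge0.
  rewrite (le_trans (symbol_sizeB _ _ _ _ _))// mulr2n mulrDl mul1r.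
  exact: lerD.
- have C20 : 0 <= 2 * C by rewrite mulr_ge0.
  exact: (schur_finite C20 msq msq N0 N0 iphi iphi).
- move=> q; rewrite -[X in _ --> X](mul0r (A q + B q)).
  apply: cvgM; last exact: cvg_cst.
  rewrite /symbol_size.
  have z1 : `|al_ n q - al q| @[n --> \oo] --> (0 : R).
    rewrite -[X in _ --> X](normr0 R); apply: cvg_norm.
    by rewrite -[X in _ --> X](subrr (al q)); apply: cvgB => //; exact: cvg_cst.
  have z2 : `|be_ n q - be q| @[n --> \oo] --> (0 : R).
    rewrite -[X in _ --> X](normr0 R); apply: cvg_norm.
    by rewrite -[X in _ --> X](subrr (be q)); apply: cvgB => //; exact: cvg_cst.
  rewrite -[X in _ --> X](addr0 0); apply: cvgD => //.
  rewrite -[X in _ --> X](mulr0 2); apply: cvgM; first exact: cvg_cst.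
  rewrite -[X in _ --> X](mul0r (pnorm q.1 * pnorm q.2)).
  by apply: cvgM => //; exact: cvg_cst.
Qed.

Lemma scales_swap : scales_measure mu33 (fun q => (q.2, q.1)) 1.
Proof.
split; first exact: measurable_swap.
by move=> f mf f0; rewrite mul1e; exact: ge0_integral_swap.
Qed.

End form_integrals.

(** * The Brown-Ravenhall kernel and its dilations *)

Section virial.
Context {R : realType}.
Variables (m c : R).
Hypotheses (m0 : 0 < m) (c0 : 0 < c).
Notation pair := (momentum R * momentum R)%type.
Notation E := (energy m c).
Notation N := (nfactor m c).
Notation e0 := (energy m c 0).
Notation F := (upper m c).
Implicit Types (p : momentum R) (q : pair).

Lemma measurable_energy : measurable_fun setT E.
Proof.
apply: measurable_fun_sqrt; apply: measurable_funD => //.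
by apply: measurable_funM => //; exact: measurable_funX.
Qed.

Lemma measurable_nfactor : measurable_fun setT N.
Proof.
apply: measurable_fun_sqrt; apply: measurable_funM.
  by apply: measurable_funM => //; exact: measurable_energy.
by apply: measurable_funD => //; exact: measurable_energy.
Qed.

Lemma measurable_upper : measurable_fun setT F.
Proof.
apply: measurable_funM; last by apply: measurable_funV; exact: measurable_nfactor.
by apply: measurable_funD => //; exact: measurable_energy.
Qed.

Lemma measurable_rscale (a : R) : measurable_fun setT (fun r : R => a * r).
Proof. exact: mulrl_measurable. Qed.

Lemma measurable_dE a : measurable_fun setT (dE m c a).
Proof.
apply: measurable_funM.
  by apply: measurable_funM => //; apply: measurable_funM => //; exact: measurable_funX.
apply: measurable_funV; apply: measurable_funD; last exact: measurable_energy.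
exact: (measurableT_comp measurable_energy (measurable_rscale a)).
Qed.

Lemma energy_le_weight p : E (pnorm p) <= (c + e0) * weight p.
Proof.
have e := energy0_gt0 m0 c0; have ce : 0 <= c + e0 by rewrite addr_ge0 ?ltW.
rewrite -(@ler_pXn2r _ 2) ?nnegrE ?energy_ge0 ?mulr_ge0 ?weight_ge0//.
rewrite exprMn weight_sqr energy_sqr//.
have s := sqr_ge0 (pnorm p).
have -> : (c + e0) ^+ 2 * (1 + pnorm p ^+ 2) = c ^+ 2 * pnorm p ^+ 2 + e0 ^+ 2 +
   (c ^+ 2 + 2 * c * e0 + (2 * c * e0 + e0 ^+ 2) * pnorm p ^+ 2) by ring.
have h1 : 0 <= c * e0 by rewrite mulr_ge0 ?ltW.
have h2 : 0 <= (2 * c * e0 + e0 ^+ 2) * pnorm p ^+ 2.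
  by rewrite mulr_ge0//; have := sqr_ge0 e0; lra.
have := sqr_ge0 c; lra.
Qed.

Lemma kernel_numE p' p (X Y : R) :
  (kernel_denom m c p' p)^-1%:C *: (X%:C%:M + Y%:C *: (dot_pauli p' *m dot_pauli p)) =
  spin_kernel p' p (X / (N (pnorm p') * N (pnorm p))) (Y / (N (pnorm p') * N (pnorm p))).
Proof.
rewrite /spin_kernel.
rewrite (_ : (kernel_denom m c p' p)^-1 = (pdist p p' ^+ 2)^-1 * (N (pnorm p') * N (pnorm p))^-1); last first.
  by rewrite /kernel_denom -[RHS]invfM; congr (_^-1); rewrite mulrAC mulrC.
rewrite rmorphM /= -scalerA; congr (_ *: _).
by rewrite scalerDr scale_scalar_mx scalerA -!rmorphM /= ![_^-1 * _]mulrC.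
Qed.

Definition al_br q : R := F (pnorm q.1) * F (pnorm q.2).
Definition be_br q : R := c ^+ 2 / (N (pnorm q.1) * N (pnorm q.2)).

Lemma al_brE q : (E (pnorm q.1) + e0) * (E (pnorm q.2) + e0) / (N (pnorm q.1) * N (pnorm q.2)) = al_br q.
Proof. by rewrite /al_br /upper invfM; ring. Qed.

Lemma kernelE q : Defs.kernel m c q.1 q.2 = spin_kernel q.1 q.2 (al_br q) (be_br q).
Proof. by rewrite /Defs.kernel /kernel_num1 /kernel_num2 kernel_numE al_brE. Qed.

Lemma kernel1E q : kernel1 m c q.1 q.2 = spin_kernel q.1 q.2 (al_br q) 0.
Proof.
rewrite /kernel1 /kernel_num1.
have := kernel_numE q.1 q.2 ((E (pnorm q.1) + e0) * (E (pnorm q.2) + e0)) 0.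
by rewrite scale0r addr0 al_brE mul0r.
Qed.

Lemma kernel2E q : kernel2 m c q.1 q.2 = spin_kernel q.1 q.2 0 (be_br q).
Proof.
rewrite /kernel2 /kernel_num2.
have := kernel_numE q.1 q.2 0 (c ^+ 2).
have E0 : (0 : R)%:C%:M = 0 :> 'M[R[i]]_2 by apply/matrixP => i j; rewrite !mxE mul0rn.
by rewrite E0 add0r mul0r.
Qed.

(** The symbols of a^3 K(a p', a p).  The factor [a] in front is a^3 times the a^-2
coming from |p - p'|^-2; in [be_dil], p'.sigma and p.sigma contribute one further
factor [a] each. *)
Definition al_dil (a : R) q : R := a * (F (a * pnorm q.1) * F (a * pnorm q.2)).
Definition be_dil (a : R) q : R :=
  c ^+ 2 * (a * ((a / N (a * pnorm q.1)) * (a / N (a * pnorm q.2)))).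

Lemma al_dil1 q : al_dil 1 q = al_br q.
Proof. by rewrite /al_dil !mul1r. Qed.

Lemma be_dil1 q : be_dil 1 q = be_br q.
Proof. by rewrite /be_dil /be_br !mul1r invfM. Qed.

Lemma spin_kernel_dilate a p' p (al be : R) : 0 < a ->
  spin_kernel (dilate a p') (dilate a p) al be =
  spin_kernel p' p (al / a ^+ 2) be.
Proof.
move=> a0; have a0' := ltW a0; rewrite /spin_kernel (pdist_dilate p p' a0').
rewrite [(_ * _) ^+ 2]exprMn [(_ * pdist _ _ ^+ 2)^-1]invfM rmorphM /=.
rewrite mulrC -scalerA; congr (_ *: _).
rewrite scalerDr scale_scalar_mx !dot_pauli_dilate -scalemxAl -scalemxAr !scalerA -!rmorphM /=.
congr (_%:C%:M + _%:C *: _); first by rewrite mulrC.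
by field; rewrite gt_eqF.
Qed.

Lemma kernel_dilate a q : 0 < a ->
  (a ^+ 3)%:C *: Defs.kernel m c (dilate a q.1) (dilate a q.2) =
  spin_kernel q.1 q.2 (al_dil a q) (be_dil a q).
Proof.
move=> a0; have := kernelE (dilate a q.1, dilate a q.2) => /= ->.
rewrite spin_kernel_dilate// spin_kernelZ /al_br /be_br /al_dil /be_dil /=.
rewrite (pnorm_dilate q.1 (ltW a0)) (pnorm_dilate q.2 (ltW a0)) invfM.
by congr spin_kernel; field; rewrite ?gt_eqF// ?nfactor_gt0.
Qed.

(** Leibniz rule for difference quotients, factor by factor. *)
Definition dal (a : R) q : R := F (a * pnorm q.1) * F (a * pnorm q.2) +
  (dupper m c a (pnorm q.1) * F (a * pnorm q.2) + F (pnorm q.1) * dupper m c a (pnorm q.2)).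
Definition dbe (a : R) q : R := c ^+ 2 *
  ((a / N (a * pnorm q.1)) * (a / N (a * pnorm q.2)) +
  (dlower m c a (pnorm q.1) * (a / N (a * pnorm q.2)) + (N (pnorm q.1))^-1 * dlower m c a (pnorm q.2))).

Lemma dal_eq a q : al_dil a q - al_br q = (a - 1) * dal a q.
Proof.
have E1 := dupper_eq m0 c0 a (pnorm q.1); have E2 := dupper_eq m0 c0 a (pnorm q.2).
rewrite /dal /al_dil /al_br !mulrDr [(a - 1) * (dupper _ _ _ _ * _)]mulrA -E1.
rewrite [(a - 1) * (F _ * dupper _ _ _ _)]mulrCA -E2; ring.
Qed.

Lemma dbe_eq a q : be_dil a q - be_br q = (a - 1) * dbe a q.
Proof.
have E1 := dlower_eq m0 c0 a (pnorm q.1); have E2 := dlower_eq m0 c0 a (pnorm q.2).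
rewrite /dbe /be_dil /be_br invfM -mulrBr [RHS]mulrCA; congr (_ * _).
rewrite !mulrDr [(a - 1) * (dlower _ _ _ _ * _)]mulrA -E1.
rewrite [(a - 1) * (_^-1 * dlower _ _ _ _)]mulrCA -E2; ring.
Qed.

Lemma dal_bound a q : 1 <= a <= 2 -> `|dal a q| <= 60.
Proof.
move=> a12.
have F2 r : `|F r| <= 2 by have /andP[h1 h2] := upper_bounds m0 c0 r; rewrite ger0_norm.
have d1 := dupper_bound m0 c0 a12 (pnorm_ge0 q.1); have d2 := dupper_bound m0 c0 a12 (pnorm_ge0 q.2).
have b1 : `|F (a * pnorm q.1) * F (a * pnorm q.2)| <= 2 * 2.
  by rewrite normrM; apply: ler_pM.
have b2 : `|dupper m c a (pnorm q.1) * F (a * pnorm q.2)| <= 14 * 2.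
  by rewrite normrM; apply: ler_pM.
have b3 : `|F (pnorm q.1) * dupper m c a (pnorm q.2)| <= 2 * 14.
  by rewrite normrM; apply: ler_pM.
rewrite /dal (le_trans (ler_normD _ _))//.
have := ler_normD (dupper m c a (pnorm q.1) * F (a * pnorm q.2)) (F (pnorm q.1) * dupper m c a (pnorm q.2)).
lra.
Qed.

Lemma dbe_bound a q : 1 <= a <= 2 -> `|dbe a q| * (pnorm q.1 * pnorm q.2) <= 13.
Proof.
move=> a12; have /andP[a1 _] := a12.
have r1 := pnorm_ge0 q.1; have r2 := pnorm_ge0 q.2.
have g1 : `|c * pnorm q.1 * (a / N (a * pnorm q.1))| <= 1.
  by have /andP[h1 h2] := lower_le1 m0 c0 a1 r1; rewrite ger0_norm.
have g2 : `|c * pnorm q.2 * (a / N (a * pnorm q.2))| <= 1.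
  by have /andP[h1 h2] := lower_le1 m0 c0 a1 r2; rewrite ger0_norm.
have g3 : `|c * pnorm q.1 * (N (pnorm q.1))^-1| <= 1.
  have := lower_le1 m0 c0 (lexx 1) r1; rewrite !mul1r => /andP[h1 h2].
  by rewrite ger0_norm.
have cr1 : 0 <= c * pnorm q.1 by rewrite mulr_ge0// ltW.
have cr2 : 0 <= c * pnorm q.2 by rewrite mulr_ge0// ltW.
have d1 : `|c * pnorm q.1 * dlower m c a (pnorm q.1)| <= 6.
  by rewrite normrM (ger0_norm cr1) (dlower_bound m0 c0 a12 r1).
have d2 : `|c * pnorm q.2 * dlower m c a (pnorm q.2)| <= 6.
  by rewrite normrM (ger0_norm cr2) (dlower_bound m0 c0 a12 r2).
rewrite -{1}(ger0_norm (mulr_ge0 r1 r2)) -normrM.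
rewrite (_ : dbe a q * _ =
  (c * pnorm q.1 * (a / N (a * pnorm q.1))) * (c * pnorm q.2 * (a / N (a * pnorm q.2))) +
  ((c * pnorm q.1 * dlower m c a (pnorm q.1)) * (c * pnorm q.2 * (a / N (a * pnorm q.2))) +
   (c * pnorm q.1 * (N (pnorm q.1))^-1) * (c * pnorm q.2 * dlower m c a (pnorm q.2)))); last first.
  by rewrite /dbe; ring.
move: g1 g2 g3 d1 d2.
move: (c * pnorm q.1 * (a / _)) (c * pnorm q.2 * (a / _)) (c * pnorm q.1 * _^-1)
  (c * pnorm q.1 * dlower _ _ _ _) (c * pnorm q.2 * dlower _ _ _ _) => x y z u v x1 y1 z1 u6 v6.
have b1 : `|x * y| <= 1 * 1 by rewrite normrM; apply: ler_pM.
have b2 : `|u * y| <= 6 * 1 by rewrite normrM; apply: ler_pM.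
have b3 : `|z * v| <= 1 * 6 by rewrite normrM; apply: ler_pM.
rewrite (le_trans (ler_normD _ _))//; have := ler_normD (u * y) (z * v); lra.
Qed.

Lemma symbol_size_quotient a q : 1 <= a <= 2 -> symbol_size q (dal a q) (dbe a q) <= 100.
Proof.
by move=> a12; rewrite /symbol_size; have := dal_bound q a12; have := dbe_bound q a12; lra.
Qed.

Definition bracket_al q : R :=
  (E (pnorm q.2))^-1 - e0 / E (pnorm q.2) ^+ 2 + ((E (pnorm q.1))^-1 - e0 / E (pnorm q.1) ^+ 2).
Definition bracket_be q : R :=
  (E (pnorm q.2))^-1 + e0 / E (pnorm q.2) ^+ 2 + ((E (pnorm q.1))^-1 + e0 / E (pnorm q.1) ^+ 2).

Definition al_lim q : R := al_br q - e0 / 2 * bracket_al q * al_br q.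
Definition be_lim q : R := be_br q + e0 / 2 * bracket_be q * be_br q.

Section lim.
Variable a_ : nat -> R.
Hypothesis a1 : a_ n @[n --> \oo] --> (1 : R).

Lemma cvg_dal q : dal (a_ n) q @[n --> \oo] --> al_lim q.
Proof.
have -> : al_lim q = F (pnorm q.1) * F (pnorm q.2) +
  ((- (e0 / 2) * ((E (pnorm q.1))^-1 - e0 / E (pnorm q.1) ^+ 2) * F (pnorm q.1)) * F (pnorm q.2) +
    F (pnorm q.1) * (- (e0 / 2) * ((E (pnorm q.2))^-1 - e0 / E (pnorm q.2) ^+ 2) * F (pnorm q.2))).
  by rewrite /al_lim /bracket_al /al_br; ring.
have f1c (p : momentum R) : F (a_ n * pnorm p) @[n --> \oo] --> F (pnorm p).
  exact: cvg_upper.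
have d1c (p : momentum R) : dupper m c (a_ n) (pnorm p) @[n --> \oo] -->
    - (e0 / 2) * ((E (pnorm p))^-1 - e0 / E (pnorm p) ^+ 2) * F (pnorm p).
  exact: cvg_dupper.
apply: cvgD; first exact: cvgM (f1c _) (f1c _).
apply: cvgD; first exact: cvgM (d1c _) (f1c _).
by apply: cvgM; [exact: cvg_cst|exact: d1c].
Qed.

Lemma cvg_dbe q : dbe (a_ n) q @[n --> \oo] --> be_lim q.
Proof.
have -> : be_lim q = c ^+ 2 * ((N (pnorm q.1))^-1 * (N (pnorm q.2))^-1 +
  ((e0 / 2 * ((E (pnorm q.1))^-1 + e0 / E (pnorm q.1) ^+ 2) / N (pnorm q.1)) * (N (pnorm q.2))^-1 +
    (N (pnorm q.1))^-1 * (e0 / 2 * ((E (pnorm q.2))^-1 + e0 / E (pnorm q.2) ^+ 2) / N (pnorm q.2)))).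
  by rewrite /be_lim /bracket_be /be_br invfM; ring.
have gc (p : momentum R) : a_ n / N (a_ n * pnorm p) @[n --> \oo] --> (N (pnorm p))^-1.
  exact: cvg_lower.
have dc (p : momentum R) : dlower m c (a_ n) (pnorm p) @[n --> \oo] -->
    e0 / 2 * ((E (pnorm p))^-1 + e0 / E (pnorm p) ^+ 2) / N (pnorm p).
  exact: cvg_dlower.
apply: cvgM; first exact: cvg_cst.
apply: cvgD; first exact: cvgM (gc _) (gc _).
apply: cvgD; first exact: cvgM (dc _) (gc _).
by apply: cvgM; [exact: cvg_cst|exact: dc].
Qed.

End lim.

End virial.

(** * The eigenvalue equation under dilation *)

Section dilated_identities.
Opaque cintegral spin_kernel sandwich inner.
Context {R : realType}.
Variables (m c : R).
Hypotheses (m0 : 0 < m) (c0 : 0 < c).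
Notation mu3 := (@lebesgue3 R).
Notation mu33 := (@lebesgue33 R).
Notation pair := (momentum R * momentum R)%type.
Notation E := (energy m c).
Notation N := (nfactor m c).
Notation e0 := (energy m c 0).
Notation F := (upper m c).
Variable phi : spinor R.
Hypothesis dphi : br_domain phi.

Lemma measurable_al_dil a : measurable_fun setT (al_dil m c a).
Proof.
have mF := measurable_upper m c.
have mFa : measurable_fun setT (fun r => F (a * r)) := measurableT_comp mF (measurable_rscale a).
have mFp := measurableT_comp mFa (@measurable_pnorm R).
apply: measurable_funM => //; apply: measurable_funM.
- exact: (measurableT_comp mFp measurable_fst).
- exact: (measurableT_comp mFp measurable_snd).
Qed.

Lemma measurable_be_dil a : measurable_fun setT (be_dil m c a).
Proof.
have mN := measurable_nfactor m c.
have mNa : measurable_fun setT (fun r => N (a * r)) := measurableT_comp mN (measurable_rscale a).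
have mNp : measurable_fun setT (fun p : momentum R => a / N (a * pnorm p)).
  apply: measurable_funM => //; apply: measurable_funV.
  exact: (measurableT_comp mNa (@measurable_pnorm R)).
apply: measurable_funM => //; apply: measurable_funM => //; apply: measurable_funM.
- exact: (measurableT_comp mNp measurable_fst).
- exact: (measurableT_comp mNp measurable_snd).
Qed.

Lemma measurable_al_br : measurable_fun setT (al_br m c).
Proof. by rewrite (_ : al_br m c = al_dil m c 1); [exact: measurable_al_dil|apply/funext => q; rewrite al_dil1]. Qed.

Lemma measurable_be_br : measurable_fun setT (be_br m c).
Proof. by rewrite (_ : be_br m c = be_dil m c 1); [exact: measurable_be_dil|apply/funext => q; rewrite be_dil1]. Qed.

Lemma measurable_dal a : a != 1 -> measurable_fun setT (dal m c a).
Proof.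
move=> an1; have a10 : a - 1 != 0 by rewrite subr_eq0.
rewrite (_ : dal m c a = fun q => (a - 1)^-1 * (al_dil m c a q - al_br m c q)).
  by apply: measurable_funM => //; apply: measurable_funB; [exact: measurable_al_dil|exact: measurable_al_br].
by apply/funext => q; rewrite (dal_eq m0 c0) mulKf.
Qed.

Lemma measurable_dbe a : a != 1 -> measurable_fun setT (dbe m c a).
Proof.
move=> an1; have a10 : a - 1 != 0 by rewrite subr_eq0.
rewrite (_ : dbe m c a = fun q => (a - 1)^-1 * (be_dil m c a q - be_br m c q)).
  by apply: measurable_funM => //; apply: measurable_funB; [exact: measurable_be_dil|exact: measurable_be_br].
by apply/funext => q; rewrite (dbe_eq m0 c0) mulKf.
Qed.

Lemma symbol_size_br q : symbol_size q (al_br m c q) (be_br m c q) <= 6.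
Proof.
have F2 r : `|F r| <= 2 by have /andP[h1 h2] := upper_bounds m0 c0 r; rewrite ger0_norm.
have g (p : momentum R) : 0 <= c * pnorm p * (N (pnorm p))^-1 <= 1.
  by have := lower_le1 m0 c0 (lexx 1) (pnorm_ge0 p); rewrite !mul1r.
have b1 : `|al_br m c q| <= 2 * 2 by rewrite normrM; apply: ler_pM.
have b2 : `|be_br m c q| * (pnorm q.1 * pnorm q.2) <= 1 * 1.
  rewrite -{1}(ger0_norm (mulr_ge0 (pnorm_ge0 q.1) (pnorm_ge0 q.2))) -normrM.
  rewrite (_ : be_br m c q * _ = (c * pnorm q.1 * (N (pnorm q.1))^-1) * (c * pnorm q.2 * (N (pnorm q.2))^-1)); last first.
    by rewrite /be_br invfM; ring.
  have /andP[h1 h2] := g q.1; have /andP[h3 h4] := g q.2.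
  by rewrite normrM !ger0_norm//; apply: ler_pM.
rewrite /symbol_size; lra.
Qed.

Lemma symbol_size_dil a q : 1 <= a <= 2 -> symbol_size q (al_dil m c a q) (be_dil m c a q) <= 106.
Proof.
move=> a12; have -> : al_dil m c a q = al_br m c q + (a - 1) * dal m c a q.
  by rewrite -(dal_eq m0 c0); ring.
have -> : be_dil m c a q = be_br m c q + (a - 1) * dbe m c a q.
  by rewrite -(dbe_eq m0 c0); ring.
have h1 := symbol_size_br q; have h2 := symbol_size_quotient m0 c0 q a12.
have /andP[a1 a2] := a12.
have key (x y : R) : `|(a - 1) * x| <= `|x|.
  by rewrite normrM ger0_norm ?subr_ge0// ler_piMl//; lra.
have pp : 0 <= pnorm q.1 * pnorm q.2 by rewrite mulr_ge0// pnorm_ge0.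
move: h1 h2; rewrite /symbol_size.
move: (al_br m c q) (be_br m c q) (dal m c a q) (dbe m c a q) => x y u v h1 h2.
have k1 := le_trans (ler_normD x ((a - 1) * u)) (lerD (lexx _) (key u 0)).
have k2 := le_trans (ler_normD y ((a - 1) * v)) (lerD (lexx _) (key v 0)).
have := ler_wpM2r pp k2; lra.
Qed.

Definition dilated a : spinor R := fun p => phi (dilate a p).

Lemma br_domain_dilated a : 0 < a -> br_domain (dilated a).
Proof. by move=> a0; exact: br_domain_dilate. Qed.

Definition overlap a := cintegral mu3 (fun p => inner (dilated a p) (phi p)).
Definition kinetic a := cintegral mu3 (fun p => (E (pnorm p))%:C * inner (dilated a p) (phi p)).
Definition kinetic_dil a := cintegral mu3 (fun p => (E (a * pnorm p))%:C * inner (dilated a p) (phi p)).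
Definition potential a := cintegral mu33 (fun q =>
  sandwich (dilated a q.1) (spin_kernel q.1 q.2 (al_br m c q) (be_br m c q)) (phi q.2)).
Definition potential_dil a := cintegral mu33 (fun q =>
  sandwich (dilated a q.1) (spin_kernel q.1 q.2 (al_dil m c a q) (be_dil m c a q)) (phi q.2)).

Lemma cintegrable_inner u v : br_domain u -> br_domain v -> cintegrable mu3 (fun p => inner (u p) (v p)).
Proof.
move=> du dv; have := @cintegrable_local _ (cst 1) 1 u v (measurable_cst _) _ du dv.
under eq_fun do rewrite /= rmorph1 mul1r.
by apply=> p; rewrite normr1 mul1r weight_ge1.
Qed.

Lemma cintegrable_kinetic u v : br_domain u -> br_domain v ->
  cintegrable mu3 (fun p => (E (pnorm p))%:C * inner (u p) (v p)).
Proof.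
move=> du dv; apply: (@cintegrable_local _ _ (c + e0)) => //.
  exact: (measurableT_comp (measurable_energy m c) (@measurable_pnorm R)).
by move=> p; rewrite ger0_norm ?energy_ge0// energy_le_weight.
Qed.

Lemma cintegrable_kernel u v : br_domain u -> br_domain v -> cintegrable mu33 (fun q =>
  sandwich (u q.1) (spin_kernel q.1 q.2 (al_br m c q) (be_br m c q)) (v q.2)).
Proof.
move=> du dv; apply: (@cintegrable_pairs _ _ _ 6) => //.
- exact: measurable_al_br.
- exact: measurable_be_br.
- exact: symbol_size_br.
Qed.

Variables (gam : R) (lambda : R[i]).
Hypothesis form : forall v, br_domain v ->
  L2_inner v (fun p => lambda *: phi p) =
  cintegral mu3 (fun p => (E (pnorm p))%:C * inner (v p) (phi p)) - gam%:C *
  cintegral mu33 (fun q => sandwich (v q.1) (Defs.kernel m c q.1 q.2) (phi q.2)).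

Lemma eigen_test v : br_domain v ->
  lambda * cintegral mu3 (fun p => inner (v p) (phi p)) =
  cintegral mu3 (fun p => (E (pnorm p))%:C * inner (v p) (phi p)) - gam%:C *
  cintegral mu33 (fun q =>
    sandwich (v q.1) (spin_kernel q.1 q.2 (al_br m c q) (be_br m c q)) (phi q.2)).
Proof.
move=> dv; have iX := cintegrable_inner dv dphi.
set J := cintegral mu33 _; set I := cintegral mu3 (fun p => _ * _).
pose A := cintegral mu33 (fun q => sandwich (v q.1) (Defs.kernel m c q.1 q.2) (phi q.2)).
have AJ : A = J by rewrite /A /J; apply: eq_cintegral => q; rewrite kernelE.
have LX : L2_inner v (fun p => lambda *: phi p) =
    lambda * cintegral mu3 (fun p => inner (v p) (phi p)).
  rewrite -(cintegralZ _ iX); apply: eq_cintegral => p; exact: innerZr.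
have := form dv; rewrite -/A -/I AJ LX; exact.
Qed.

Lemma eigen_dilated a : 0 < a -> lambda * overlap a = kinetic a - gam%:C * potential a.
Proof. by move=> a0; exact: (eigen_test (br_domain_dilated a0)). Qed.

Lemma dilatedK a p : 0 < a -> dilated a^-1 (dilate a p) = phi p.
Proof. by move=> a0; rewrite /dilated dilate_dilate mulVf ?gt_eqF// dilate1. Qed.

(** Here and in the next two lemmas the substitution p -> a p turns phi_{1/a} into
phi and phi into phi_a; conjugation then exchanges the two arguments. *)
Lemma overlap_inv a : 0 < a ->
  cintegral mu3 (fun p => inner (dilated a^-1 p) (phi p)) = (a ^+ 3)%:C * (overlap a)^*%C.
Proof.
move=> a0; have i0 : 0 < a^-1 by rewrite invr_gt0.
have k0 : 0 <= a ^- 3 by rewrite invr_ge0 exprn_ge0// ltW.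
have := cintegral_scales k0 (scales_lebesgue3 a0) (cintegrable_inner (br_domain_dilated i0) dphi).
rewrite (_ : (fun p => inner _ _) = fun p => (inner (dilated a p) (phi p))^*%C); last first.
  by apply/funext => p; rewrite inner_conj dilatedK.
rewrite cintegral_conj; last exact: cintegrable_inner (br_domain_dilated a0) dphi.
rewrite -/(overlap a) => ->; rewrite mulrA -rmorphM /= mulfV ?mul1r//.
by rewrite expf_neq0// gt_eqF.
Qed.

Lemma kinetic_inv a : 0 < a ->
  cintegral mu3 (fun p => (E (pnorm p))%:C * inner (dilated a^-1 p) (phi p)) =
  (a ^+ 3)%:C * (kinetic_dil a)^*%C.
Proof.
move=> a0; have i0 : 0 < a^-1 by rewrite invr_gt0.
have k0 : 0 <= a ^- 3 by rewrite invr_ge0 exprn_ge0// ltW.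
have := cintegral_scales k0 (scales_lebesgue3 a0) (cintegrable_kinetic (br_domain_dilated i0) dphi).
rewrite (_ : (fun p => _ * inner _ _) =
   fun p => ((E (a * pnorm p))%:C * inner (dilated a p) (phi p))^*%C); last first.
  apply/funext => p; rewrite rmorphM /= inner_conj dilatedK// (pnorm_dilate p (ltW a0)).
  by rewrite /= oppr0.
rewrite cintegral_conj; last first.
  apply: (@cintegrable_local _ _ ((1 + a) * (c + e0)) _ _ _ _ (br_domain_dilated a0) dphi).
    apply: (measurableT_comp (measurable_energy m c)).
    by apply: measurable_funM => //; exact: measurable_pnorm.
  move=> p; rewrite ger0_norm ?energy_ge0// -(pnorm_dilate p (ltW a0)).
  apply: (le_trans (energy_le_weight m0 c0 _)).
  rewrite [X in _ <= X * _]mulrC -mulrA; apply: ler_wpM2l.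
    by rewrite addr_ge0 ?energy_ge0// ltW.
  have := weight_le_dilate_gt0 (dilate a p) i0.
  by rewrite invrK dilate_dilate mulVf ?gt_eqF// dilate1.
rewrite -/(kinetic_dil a) => ->; rewrite mulrA -rmorphM /= mulfV ?mul1r//.
by rewrite expf_neq0// gt_eqF.
Qed.

(** The substitution p -> a p in both momenta has the Jacobian a^6, of which the
dilated kernel takes up a^3.  Conjugation exchanges the two momenta because
the kernel is Hermitian. *)
Lemma potential_inv a : 1 <= a <= 2 ->
  cintegral mu33 (fun q =>
    sandwich (dilated a^-1 q.1) (spin_kernel q.1 q.2 (al_br m c q) (be_br m c q)) (phi q.2)) =
  (a ^+ 3)%:C * (potential_dil a)^*%C.
Proof.
move=> a12; have a0 : 0 < a by have /andP[+ _] := a12; apply: lt_le_trans.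
have i0 : 0 < a^-1 by rewrite invr_gt0.
have k0 : 0 <= a ^- 6 by rewrite invr_ge0 exprn_ge0// ltW.
have a3 : a ^+ 3 != 0 by rewrite expf_neq0// gt_eqF.
have a6 : a ^- 6 != 0 by rewrite invr_eq0 expf_neq0// gt_eqF.
have := cintegral_scales k0 (scales_lebesgue33 a0) (cintegrable_kernel (br_domain_dilated i0) dphi).
pose G (q : pair) := sandwich (dilated a q.1) (spin_kernel q.1 q.2 (al_dil m c a q) (be_dil m c a q)) (phi q.2).
have iG : cintegrable mu33 G.
  apply: (@cintegrable_pairs _ _ _ 106 (dilated a) phi) => //.
  - exact: measurable_al_dil.
  - exact: measurable_be_dil.
  - by move=> q; exact: symbol_size_dil.
  - exact: br_domain_dilated.
rewrite (_ : (fun q => sandwich _ _ _) = fun q => (a ^- 3)%:C * (G (q.2, q.1))^*%C); last first.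
  apply/funext => q.
  have -> : spin_kernel (dilate a q.1) (dilate a q.2) (al_br m c (dilate a q.1, dilate a q.2))
      (be_br m c (dilate a q.1, dilate a q.2)) =
    (a ^- 3)%:C *: spin_kernel q.1 q.2 (al_dil m c a q) (be_dil m c a q).
    by rewrite -(kernel_dilate m0 c0)// scalerA -rmorphM /= mulVf// scale1r
      -(kernelE m c (dilate a q.1, dilate a q.2)).
  rewrite sandwichZ dilatedK// /G /=; congr (_ * _).
  have al_sym : al_dil m c a (q.2, q.1) = al_dil m c a q by rewrite /al_dil /= [F _ * _]mulrC.
  have be_sym : be_dil m c a (q.2, q.1) = be_dil m c a q by rewrite /be_dil /= [a / _ * _]mulrC.
  rewrite al_sym be_sym; apply/esym/sandwich_conj => i j; exact: spin_kernel_conj.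
have iGc := cintegrable_conj iG.
have iGs : cintegrable mu33 (fun q => (G (q.2, q.1))^*%C).
  have := @cintegrable_pairs _ (al_dil m c a) (be_dil m c a) 106 phi (dilated a)
    (measurable_al_dil a) (measurable_be_dil a) (fun q => symbol_size_dil q a12) dphi (br_domain_dilated a0).
  rewrite (_ : (fun q => sandwich _ _ _) = fun q => (G (q.2, q.1))^*%C)//.
  apply/funext => q; rewrite /G /=; apply/esym.
  have al_sym : al_dil m c a (q.2, q.1) = al_dil m c a q by rewrite /al_dil /= [F _ * _]mulrC.
  have be_sym : be_dil m c a (q.2, q.1) = be_dil m c a q by rewrite /be_dil /= [a / _ * _]mulrC.
  rewrite al_sym be_sym; apply: sandwich_conj => i j; exact: spin_kernel_conj.
set T := cintegral mu33 (fun q => sandwich _ _ _).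
have SW : cintegral mu33 (fun q => (G (q.2, q.1))^*%C) = (potential_dil a)^*%C.
  by rewrite -(cintegral_conj iG) -[RHS]mul1r; exact: (cintegral_scales ler01 (@scales_swap R) iGc).
rewrite (cintegralZ _ iGs) SW.
move=> H; apply: (mulfI (x := (a ^- 6)%:C)).
  by apply/eqP => -[] /eqP; apply/negP.
rewrite -H mulrA -rmorphM; congr (_%:C * _).
by field; rewrite gt_eqF.
Qed.

(** The common factor a^3 of the three integrals cancels. *)
Lemma eigen_dilated_dual a : 1 <= a <= 2 -> lambda^*%C * overlap a = kinetic_dil a - gam%:C * potential_dil a.
Proof.
move=> a12; have a0 : 0 < a by have /andP[+ _] := a12; apply: lt_le_trans.
have i0 : 0 < a^-1 by rewrite invr_gt0.
have a3 : (a ^+ 3)%:C != 0 by rewrite fmorph_eq0 expf_neq0// gt_eqF.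
have H := eigen_test (br_domain_dilated i0); rewrite (overlap_inv a0) (kinetic_inv a0) (potential_inv a12) in H.
have {}H : lambda * (overlap a)^*%C = (kinetic_dil a)^*%C - gam%:C * (potential_dil a)^*%C.
  by apply: (mulfI a3); rewrite mulrCA H mulrBr [in RHS](mulrCA _ gam%:C).
move/(congr1 (@conjc R)): H.
by rewrite /= rmorphB /= !rmorphM /= !conjcK /= oppr0.
Qed.

Lemma kinetic_diff a : 1 <= a <= 2 -> kinetic_dil a - kinetic a = (a - 1)%:C *
  cintegral mu3 (fun p => (dE m c a (pnorm p))%:C * inner (dilated a p) (phi p)).
Proof.
move=> a12; have a0 : 0 < a by have /andP[+ _] := a12; apply: lt_le_trans.
have iD : cintegrable mu3 (fun p => (dE m c a (pnorm p))%:C * inner (dilated a p) (phi p)).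
  apply: (@cintegrable_local _ _ (2 * (c + e0)) _ _ _ _ (br_domain_dilated a0) dphi).
    exact: (measurableT_comp (measurable_dE m c a) (@measurable_pnorm R)).
  move=> p; have /andP[d0 d1] := dE_bounds m0 c0 a12 (pnorm_ge0 p).
  rewrite ger0_norm// (le_trans d1)// -mulrA; apply: ler_wpM2l => //.
  exact: energy_le_weight.
have iE := cintegrable_kinetic (br_domain_dilated a0) dphi.
have H : kinetic_dil a = kinetic a + (a - 1)%:C *
  cintegral mu3 (fun p => (dE m c a (pnorm p))%:C * inner (dilated a p) (phi p)).
  rewrite -cintegralZ// -cintegralD//; last exact: cintegrableZ.
  apply: eq_cintegral => p; rewrite mulrA -mulrDl -rmorphM -rmorphD /=; congr (_%:C * _).
  by rewrite -(dE_eq m0 c0); ring.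
by rewrite H addrC addKr.
Qed.

Lemma potential_diff a : 1 <= a <= 2 -> potential_dil a - potential a = (a - 1)%:C *
  cintegral mu33 (fun q => sandwich (dilated a q.1)
    (spin_kernel q.1 q.2 (dal m c a q) (dbe m c a q)) (phi q.2)).
Proof.
move=> a12; have a0 : 0 < a by have /andP[+ _] := a12; apply: lt_le_trans.
have [->|an1] := eqVneq a 1.
  have -> : potential_dil 1 = potential 1 by apply: eq_cintegral => q; rewrite al_dil1 be_dil1.
  by rewrite !subrr mul0r.
have a10 : a - 1 != 0 by rewrite subr_eq0.
have iA : cintegrable mu33 (fun q => sandwich (dilated a q.1)
    (spin_kernel q.1 q.2 (al_dil m c a q) (be_dil m c a q)) (phi q.2)).
  apply: (@cintegrable_pairs _ _ _ 106 (dilated a) phi) => //.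
  - exact: measurable_al_dil.
  - exact: measurable_be_dil.
  - by move=> q; exact: symbol_size_dil.
  - exact: br_domain_dilated.
have iD : cintegrable mu33 (fun q => sandwich (dilated a q.1)
    (spin_kernel q.1 q.2 (dal m c a q) (dbe m c a q)) (phi q.2)).
  apply: (@cintegrable_pairs _ _ _ 100 (dilated a) phi) => //; last exact: br_domain_dilated.
  - exact: measurable_dal.
  - exact: measurable_dbe.
  - by move=> q; exact: symbol_size_quotient.
rewrite -(cintegralB iA (cintegrable_kernel (br_domain_dilated a0) dphi)) -(cintegralZ _ iD).
apply: eq_cintegral => q; rewrite -sandwichB spin_kernelB (dal_eq m0 c0) (dbe_eq m0 c0).
by rewrite -spin_kernelZ sandwichZ.
Qed.

Hypothesis phi_neq0 : ~ {ae mu3, forall p, phi p = 0}.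

Lemma overlap1E : overlap 1 = (L2_norm phi ^+ 2)%:C.
Proof.
rewrite /overlap /L2_norm sqr_sqrtr; last by apply: Rintegral_ge0 => p _; exact: sqnorm_ge0.
rewrite -cintegral_real; apply: eq_cintegral => p.
by rewrite /dilated dilate1 inner_self.
Qed.

Lemma overlap1_neq0 : overlap 1 != 0.
Proof.
apply/eqP => X0; apply: phi_neq0.
have mphi := br_domain_cmeasurable dphi.
have msq := measurable_sqnorm mphi.
have sq0 : Rintegral mu3 setT (fun p => sqnorm (phi p)) = 0.
  move: overlap1E; rewrite X0 /L2_norm sqr_sqrtr; first by move=> -[/esym].
  by apply: Rintegral_ge0 => p _; exact: sqnorm_ge0.
have i0 : (\int[mu3]_p (sqnorm (phi p))%:E)%E = 0%E.
  have [iX _] := cintegrable_inner dphi dphi.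
  rewrite (_ : (fun p => _) = fun p => (sqnorm (phi p))%:E) in iX; last first.
    by apply/funext => p; rewrite inner_self.
  by rewrite -(fineK (integrable_fin_num measurableT iX)) -/(Rintegral _ _ _) sq0.
have := (ae_eq_integral_abs mu3 measurableT (f := fun p => (sqnorm (phi p))%:E)
  (measurableT_comp (@EFin_measurable R setT) msq)).1.
under eq_integral => p _ do rewrite gee0_abs ?lee_fin ?sqnorm_ge0//.
move=> /(_ i0); apply: filterS => p /(_ I) /= [sqp].
apply/matrixP => i j; rewrite ord1 mxE.
apply: eq0_normc; apply/eqP; rewrite -sqrf_eq0.
move: sqp => /eqP; rewrite psumr_eq0; last by move=> k _; exact: sqr_ge0.
by move=> /allP /(_ i); rewrite mem_index_enum => /(_ isT).
Qed.

(** At [a = 1] the two forms of the eigenvalue equation coincide up to the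
conjugation of the eigenvalue. *)
Lemma lambda_real : lambda^*%C = lambda.
Proof.
have a12 : 1 <= (1 : R) <= 2 by rewrite lexx ler1n.
have H2 := eigen_dilated_dual a12; have H1 := eigen_dilated (@ltr01 R).
have E1 : kinetic_dil 1 = kinetic 1 by apply: eq_cintegral => p; rewrite mul1r.
have E2 : potential_dil 1 = potential 1 by apply: eq_cintegral => q; rewrite al_dil1 be_dil1.
by rewrite E1 E2 -H1 in H2; exact: (mulIf overlap1_neq0 H2).
Qed.

(** Both equations have the same left-hand side, so the difference of the right-hand
sides vanishes. *)
Lemma quotient_identity a : 1 <= a <= 2 -> a != 1 ->
  cintegral mu3 (fun p => (dE m c a (pnorm p))%:C * inner (dilated a p) (phi p)) =
  gam%:C * cintegral mu33 (fun q => sandwich (dilated a q.1)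
    (spin_kernel q.1 q.2 (dal m c a q) (dbe m c a q)) (phi q.2)).
Proof.
move=> a12 an1; have a0 : 0 < a by have /andP[+ _] := a12; apply: lt_le_trans.
have a10 : (a - 1)%:C != 0 by rewrite fmorph_eq0 subr_eq0.
apply: (mulfI a10); rewrite -kinetic_diff// mulrCA -potential_diff//.
have H2 := eigen_dilated_dual a12; have H1 := eigen_dilated a0; rewrite lambda_real in H2.
rewrite mulrBr; apply/eqP; rewrite -subr_eq0.
have -> : kinetic_dil a - kinetic a - (gam%:C * potential_dil a - gam%:C * potential a) =
  (kinetic_dil a - gam%:C * potential_dil a) - (kinetic a - gam%:C * potential a) by ring.
by rewrite -H1 -H2 subrr.
Qed.

Lemma measurable_bracket (s : R) : measurable_fun setT (fun q : pair =>
  (E (pnorm q.2))^-1 + s / E (pnorm q.2) ^+ 2 + ((E (pnorm q.1))^-1 + s / E (pnorm q.1) ^+ 2)).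
Proof.
have mE : measurable_fun setT (fun p : momentum R => E (pnorm p)).
  exact: (measurableT_comp (measurable_energy m c) (@measurable_pnorm R)).
have mb : measurable_fun setT (fun p : momentum R => (E (pnorm p))^-1 + s / E (pnorm p) ^+ 2).
  apply: measurable_funD; first exact: measurable_funV.
  by apply: measurable_funM => //; apply: measurable_funV; exact: measurable_funX.
apply: measurable_funD; first exact: (measurableT_comp mb measurable_snd).
exact: (measurableT_comp mb measurable_fst).
Qed.

Lemma measurable_bracket_al : measurable_fun setT (bracket_al m c).
Proof.
rewrite (_ : bracket_al m c = fun q => (E (pnorm q.2))^-1 + (- e0) / E (pnorm q.2) ^+ 2 +
  ((E (pnorm q.1))^-1 + (- e0) / E (pnorm q.1) ^+ 2)); first exact: measurable_bracket.
by apply/funext => q; rewrite /bracket_al !mulNr.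
Qed.

Lemma measurable_bracket_be : measurable_fun setT (bracket_be m c).
Proof. exact: measurable_bracket. Qed.

Lemma bracket_bounds q : `|e0 * bracket_al m c q| <= 4 /\ `|e0 * bracket_be m c q| <= 4.
Proof.
have e := energy0_gt0 m0 c0.
have b (p : momentum R) : 0 <= e0 / E (pnorm p) <= 1.
  have h := energy_ge_e0 c m0 (pnorm p); have Ep := energy_gt0 m0 c0 (pnorm p).
  by rewrite divr_ge0 ?energy_ge0//= ler_pdivrMr// mul1r.
have /andP[x0 x1] := b q.1; have /andP[y0 y1] := b q.2.
have -> : e0 * bracket_al m c q = e0 / E (pnorm q.2) - (e0 / E (pnorm q.2)) ^+ 2 +
    (e0 / E (pnorm q.1) - (e0 / E (pnorm q.1)) ^+ 2).
  by rewrite /bracket_al !exprMn -!exprVn; ring.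
have -> : e0 * bracket_be m c q = e0 / E (pnorm q.2) + (e0 / E (pnorm q.2)) ^+ 2 +
    (e0 / E (pnorm q.1) + (e0 / E (pnorm q.1)) ^+ 2).
  by rewrite /bracket_be !exprMn -!exprVn; ring.
move: (e0 / _) (e0 / _) x0 x1 y0 y1 => x y x0 x1 y0 y1.
have x2 : 0 <= x ^+ 2 <= 1 by rewrite sqr_ge0/= expr_le1.
have y2 : 0 <= y ^+ 2 <= 1 by rewrite sqr_ge0/= expr_le1.
move: x2 y2 => /andP[? ?] /andP[? ?].
by rewrite !ler_norml; split; apply/andP; split; lra.
Qed.

(** Both sides of [quotient_identity] converge as [a] tends to 1. *)
Lemma virial_theorem :
  cintegral mu3 (fun p => (c ^+ 2 * pnorm p ^+ 2 / E (pnorm p))%:C * inner (phi p) (phi p)) =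
  gam%:C * cintegral mu33 (fun q => sandwich (phi q.1)
    (spin_kernel q.1 q.2 (al_lim m c q) (be_lim m c q)) (phi q.2)).
Proof.
pose a_ (n : nat) : R := 1 + n.+1%:R^-1.
have a12 n : 1 <= a_ n <= 2.
  rewrite /a_ lerDl invr_ge0 ler0n/= (_ : 2 = 1 + 1 :> R)// lerD2l.
  by rewrite invf_le1// ler1n.
have an1 n : a_ n != 1 by rewrite /a_ -subr_eq0 addrC addKr invr_eq0 pnatr_eq0.
have a1 : a_ n @[n --> \oo] --> (1 : R).
  rewrite -[X in _ --> X]addr0; apply: cvgD; first exact: cvg_cst.
  exact: cvg_harmonic.
have mlim (f : nat -> pair -> R) (g : pair -> R) : (forall n, measurable_fun setT (f n)) ->
    (forall q, f n q @[n --> \oo] --> g q) -> measurable_fun setT g.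
  move=> mf fg; apply: (measurable_fun_cvg mf) => q _; exact: fg.
have mdal n := measurable_dal (an1 n).
have mdbe n := measurable_dbe (an1 n).
have lal q := @cvg_dal R m c m0 c0 a_ a1 q.
have lbe q := @cvg_dbe R m c m0 c0 a_ a1 q.
have mal := mlim _ _ mdal lal.
have mbe := mlim _ _ mdbe lbe.
have CC q : symbol_size q (al_lim m c q) (be_lim m c q) <= 18.
  have [h1 h2] := bracket_bounds q; have h3 := symbol_size_br q.
  have -> : al_lim m c q = al_br m c q - (e0 * bracket_al m c q) / 2 * al_br m c q by rewrite /al_lim; ring.
  have -> : be_lim m c q = be_br m c q + (e0 * bracket_be m c q) / 2 * be_br m c q by rewrite /be_lim; ring.
  move: h1 h2 h3; rewrite /symbol_size.
  move: (e0 * bracket_al m c q) (e0 * bracket_be m c q) (al_br m c q) (be_br m c q) => s t x y s4 t4 h.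
  have pp : 0 <= pnorm q.1 * pnorm q.2 by rewrite mulr_ge0// pnorm_ge0.
  have h1 : `|x - s / 2 * x| <= 3 * `|x|.
    rewrite (le_trans (ler_normB _ _))// !normrM (ger0_norm (x := 2^-1))//.
    have := ler_wpM2r (normr_ge0 x) s4; lra.
  have h2 : `|y + t / 2 * y| <= 3 * `|y|.
    rewrite (le_trans (ler_normD _ _))// !normrM (ger0_norm (x := 2^-1))//.
    have := ler_wpM2r (normr_ge0 y) t4; lra.
  have := ler_wpM2r pp h2; lra.
pose W p := c ^+ 2 * pnorm p ^+ 2 / E (pnorm p).
have mE : measurable_fun setT (fun p : momentum R => E (pnorm p)).
  exact: (measurableT_comp (measurable_energy m c) (@measurable_pnorm R)).
have mp := @measurable_pnorm R.
have mW : measurable_fun setT W.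
  apply: measurable_funM; last exact: measurable_funV.
  by apply: measurable_funM => //; exact: measurable_funX.
have WC p : `|W p| <= 2 * (c + e0) * weight p.
  have Ep := energy_gt0 m0 c0 (pnorm p); have El := energy_le_weight m0 c0 p.
  have E2 := energy_sqr c m0 (pnorm p); have e02 := sqr_ge0 e0.
  have W0 : 0 <= W p by apply: divr_ge0; [apply: mulr_ge0; exact: sqr_ge0|exact: ltW].
  rewrite ger0_norm//; apply: (@le_trans _ _ (E (pnorm p))).
    by rewrite /W ler_pdivrMr// -expr2 E2 lerDl.
  apply: (le_trans El); rewrite -mulrA ler_peMl ?ler1n// mulr_ge0 ?weight_ge0//.
  by rewrite addr_ge0 ?energy_ge0// ltW.
have dC n p : `|dE m c (a_ n) (pnorm p)| <= 2 * (c + e0) * weight p.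
  have /andP[d0 d1] := dE_bounds m0 c0 (a12 n) (pnorm_ge0 p).
  rewrite ger0_norm// (le_trans d1)// -mulrA; apply: ler_wpM2l => //.
  exact: energy_le_weight.
have L1 := @cvg_local R phi a_ (fun n p => dE m c (a_ n) (pnorm p)) W (2 * (c + e0)) dphi a12 a1
  (fun n => measurableT_comp (measurable_dE m c (a_ n)) mp) mW dC WC
  (fun p => @cvg_dE R m c m0 c0 a_ a1 (pnorm p)).
have CC' q : symbol_size q (al_lim m c q) (be_lim m c q) <= 100.
  by apply: le_trans (CC q) _; rewrite ler_nat.
have L2 := @cvg_pairs R phi a_ (fun n => dal m c (a_ n)) (fun n => dbe m c (a_ n))
  (al_lim m c) (be_lim m c) 100 dphi a12 a1 mdal mdbe mal mbe
  (fun n q => symbol_size_quotient m0 c0 q (a12 n)) CC' lal lbe.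
have key (A B A' B' : R[i]) (e : R) : A' = gam%:C * B' -> normc (A' - A) <= e ->
    normc (B' - B) <= e -> normc (A - gam%:C * B) <= (1 + `|gam|) * e.
  move=> AB hA hB; have -> : A - gam%:C * B = gam%:C * (B' - B) - (A' - A) by rewrite AB; ring.
  apply: (le_trans (le_normcD _ _)); rewrite normcN normcM normc_real.
  have := ler_wpM2l (normr_ge0 gam) hB; lra.
apply/eqP; rewrite -subr_eq0; apply/eqP; apply: eq0_normc.
apply/eqP; rewrite eq_le normc_ge0 andbT.
apply/ler_addgt0Pr => e ep; rewrite add0r.
have g0 : 0 < 1 + `|gam| by rewrite ltr_pwDl.
have eg : 0 < e / (1 + `|gam|) by rewrite divr_gt0.
have [n [h1 h2]] := filter_ex (filterI (L1 _ eg) (L2 _ eg)).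
apply: (le_trans (key _ _ _ _ _ (quotient_identity (a12 n) (an1 n)) h1 h2)).
by rewrite mulrCA mulfV ?mulr1// gt_eqF.
Qed.

End dilated_identities.

(** * The virial identity *)

Section virial_identity.
Context {R : realType}.
Variables (m c : R).
Hypotheses (m0 : 0 < m) (c0 : 0 < c).
Opaque cintegral spin_kernel sandwich inner.
Notation mu3 := (@lebesgue3 R).
Notation mu33 := (@lebesgue33 R).
Notation pair := (momentum R * momentum R)%type.
Notation E := (energy m c).
Notation e0 := (energy m c 0).
Variable phi : spinor R.
Hypothesis dphi : br_domain phi.

Lemma bracket_size q :
  symbol_size q (bracket_al m c q * al_br m c q) 0 <= 24 / e0 /\
  symbol_size q 0 (bracket_be m c q * be_br m c q) <= 24 / e0.
Proof.
have e := energy0_gt0 m0 c0; have e' := ltW e.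
have [] := bracket_bounds m0 c0 q; rewrite !normrM (ger0_norm e'); have := symbol_size_br m0 c0 q.
rewrite /symbol_size normr0 !mul0r mulr0 addr0 add0r !ler_pdivlMr//.
move: (bracket_al _ _ _) (bracket_be _ _ _) (al_br _ _ _) (be_br _ _ _) => s t x y s6 b1 b2.
have pp : 0 <= pnorm q.1 * pnorm q.2 by rewrite mulr_ge0// pnorm_ge0.
have y0 : 0 <= `|y| * (pnorm q.1 * pnorm q.2) by exact: mulr_ge0.
have k1 := ler_wpM2r (normr_ge0 x) b1; have k2 := ler_wpM2r y0 b2.
rewrite !normrM; split.
  by rewrite (_ : _ * e0 = e0 * `|s| * `|x|); [lra|ring].
rewrite (_ : _ * e0 = 2 * (e0 * `|t| * (`|y| * (pnorm q.1 * pnorm q.2)))); [|ring].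
have := normr_ge0 x; lra.
Qed.

(** The integrands of the two double integrals of the theorem, as spin kernels. *)
Definition virial1 (q : pair) : R[i] :=
  sandwich (phi q.1) (spin_kernel q.1 q.2 (bracket_al m c q * al_br m c q) 0) (phi q.2).
Definition virial2 (q : pair) : R[i] :=
  sandwich (phi q.1) (spin_kernel q.1 q.2 0 (bracket_be m c q * be_br m c q)) (phi q.2).

Lemma virial1_integrable : cintegrable mu33 virial1.
Proof.
apply: (@cintegrable_pairs _ _ _ (24 / e0)) => //.
- by apply: measurable_funM; [exact: measurable_bracket_al|exact: measurable_al_br].
- by move=> q; have [] := bracket_size q.
Qed.

Lemma virial2_integrable : cintegrable mu33 virial2.
Proof.
apply: (@cintegrable_pairs _ _ _ (24 / e0)) => //.
- by apply: measurable_funM; [exact: measurable_bracket_be|exact: measurable_be_br].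
- by move=> q; have [] := bracket_size q.
Qed.

Lemma sandwich_spin_scale v (p' p : momentum R) (al be a : R) u :
  sandwich v (spin_kernel p' p al be) u * a%:C =
  sandwich v (spin_kernel p' p (a * al) (a * be)) u.
Proof. by rewrite -spin_kernelZ sandwichZ mulrC. Qed.

Lemma sandwich_spin_perturb v (p' p : momentum R) (al be x y k : R) u :
  sandwich v (spin_kernel p' p (al - k * x) (be + k * y)) u =
  sandwich v (spin_kernel p' p al be) u +
  (k%:C * sandwich v (spin_kernel p' p 0 y) u - k%:C * sandwich v (spin_kernel p' p x 0) u).
Proof.
have -> : spin_kernel p' p (al - k * x) (be + k * y) = spin_kernel p' p al be +
    (k%:C *: spin_kernel p' p 0 y - k%:C *: spin_kernel p' p x 0).
  rewrite !spin_kernelZ spin_kernelB.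
  rewrite -[LHS](subrK (spin_kernel p' p al be)) spin_kernelB addrC.
  rewrite (_ : al - k * x - al = k * 0 - k * x); last by ring.
  by rewrite (_ : be + k * y - be = k * y - k * 0); last by ring.
move: (spin_kernel _ _ _ _) (spin_kernel _ _ _ _) (spin_kernel _ _ _ _) => A B C.
by rewrite (sandwichD v C) (sandwichB v (k%:C *: B)) (sandwichZ _ v B) (sandwichZ _ v A).
Qed.

Lemma virial1E q : virial1 q = sandwich (phi q.1) (kernel1 m c q.1 q.2) (phi q.2) *
  (1 / E (pnorm q.2) - e0 / E (pnorm q.2) ^+ 2 + 1 / E (pnorm q.1) - e0 / E (pnorm q.1) ^+ 2)%:C.
Proof.
rewrite kernel1E sandwich_spin_scale mulr0 /virial1.
by rewrite /bracket_al !div1r !addrA.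
Qed.

Lemma virial2E q : virial2 q = sandwich (phi q.1) (kernel2 m c q.1 q.2) (phi q.2) *
  (1 / E (pnorm q.2) + e0 / E (pnorm q.2) ^+ 2 + 1 / E (pnorm q.1) + e0 / E (pnorm q.1) ^+ 2)%:C.
Proof.
rewrite kernel2E sandwich_spin_scale mulr0 /virial2.
by rewrite /bracket_be !div1r !addrA.
Qed.

Definition rest_density (p : momentum R) : R := e0 ^+ 2 / E (pnorm p) * sqnorm (phi p).

Lemma rest_densityE p : (e0 ^+ 2 / E (pnorm p))%:C * inner (phi p) (phi p) = (rest_density p)%:C.
Proof. by rewrite inner_self -rmorphM. Qed.

Lemma cintegrable_rest_density :
  cintegrable mu3 (fun p => (e0 ^+ 2 / E (pnorm p))%:C * inner (phi p) (phi p)).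
Proof.
have e := energy0_gt0 m0 c0.
apply: (@cintegrable_local _ _ e0) => //.
  apply: measurable_funM => //; apply: measurable_funV.
  exact: (measurableT_comp (measurable_energy m c) (@measurable_pnorm R)).
move=> p; have Ep := energy_gt0 m0 c0 (pnorm p).
rewrite ger0_norm; last by apply: divr_ge0; [exact: sqr_ge0|exact: ltW].
rewrite ler_pdivrMr// expr2 -mulrA ler_pM2l//.
apply: (le_trans (energy_ge_e0 c m0 (pnorm p))).
by rewrite ler_peMl ?weight_ge1// ltW.
Qed.

Variables (gam : R) (lambda : R[i]).
Hypothesis form : forall v, br_domain v ->
  L2_inner v (fun p => lambda *: phi p) =
  cintegral mu3 (fun p => (E (pnorm p))%:C * inner (v p) (phi p)) - gam%:C *
  cintegral mu33 (fun q => sandwich (v q.1) (Defs.kernel m c q.1 q.2) (phi q.2)).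
Hypothesis phi_neq0 : ~ {ae mu3, forall p, phi p = 0}.

(** e = e(0)^2 / e + c^2 p^2 / e, and the last term is the one that the virial theorem
evaluates. *)
Lemma kinetic_split : kinetic m c phi 1 = (Rintegral mu3 setT rest_density)%:C +
  cintegral mu3 (fun p => (c ^+ 2 * pnorm p ^+ 2 / E (pnorm p))%:C * inner (phi p) (phi p)).
Proof.
have iE := cintegrable_kinetic m0 c0 dphi dphi.
have iF := cintegrable_rest_density.
have -> : (Rintegral mu3 setT rest_density)%:C =
    cintegral mu3 (fun p => (e0 ^+ 2 / E (pnorm p))%:C * inner (phi p) (phi p)).
  by rewrite -cintegral_real; apply: eq_cintegral => p; rewrite rest_densityE.
have -> : kinetic m c phi 1 = cintegral mu3 (fun p => (E (pnorm p))%:C * inner (phi p) (phi p)).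
  by apply: eq_cintegral => p; rewrite /dilated dilate1.
apply: (addIr (- cintegral mu3 (fun p => (e0 ^+ 2 / E (pnorm p))%:C * inner (phi p) (phi p)))).
rewrite addrAC subrr add0r -(cintegralB iE iF).
apply: eq_cintegral => p; rewrite -mulrBl -rmorphB; congr (_%:C * _).
have Ep := energy_gt0 m0 c0 (pnorm p); have E2 := energy_sqr c m0 (pnorm p).
by rewrite -[X in X - _](mulfK (negbT (gt_eqF Ep))) -expr2 E2 -mulrBl addrK.
Qed.

(** Here the derivative of the dilated kernel at 1, with K removed, becomes the
combination of K^1 and K^2 that occurs in the theorem. *)
Lemma potential_derivative :
  cintegral mu33 (fun q => sandwich (phi q.1)
    (spin_kernel q.1 q.2 (al_lim m c q) (be_lim m c q)) (phi q.2)) - potential m c phi 1 =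
  (e0 / 2)%:C * cintegral mu33 virial2 - (e0 / 2)%:C * cintegral mu33 virial1.
Proof.
have iK := cintegrable_kernel m0 c0 dphi dphi; have i1 := virial1_integrable; have i2 := virial2_integrable.
pose L q := sandwich (phi q.1) (spin_kernel q.1 q.2 (al_lim m c q) (be_lim m c q)) (phi q.2).
pose K0 q := sandwich (phi q.1) (spin_kernel q.1 q.2 (al_br m c q) (be_br m c q)) (phi q.2).
have LE q : L q = K0 q + ((e0 / 2)%:C * virial2 q - (e0 / 2)%:C * virial1 q).
  rewrite /L /K0 /virial1 /virial2 -sandwich_spin_perturb.
  have -> : al_lim m c q = al_br m c q - e0 / 2 * (bracket_al m c q * al_br m c q).
    by rewrite /al_lim mulrA.
  have -> // : be_lim m c q = be_br m c q + e0 / 2 * (bracket_be m c q * be_br m c q).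
  by rewrite /be_lim mulrA.
have EK : potential m c phi 1 = cintegral mu33 K0.
  by apply: eq_cintegral => q; rewrite /dilated dilate1.
have j1 := cintegrableZ (e0 / 2)%:C i1; have j2 := cintegrableZ (e0 / 2)%:C i2.
have iB : cintegrable mu33 (fun q => (e0 / 2)%:C * virial2 q - (e0 / 2)%:C * virial1 q).
  rewrite (_ : (fun q => _) = fun q => (e0 / 2)%:C * virial2 q + (-1) * ((e0 / 2)%:C * virial1 q)).
    exact: cintegrableD j2 (cintegrableZ (-1) j1).
  by apply/funext => q; rewrite mulN1r.
rewrite EK; apply: etrans (congr1 (fun z => z - cintegral mu33 K0) (eq_cintegral _ LE)) _.
rewrite (cintegralD iK iB) addrAC subrr add0r.
exact: etrans (cintegralB j2 j1) (congr2 (fun z w => z - w) (cintegralZ _ i2) (cintegralZ _ i1)).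
Qed.

Lemma virial_identity : lambda * (L2_norm phi ^+ 2)%:C =
  (Rintegral mu3 setT rest_density)%:C - (gam / 2 * e0)%:C * cintegral mu33 virial1
  + (gam / 2 * e0)%:C * cintegral mu33 virial2.
Proof.
have H1 := eigen_dilated dphi form (@ltr01 R).
have H2 := virial_theorem m0 c0 dphi form phi_neq0.
have H3 := potential_derivative; have H4 := kinetic_split.
rewrite overlap1E H4 H2 in H1.
rewrite H1 -!addrA -mulrBr H3; congr (_ + _).
have -> : (gam / 2 * e0)%:C = gam%:C * (e0 / 2)%:C by rewrite -rmorphM; congr (_%:C); ring.
have alg (V1 V2 g e : R[i]) : g * (e * V2 - e * V1) = - (g * e * V1) + g * e * V2.
  by rewrite mulrBr !mulrA addrC.
exact: alg.
Qed.

End virial_identity.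

Theorem theorem2p2 (R : realType) (m c alpha Z : R)
    (m_gt0 : 0 < m) (c_gt0 : 0 < c) (alpha_gt0 : 0 < alpha)
    (Z_gt0 : 0 < Z) (Z_lt : Z < critical_charge alpha)
    (lambda : R[i]) (phi : spinor R)
    (phi_eigen : eigenvector (brown_ravenhall m c alpha Z) lambda phi) :
  let e (p : momentum R) := energy m c (pnorm p) in
  let e0 := energy m c 0 in
  let gamma := br_gamma c alpha Z in
  let F0 (p : momentum R) := e0 ^+ 2 / e p * sqnorm (phi p) in
  let F1 (q : momentum R * momentum R) :=
    let: (p', p) := q in
    sandwich (phi p') (kernel1 m c p' p) (phi p) *
    (1 / e p - e0 / e p ^+ 2 + 1 / e p' - e0 / e p' ^+ 2)%:C in
  let F2 (q : momentum R * momentum R) :=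
    let: (p', p) := q in
    sandwich (phi p') (kernel2 m c p' p) (phi p) *
    (1 / e p + e0 / e p ^+ 2 + 1 / e p' + e0 / e p' ^+ 2)%:C in
  [/\ (@lebesgue3 R).-integrable setT (EFin \o F0),
      cintegrable (@lebesgue33 R) F1,
      cintegrable (@lebesgue33 R) F2
    & lambda * (L2_norm phi ^+ 2)%:C =
      (Rintegral (@lebesgue3 R) setT F0)%:C
      - (gamma / 2 * e0)%:C * cintegral (@lebesgue33 R) F1
      + (gamma / 2 * e0)%:C * cintegral (@lebesgue33 R) F2].
Proof.
move=> e e0 gamma F0 F1 F2.
have [[dphi _ form] phi_neq0] := phi_eigen.
have F1E : F1 = virial1 m c phi.
  by apply/funext => -[p' p]; rewrite virial1E.
have F2E : F2 = virial2 m c phi.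
  by apply/funext => -[p' p]; rewrite virial2E.
rewrite F1E F2E; split.
- have [iF _] := cintegrable_rest_density m_gt0 c_gt0 dphi.
  rewrite (_ : EFin \o F0 = fun p => (complex.Re ((rest_density m c phi p)%:C))%:E)//.
  by under eq_fun do rewrite -rest_densityE.
- exact: virial1_integrable.
- exact: virial2_integrable.
exact: (virial_identity m_gt0 c_gt0 dphi form phi_neq0).
Qed.
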